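(* Let $N\ge 2$, let $\Omega\subset\mathbb{R}^N$ be a bounded smooth domain, let $a>0$, $b>0$, $0<\alpha<\frac{2^*-1}{2}$ and $2\alpha+1<p<2^*$. Let $h:\overline\Omega\times\mathbb{R}\times\mathbb{R}^N\to\mathbb{R}$, $(x,s,\xi)\mapsto h(x,s,\xi)$, satisfy: - for $s>0$, $h(x,s,\xi)$ is Hölder continuous and $h(x,s,\xi)\ge 0$; - there is a constant $\lambda>0$ such that $\lim_{s\to 0^+}\frac{h(x,s,\xi)}{s}=\lambda$ uniformly in $x$ and $\xi$, and there are constants $C>0$ and $q$ with $1<q<p$ such that $|h(x,s,\xi)|\le C(s+s^q)$ for all $s>0$ and all $x,\xi$. Assume moreover that $\lambda<a\lambda_1(\Omega)$. For $t\in[0,1]$ consider the problem $$(P_t)\qquad -(a+tb\|\nabla u\|_2^{2\alpha})\Delta u=u^p+t\,h(x,u,\nabla u)\ \text{ in }\Omega,\qquad u>0\ \text{ in }\Omega,\qquad u=0\ \text{ on }\partial\Omega .$$ Then there exist positive constants $r$ and $R$, independent of $t\in[0,1]$ and of the solution, such that every solution $u\in C^2(\Omega)\cap C(\overline\Omega)$ of $(P_t)$ satisfies $r\le\|u\|_{C(\Omega)}\le R$.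
   Context: $\|\nabla u\|_2$ is the $L^2(\Omega)$ norm of $|\nabla u|$ (finite for solutions). $\|u\|_{C(\Omega)}=\sup_{x\in\Omega}|u(x)|$. $\lambda_1(\Omega)$ is the first eigenvalue of $-\Delta$ on $\Omega$ with zero Dirichlet boundary condition. $2^*=+\infty$ if $N=2$ and $2^*=\frac{N+2}{N-2}$ if $N\ge 3$. *)

(* Defs.v *)
From HB Require Import structures.
From mathcomp Require Import all_boot all_order all_algebra.
From mathcomp Require Import all_classical all_reals all_analysis.
Set Implicit Arguments.
Unset Strict Implicit.
Unset Printing Implicit Defensive.
Import Order.TTheory GRing.Theory Num.Theory.
Import numFieldNormedType.Exports.
Local Open Scope classical_set_scope.
Local Open Scope ring_scope.

(* The norm that the library puts on 'rV[R]_n is the sup norm: it is used only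
   for topological and metric notions that do not depend on the choice of a
   norm. The length of the gradient is Euclidean. *)
Definition enorm (R : realType) (n : nat) (x : 'rV[R]_n) : R :=
  Num.sqrt (\sum_i x ord0 i ^+ 2).

Definition partial (R : realType) (n : nat) (i : 'I_n) (f : 'rV[R]_n -> R) :
    'rV[R]_n -> R :=
  fun x => 'D_(delta_mx ord0 i) f x.

Definition grad (R : realType) (n : nat) (f : 'rV[R]_n -> R) (x : 'rV[R]_n) :
    'rV[R]_n :=
  \row_i partial i f x.

Definition laplacian (R : realType) (n : nat) (f : 'rV[R]_n -> R)
    (x : 'rV[R]_n) : R :=
  \sum_i partial i (partial i f) x.

Definition iter_partial (R : realType) (n : nat) (s : seq 'I_n)
    (f : 'rV[R]_n -> R) : 'rV[R]_n -> R :=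
  foldr (@partial R n) f s.

(* For A open: all partial derivatives of f of order at most k exist and are
   continuous in A. The values of f outside A are irrelevant. *)
Definition Ck_on (R : realType) (n k : nat) (A : set 'rV[R]_n)
    (f : 'rV[R]_n -> R) : Prop :=
  forall s : seq 'I_n, (size s <= k)%N ->
    {within A, continuous (iter_partial s f)} /\
    ((size s < k)%N -> forall x, A x -> forall i,
        derivable (iter_partial s f) x (delta_mx ord0 i)).

Definition smooth (R : realType) (n : nat) (f : 'rV[R]_n -> R) : Prop :=
  forall k, Ck_on k setT f.

Definition boundary (T : topologicalType) (A : set T) : set T :=
  closure A `\` interior A.

(* Near each of its points, up to the choice of a coordinate axis i and of an
   orientation b of it, the boundary is the graph of a C^infinity function of
   the N - 1 other coordinates, and Omega is the part above the graph. *)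
Definition smooth_boundary (R : realType) (N : nat) (Omega : set 'rV[R]_N) :
    Prop :=
  forall x0, boundary Omega x0 ->
    exists (i : 'I_N) (b : bool) (g : 'rV[R]_N.-1 -> R) (r : R),
      [/\ 0 < r, smooth g &
          forall x, ball x0 r x ->
            (Omega x <-> g (col' i x) < (-1) ^+ b * x ord0 i)].

Definition bounded_smooth_domain (R : realType) (N : nat)
    (Omega : set 'rV[R]_N) : Prop :=
  [/\ open Omega, connected Omega, Omega !=set0, bounded_set Omega &
      smooth_boundary Omega].

(* u belongs to C^2(Omega) and to C(closure Omega), and u = 0 on the boundary *)
Definition classical_dirichlet (R : realType) (N : nat) (Omega : set 'rV[R]_N)
    (u : 'rV[R]_N -> R) : Prop :=
  [/\ Ck_on 2 Omega u, {within closure Omega, continuous u} &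
      forall x, boundary Omega x -> u x = 0].

Definition dirichlet_eigenvalue (R : realType) (N : nat)
    (Omega : set 'rV[R]_N) (mu : R) : Prop :=
  exists phi : 'rV[R]_N -> R,
    [/\ classical_dirichlet Omega phi,
        exists2 x, Omega x & phi x != 0 &
        forall x, Omega x -> - laplacian phi x = mu * phi x].

Definition lambda1 (R : realType) (N : nat) (Omega : set 'rV[R]_N) : R :=
  inf [set mu | dirichlet_eigenvalue Omega mu].

Definition cons_pair (R : realType) (n : nat)
    (z : measurableTypeR R * n.-tuple (measurableTypeR R)) :
    n.+1.-tuple (measurableTypeR R) :=
  [the n.+1.-tuple (measurableTypeR R) of z.1 :: z.2].

Lemma measurable_cons_pair (R : realType) (n : nat) :
  measurable_fun [set: measurableTypeR R * n.-tuple (measurableTypeR R)]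
    (@cons_pair R n).
Proof.
exact: measurable_cons measurable_fst measurable_snd.
Qed.

Section leb_step.
Variables (R : realType) (n : nat).
Local Notation T := (measurableTypeR R).
Variable m : {sigma_finite_measure set (n.-tuple T) -> \bar R}.

Let mu1 : {sigma_finite_measure set T -> \bar R} := @lebesgue_measure R.

Let mu : {measure set (T * n.-tuple T)%type -> \bar R} := (mu1 \x m)%E.

Definition leb_step : set (n.+1.-tuple T) -> \bar R :=
  pushforward mu (@cons_pair R n).

Let mF (A : set (n.+1.-tuple T)) :
  measurable A -> measurable (@cons_pair R n @^-1` A).
Proof.
by move=> mA; rewrite -[X in measurable X]setTI; exact: measurable_cons_pair.
Qed.

Let leb_step0 : leb_step set0 = 0%E.
Proof. by rewrite /leb_step /pushforward preimage_set0 measure0. Qed.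

Let leb_step_ge0 A : (0 <= leb_step A)%E.
Proof. by rewrite /leb_step /pushforward; exact: measure_ge0. Qed.

Let leb_step_sigma_additive : semi_sigma_additive leb_step.
Proof.
move=> F mFn tF mUF; rewrite /leb_step /pushforward preimage_bigcup.
apply: measure_semi_sigma_additive.
- by move=> k; exact: mF.
- apply/trivIsetP => /= i j _ _ ij; rewrite -preimage_setI.
  by move/trivIsetP : tF => /(_ _ _ _ _ ij) ->//; rewrite preimage_set0.
- by rewrite -preimage_bigcup; exact: mF.
Qed.

HB.instance Definition _ := isMeasure.Build _ _ _ leb_step
  leb_step0 leb_step_ge0 leb_step_sigma_additive.

Let uncons (t : n.+1.-tuple T) : (T * n.-tuple T)%type :=
  (thead t, [tuple of behead t]).

Let measurable_uncons : measurable_fun setT uncons.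
Proof.
apply/measurable_fun_pairP; split => /=.
- exact: measurable_tnth.
- exact: measurable_behead.
Qed.

Let leb_step_sigma_finite : sigma_finite setT leb_step.
Proof.
have /sigma_finiteP[F [TF ndF Foo]] := sigma_finiteT mu1.
have /sigma_finiteP[G [TG ndG Goo]] := sigma_finiteT m.
have consK : cancel (@cons_pair R n) uncons.
  by move=> [x t]; rewrite /uncons /cons_pair /=; congr pair; exact/val_inj.
exists (fun k => uncons @^-1` (F k `*` G k)).
  rewrite -preimage_bigcup -[LHS](preimage_setT uncons); congr preimage.
  rewrite -setXTT TF TG predeqE => -[x y]; split.
    move=> [/= [i _ Fix] [k _ Gky]]; exists (maxn i k) => //; split.
    - by move: x Fix; exact/subsetPset/ndF/leq_maxl.
    - by move: y Gky; exact/subsetPset/ndG/leq_maxr.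
  by move=> [i _ []/= ? ?]; split; exists i.
move=> k; have [mFk Fkoo] := Foo k; have [mGk Gkoo] := Goo k; split.
  rewrite -[X in measurable X]setTI; apply: measurable_uncons => //.
  exact: measurableX.
rewrite /leb_step /pushforward -comp_preimage.
have -> : uncons \o @cons_pair R n = id by apply/funext => z /=; rewrite consK.
by rewrite preimage_id /mu /= product_measure1E// lte_mul_pinfty// ge0_fin_numE.
Qed.

HB.instance Definition _ := Measure_isSigmaFinite.Build _ _ _ leb_step
  leb_step_sigma_finite.
End leb_step.

(* The Lebesgue measure of R^n: the n-fold product of the Lebesgue measure of
   the line, on the product sigma-algebra of n.-tuple R. *)
Fixpoint leb (R : realType) (n : nat) :
    {sigma_finite_measure set (n.-tuple (measurableTypeR R)) -> \bar R} :=
  match n with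
  | 0 => dirac ([tuple] : 0.-tuple (measurableTypeR R))
  | n'.+1 => leb_step (leb R n')
  end.

Definition rv_of_tuple (R : realType) (n : nat)
    (t : n.-tuple (measurableTypeR R)) : 'rV[R]_n :=
  \row_i tnth t i.

(* || grad u ||_2, possibly infinite *)
Definition grad_L2norm (R : realType) (N : nat) (Omega : set 'rV[R]_N)
    (u : 'rV[R]_N -> R) : \bar R :=
  Lnorm (leb R N) 2%:E
    ((fun t => (enorm (grad u (rv_of_tuple t)))%:E)
       \_ (@rv_of_tuple R N @^-1` Omega)).

(* Called 2^* here, but it is the exponent (N + 2) / (N - 2), not the Sobolev
   exponent 2 N / (N - 2). *)
Definition two_star (R : realType) (N : nat) : \bar R :=
  if N == 2%N then +oo%E else ((N%:R + 2) / (N%:R - 2))%:E.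
Arguments two_star R N : clear implicits.

(* h x s xi, as a function of (x, s, xi) in closure Omega x ]0, +oo[ x R^N, is
   Hoelder continuous on compact subsets. A uniform Hoelder condition on this
   unbounded set is a stronger requirement. *)
Definition holder_pos (R : realType) (N : nat) (Omega : set 'rV[R]_N)
    (h : 'rV[R]_N -> R -> 'rV[R]_N -> R) : Prop :=
  forall K : set ('rV[R]_N * R * 'rV[R]_N)%type,
    compact K ->
    (forall z, K z -> closure Omega z.1.1 /\ 0 < z.1.2) ->
    exists theta C : R, [/\ 0 < theta, theta <= 1, 0 <= C &
      forall z w, K z -> K w ->
        `|h z.1.1 z.1.2 z.2 - h w.1.1 w.1.2 w.2| <= C * `|z - w| `^ theta].

(* - (a + t b || grad u ||_2^(2 alpha)) Laplacian u = u^p + t h(x, u, grad u);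
   for the equation to make sense || grad u ||_2 has to be finite. *)
Definition solution (R : realType) (N : nat) (Omega : set 'rV[R]_N)
    (a b alpha p : R) (h : 'rV[R]_N -> R -> 'rV[R]_N -> R) (t : R)
    (u : 'rV[R]_N -> R) : Prop :=
  [/\ classical_dirichlet Omega u,
      forall x, Omega x -> 0 < u x,
      (grad_L2norm Omega u < +oo)%E &
      forall x, Omega x ->
        - (a + t * b * fine (grad_L2norm Omega u) `^ (2 * alpha))
          * laplacian u x
        = u x `^ p + t * h x (u x) (grad u x)].

Definition supnorm (R : realType) (N : nat) (Omega : set 'rV[R]_N)
    (u : 'rV[R]_N -> R) : \bar R :=
  ereal_sup [set (`|u x|)%:E | x in Omega].

(* Main.v *)
(* Both bounds follow by compactness, and only the maximum principle is used.
   Extend a solution u by 0, let M be its maximum and let K stand for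
   a + t b |grad u|_2^(2 alpha). Quadratic barriers at the boundary and the
   interior gradient estimate bound the Lipschitz constant of u, for every small
   d, by M / d + d sup |Laplacian u| up to a constant. This controls
   |grad u|_2, hence K, and since 2 alpha < p - 1 it forces K / M^(p - 1) to tend
   to 0 when M tends to infinity. Rescaling u around its maximum point by
   sqrt (K / M^(p - 1)) then gives in the limit a bounded nonzero solution of
   - Laplacian v = v^p in the space, or in a half-space with v = 0 outside it.
   The first is excluded, since p < (N + 2) / (N - 2), by moving spheres; in the
   second, moving planes make v monotone in the normal direction, so that its
   translates converge to a solution in the whole space. If M tends to 0 instead,
   u / M converges to an eigenfunction for the limit mu <= lambda / a of
   t lambda / K, while lambda / a < lambda1. Limits are taken along an
   ultrafilter on nat, which spares the extraction of subsequences. *)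
Require Import Defs.
From mathcomp Require Import all_boot all_order all_algebra.
From mathcomp Require Import all_classical all_reals all_analysis.
From mathcomp Require Import ring lra.
Set Implicit Arguments.
Unset Strict Implicit.
Unset Printing Implicit Defensive.
Import Order.TTheory GRing.Theory Num.Theory.
Import numFieldNormedType.Exports.
Local Open Scope classical_set_scope.
Local Open Scope ring_scope.

(** * Euclidean structure and second-order expansions *)

(** The obstacle is compactness without second-derivative estimates: bounds on a solution and on its
    Laplacian give Lipschitz bounds only, so the equation has to survive locally uniform
    convergence. Hence the relation [Lap], closed under such limits, for which comparison,
    reflection and the Kelvin transform are proved. Gradients need not converge: when M tends to
    infinity, [h] becomes an error that vanishes uniformly in its last argument because q < p; when
    M tends to 0, it becomes a linear term plus such an error. Second derivatives come back once,
    for the limit of u / M, which must be of class C^2 to be compared with [lambda1].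

    The Kirchhoff coefficient is controlled as follows. If K / M^(p - 1) stayed above some d^2, the
    Lipschitz constant of u would be of order M / d with d fixed, hence K at most of order M^(2
    alpha), which is less than d^2 M^(p - 1) for M large. For the same reason sqrt (K / M^(p - 1))
    is the scale at which the rescaled solutions are uniformly Lipschitz. *)

Section euclid.
Context {R : realType} {n : nat}.
Implicit Types (x y z h b : 'rV[R]_n) (A B : 'M[R]_n) (c : R).

Definition dot x y : R := \sum_i x ord0 i * y ord0 i.
Definition nsq x : R := dot x x.
Definition qf A h : R := dot (h *m A) h.

Lemma dotC x y : dot x y = dot y x.
Proof. by apply: eq_bigr => i _; rewrite mulrC. Qed.
Lemma dotDl x y z : dot (x + y) z = dot x z + dot y z.
Proof. by rewrite -big_split; apply: eq_bigr => i _; rewrite mxE mulrDl. Qed.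
Lemma dotDr x y z : dot z (x + y) = dot z x + dot z y.
Proof. by rewrite !(dotC z) dotDl. Qed.
Lemma dotZl c x y : dot (c *: x) y = c * dot x y.
Proof. by rewrite /dot mulr_sumr; apply: eq_bigr => i _; rewrite mxE mulrA. Qed.
Lemma dotZr c x y : dot x (c *: y) = c * dot x y.
Proof. by rewrite !(dotC x) dotZl. Qed.
Lemma dotNl x y : dot (- x) y = - dot x y.
Proof. by rewrite -scaleN1r dotZl mulN1r. Qed.
Lemma dotNr x y : dot x (- y) = - dot x y.
Proof. by rewrite !(dotC x) dotNl. Qed.
Lemma dotBl x y z : dot (x - y) z = dot x z - dot y z.
Proof. by rewrite dotDl dotNl. Qed.
Lemma dotBr x y z : dot z (x - y) = dot z x - dot z y.
Proof. by rewrite !(dotC z) dotBl. Qed.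
Lemma dot0l x : dot 0 x = 0.
Proof. by rewrite -(scale0r x) dotZl mul0r. Qed.
Lemma dot0r x : dot x 0 = 0.
Proof. by rewrite dotC dot0l. Qed.
Lemma dot_mxl A x y : dot (x *m A) y = dot x (y *m A^T).
Proof.
rewrite /dot; under eq_bigr do rewrite mxE mulr_suml.
under [RHS]eq_bigr do rewrite mxE mulr_sumr.
rewrite exchange_big; apply: eq_bigr => i _; apply: eq_bigr => j _.
by rewrite mxE; ring.
Qed.
Lemma dot_mxr A x y : dot x (y *m A) = dot (x *m A^T) y.
Proof. by rewrite dotC dot_mxl dotC. Qed.
Lemma dot_delta x i : dot x (delta_mx ord0 i) = x ord0 i.
Proof.
rewrite /dot (bigD1 i)//= mxE !eqxx mulr1 big1 ?addr0// => j ji.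
by rewrite mxE eqxx (negbTE ji) mulr0.
Qed.

Lemma nsqE x : nsq x = \sum_i x ord0 i ^+ 2.
Proof. by apply: eq_bigr => i _; rewrite expr2. Qed.
Lemma nsq_ge0 x : 0 <= nsq x.
Proof. by rewrite nsqE sumr_ge0// => i _; exact: sqr_ge0. Qed.
Lemma nsq_eq0 x : (nsq x == 0) = (x == 0).
Proof.
apply/eqP/eqP => [|->]; last by rewrite /nsq dot0l.
rewrite nsqE => /eqP; rewrite psumr_eq0 => [|i _]; last exact: sqr_ge0.
move=> /allP x0; apply/rowP => i; rewrite mxE.
by have := x0 i (mem_index_enum _); rewrite /= sqrf_eq0 => /eqP.
Qed.
Lemma nsq_gt0 x : (0 < nsq x) = (x != 0).
Proof. by rewrite lt0r nsq_eq0 nsq_ge0 andbT. Qed.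
Lemma nsqD x y : nsq (x + y) = nsq x + 2 * dot x y + nsq y.
Proof. by rewrite /nsq !(dotDl, dotDr) (dotC y x); ring. Qed.
Lemma nsqN x : nsq (- x) = nsq x.
Proof. by rewrite /nsq dotNl dotNr opprK. Qed.
Lemma nsqB x y : nsq (x - y) = nsq x - 2 * dot x y + nsq y.
Proof. by rewrite nsqD nsqN dotNr; ring. Qed.
Lemma nsqZ c x : nsq (c *: x) = c ^+ 2 * nsq x.
Proof. by rewrite /nsq dotZl dotZr; ring. Qed.
Lemma nsq0 : nsq 0 = 0.
Proof. by rewrite /nsq dot0l. Qed.
Lemma CauchySchwarz x y : dot x y ^+ 2 <= nsq x * nsq y.
Proof.
have [->|x0] := eqVneq x 0; first by rewrite dot0l nsq0 mul0r expr0n.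
have xx : 0 < nsq x by rewrite nsq_gt0.
have := nsq_ge0 (nsq x *: y - dot x y *: x).
rewrite nsqB !nsqZ dotZl dotZr (dotC y x) => H.
have : 0 <= nsq x * (nsq x * nsq y - dot x y ^+ 2) by lra.
by rewrite pmulr_rge0// subr_ge0.
Qed.

Lemma coord_le x i : `|x ord0 i| <= `|x|.
Proof.
rewrite [leRHS]/Num.norm/= mx_normrE.
by apply/bigmax_geP; right => /=; exists (ord0, i).
Qed.
Lemma norm_le x c : 0 <= c -> (forall i, `|x ord0 i| <= c) -> `|x| <= c.
Proof.
move=> c0 H; rewrite [leLHS]/Num.norm/= mx_normrE.
by apply/bigmax_leP; split => // -[i j] _ /=; rewrite (ord1 i).
Qed.
Lemma norm_delta i : `|delta_mx ord0 i : 'rV[R]_n| <= 1.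
Proof.
apply: norm_le => // j; rewrite mxE eqxx /=.
by case: (j == i); rewrite ?normr1// normr0.
Qed.
Lemma nsq_delta i : nsq (delta_mx ord0 i : 'rV[R]_n) = 1.
Proof. by rewrite /nsq dot_delta mxE !eqxx. Qed.
(** [|x|] is the sup norm and [nsq] the squared Euclidean length. This and [nsq_le] are the
    comparisons through which Euclidean barriers are used on cubes, the balls of the sup norm. *)
Lemma norm_sqr_le x : `|x| ^+ 2 <= nsq x.
Proof.
have : `|x| <= Num.sqrt (nsq x).
  apply: norm_le => [|i]; first exact: sqrtr_ge0.
  rewrite -sqrtr_sqr ler_wsqrtr// nsqE (bigD1 i)//= lerDl sumr_ge0// => j _.
  exact: sqr_ge0.
move=> H; rewrite -(sqr_sqrtr (nsq_ge0 x)).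
by rewrite lerXn2r ?nnegrE ?sqrtr_ge0.
Qed.
Lemma dot_le x y : `|dot x y| <= n%:R * `|x| * `|y|.
Proof.
apply: le_trans (ler_norm_sum _ _ _) _.
apply: le_trans (_ : \sum_(i < n) (`|x| * `|y|) <= _).
  by apply: ler_sum => i _; rewrite normrM ler_pM// coord_le.
by rewrite sumr_const card_ord -[leLHS]mulr_natl mulrA.
Qed.
Lemma nsq_le x : nsq x <= n%:R * `|x| ^+ 2.
Proof. by rewrite expr2 mulrA; apply: le_trans (dot_le x x); exact: ler_norm. Qed.
Lemma mulmx_le A x : `|x *m A| <= (n%:R * `|A|) * `|x|.
Proof.
apply: norm_le => [|i]; first by rewrite !mulr_ge0.
rewrite mxE; apply: le_trans (ler_norm_sum _ _ _) _.
apply: le_trans (_ : \sum_(i < n) (`|A| * `|x|) <= _).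
  apply: ler_sum => j _; rewrite normrM mulrC ler_pM// ?coord_le//.
  rewrite [leRHS]/Num.norm/= mx_normrE.
  by apply/bigmax_geP; right => /=; exists (j, i).
by rewrite sumr_const card_ord -[leLHS]mulr_natl mulrA.
Qed.
Lemma qf_le A : exists2 c, 0 <= c & forall h, `|qf A h| <= c * `|h| ^+ 2.
Proof.
exists (n%:R * (n%:R * `|A|)); first by rewrite !mulr_ge0.
move=> h; apply: le_trans (dot_le _ _) _.
rewrite (_ : _ * _ ^+ 2 = n%:R * (n%:R * `|A| * `|h|) * `|h|); last by ring.
by rewrite ler_wpM2r// ler_wpM2l// mulmx_le.
Qed.
Lemma qfD A B h : qf (A + B) h = qf A h + qf B h.
Proof. by rewrite /qf mulmxDr dotDl. Qed.
Lemma qfZ c A h : qf (c *: A) h = c * qf A h.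
Proof. by rewrite /qf -scalemxAr dotZl. Qed.
Lemma qfhZ c A h : qf A (c *: h) = c ^+ 2 * qf A h.
Proof. by rewrite /qf -scalemxAl dotZl dotZr; ring. Qed.
Lemma qf1 h : qf 1%:M h = nsq h.
Proof. by rewrite /qf mulmx1. Qed.
Lemma qf0 A : qf A 0 = 0.
Proof. by rewrite /qf dot0r. Qed.
Lemma qfDr A x y : qf A (x + y) = qf A x + dot (x *m (A + A^T)) y + qf A y.
Proof.
rewrite /qf mulmxDl !dotDl !dotDr mulmxDr dotDl.
by rewrite (dot_mxl A y x) (dotC y); ring.
Qed.
Lemma qf_outer x y h : qf (x^T *m y) h = dot x h * dot y h.
Proof.
rewrite /qf mulmxA.
have -> : h *m x^T = (dot x h)%:M.
  apply/matrixP => i j; rewrite !ord1 !mxE eqxx mulr1n.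
  by apply: eq_bigr => k _; rewrite mxE mulrC.
by rewrite mul_scalar_mx dotZl.
Qed.
Lemma tr_outer x y : \tr (x^T *m y) = dot x y.
Proof.
rewrite mxtrace_mulC /mxtrace big_ord1 mxE; apply: eq_bigr => i _.
by rewrite mxE mulrC.
Qed.
Lemma qf_delta A i : qf A (delta_mx ord0 i) = A i i.
Proof. by rewrite /qf dot_delta -rowE mxE. Qed.
End euclid.

Lemma le_eq {R : realType} (a b : R) : a = b -> a <= b.
Proof. by move=> ->. Qed.

Section jets.
Context {R : realType} {n : nat}.
Local Notation V := 'rV[R]_n.
Implicit Types (x y h b : V) (A B : 'M[R]_n) (w v : V -> R).

(** Second-order Taylor expansion in Peano form at the single point x; A is half the Hessian up to
    an antisymmetric matrix. *)
Definition jet w x b A : Prop := forall e : R, 0 < e ->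
  \forall h \near (0 : V), `|w (x + h) - w x - dot b h - qf A h| <= e * `|h| ^+ 2.

Lemma near0P (P : V -> Prop) :
  (\forall h \near (0 : V), P h) <->
  exists2 d : R, 0 < d & forall h, `|h| < d -> P h.
Proof.
split=> [/nbhs_ballP[d /= d0 H]|[d d0 H]].
  exists d => // h hd; apply: H.
  by rewrite -ball_normE /= sub0r normrN.
by apply/nbhs_ballP; exists d => //= h; rewrite -ball_normE /= sub0r normrN => /H.
Qed.

Lemma near0_norm (d : R) : 0 < d -> \forall h \near (0 : V), `|h| < d.
Proof. by move=> d0; apply/near0P; exists d. Qed.

(** Lets a function be replaced by a model that agrees with it up to o(|h|^2), such as the transform
    of its own Taylor polynomial. *)
Lemma jet_eq w v x b A : w x = v x -> jet v x b A ->
  (forall e : R, 0 < e ->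
    \forall h \near (0 : V), `|w (x + h) - v (x + h)| <= e * `|h| ^+ 2) ->
  jet w x b A.
Proof.
move=> wv jv H e e0; have e2 : 0 < e / 2 by lra.
near=> h.
have H1 : `|w (x + h) - v (x + h)| <= e / 2 * `|h| ^+ 2 by near: h; exact: H.
have H2 : `|v (x + h) - v x - dot b h - qf A h| <= e / 2 * `|h| ^+ 2.
  by near: h; exact: jv.
move: H1 H2; rewrite wv.
set a1 := w _; set a2 := v _; set a3 := v _; set a4 := dot _ _; set a5 := qf _ _.
move=> H1 H2; rewrite (_ : a1 - a3 - a4 - a5 = (a1 - a2) + (a2 - a3 - a4 - a5)); last by ring.
by apply: le_trans (ler_normD _ _) _; lra.
Unshelve. all: by end_near. Qed.

Lemma jetD w v x b c A B : jet w x b A -> jet v x c B ->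
  jet (fun y => w y + v y) x (b + c) (A + B).
Proof.
move=> jw jv e e0; have e2 : 0 < e / 2 by lra.
near=> h.
have H1 : `|w (x + h) - w x - dot b h - qf A h| <= e / 2 * `|h| ^+ 2.
  by near: h; exact: jw.
have H2 : `|v (x + h) - v x - dot c h - qf B h| <= e / 2 * `|h| ^+ 2.
  by near: h; exact: jv.
rewrite dotDl qfD; set a := leRHS.
apply: le_trans (_ : `|(w (x + h) - w x - dot b h - qf A h) +
  (v (x + h) - v x - dot c h - qf B h)| <= _).
  by apply: le_eq; congr `|_|; ring.
by apply: le_trans (ler_normD _ _) _; rewrite /a; lra.
Unshelve. all: by end_near. Qed.

Lemma jetZ k w x b A : jet w x b A -> jet (fun y => k * w y) x (k *: b) (k *: A).
Proof.
move=> jw e e0; have k0 : 0 < `|k| + 1 by rewrite ltr_wpDl.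
have e2 : 0 < e / (`|k| + 1) by rewrite divr_gt0.
near=> h.
have H1 : `|w (x + h) - w x - dot b h - qf A h| <= e / (`|k| + 1) * `|h| ^+ 2.
  by near: h; exact: jw.
rewrite dotZl qfZ -!mulrBr normrM.
apply: le_trans (_ : (`|k| + 1) * (e / (`|k| + 1) * `|h| ^+ 2) <= _).
  by rewrite ler_pM// lerDl.
by apply: le_eq; field; rewrite gt_eqF.
Unshelve. all: by end_near. Qed.

Lemma jetN w x b A : jet w x b A -> jet (fun y => - w y) x (- b) (- A).
Proof.
move=> /(jetZ (-1)); rewrite !scaleN1r.
by under eq_fun do rewrite mulN1r.
Qed.

Lemma jetB w v x b c A B : jet w x b A -> jet v x c B ->
  jet (fun y => w y - v y) x (b - c) (A - B).
Proof. by move=> jw /jetN; exact: jetD. Qed.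

Lemma jet_cst (k : R) x : jet (fun=> k) x 0 0.
Proof.
move=> e e0; near=> h; rewrite dot0l /qf mulmx0 dot0l (_ : _ - _ = 0); last by ring.
by rewrite normr0 mulr_ge0// ltW.
Unshelve. all: by end_near. Qed.

Lemma jet_dot b x : jet (dot b) x b 0.
Proof.
move=> e e0; near=> h; rewrite dotDr /qf mulmx0 dot0l (_ : _ - _ = 0); last by ring.
by rewrite normr0 mulr_ge0// ltW.
Unshelve. all: by end_near. Qed.

Lemma jet_qf A x : jet (qf A) x (x *m (A + A^T)) A.
Proof.
move=> e e0; near=> h; rewrite qfDr.
rewrite (_ : _ - _ = 0); last by ring.
by rewrite normr0 mulr_ge0// ltW.
Unshelve. all: by end_near. Qed.

Lemma jet_bound1 w x b A : jet w x b A ->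
  exists2 c : R, 0 < c & \forall h \near (0 : V), `|w (x + h) - w x| <= c * `|h|.
Proof.
move=> jw; have [cA cA0 HA] := qf_le A.
exists (n%:R * `|b| + cA + 1); first by rewrite ltr_wpDl// addr_ge0// mulr_ge0.
near=> h.
have h1 : `|h| < 1 by near: h; exact: near0_norm.
have H1 : `|w (x + h) - w x - dot b h - qf A h| <= 1 * `|h| ^+ 2.
  by near: h; exact: jw.
have H2 := dot_le b h; have H3 := HA h.
have h0 := normr_ge0 h.
have hh : `|h| ^+ 2 <= `|h| by rewrite expr2 ler_piMl// ltW.
rewrite (_ : _ - _ = (w (x + h) - w x - dot b h - qf A h) + dot b h + qf A h); last by ring.
apply: le_trans (ler_normD _ _) _.
have := ler_normD (w (x + h) - w x - dot b h - qf A h) (dot b h).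
have : cA * `|h| ^+ 2 <= cA * `|h| by rewrite ler_wpM2l.
nra.
Unshelve. all: by end_near. Qed.

Lemma cvg_near0P w x :
  {for x, continuous w} <->
  (forall e : R, 0 < e -> \forall h \near (0 : V), `|w (x + h) - w x| < e).
Proof.
split=> [cw e e0|H].
  have /cvgrPdist_lt/(_ _ e0) := cw.
  move/nbhs_ballP => [d /= d0 Hd]; apply/near0P; exists d => // h hd.
  rewrite distrC; apply: Hd.
  by rewrite -ball_normE /= opprD addrA subrr sub0r normrN.
apply/(cvgrPdist_lt (FF := nbhs_filter x)) => e /H /near0P[d d0 Hd].
apply/nbhs_ballP; exists d => //= y; rewrite -ball_normE /= distrC => yd.
by rewrite distrC; have := Hd _ yd; rewrite addrCA subrr addr0.
Qed.

Lemma jet_cont w x b A : jet w x b A -> {for x, continuous w}.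
Proof.
move=> /jet_bound1[c c0 H]; apply/cvg_near0P => e e0.
have ec : 0 < e / c by rewrite divr_gt0.
near=> h.
have H1 : `|w (x + h) - w x| <= c * `|h| by near: h.
have H2 : `|h| < e / c by near: h; exact: near0_norm.
apply: le_lt_trans H1 _.
by rewrite -ltr_pdivlMl// mulrC.
Unshelve. all: by end_near. Qed.

(** The same expansion in one variable; [f2] is half the second derivative. *)
Definition jet1 (f : R -> R) (s f1 f2 : R) : Prop := forall e : R, 0 < e ->
  exists2 d : R, 0 < d & forall k, `|k| < d ->
    `|f (s + k) - f s - f1 * k - f2 * k ^+ 2| <= e * k ^+ 2.

Lemma jet_comp (f : R -> R) w x b A f1 f2 :
  jet w x b A -> jet1 f (w x) f1 f2 ->
  jet (fun y => f (w y)) x (f1 *: b) (f1 *: A + f2 *: (b^T *m b)).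
Proof.
move=> jw jf e e0.
have [c c0 Hc] := jet_bound1 jw.
have [cA cA0 HA] := qf_le A.
pose e1 := e / (4 * c ^+ 2).
pose C := `|f2| * (n%:R * `|b| + c) + 1.
have C0 : 0 < C by rewrite ltr_wpDl// mulr_ge0// addr_ge0 ?mulr_ge0// ltW.
have e10 : 0 < e1 by rewrite divr_gt0// mulr_gt0// exprn_gt0.
have [d d0 Hd] := jf _ e10.
pose e2 := e / (4 * (`|f1| + 1)).
have e20 : 0 < e2 by rewrite divr_gt0// mulr_gt0// ltr_wpDl.
pose e3 := e / (4 * C).
have e30 : 0 < e3 by rewrite divr_gt0// mulr_gt0.
near=> h.
have H1 : `|w (x + h) - w x| <= c * `|h| by near: h.
have H2 : `|h| < d / c by near: h; apply: near0_norm; rewrite divr_gt0.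
have H3 : `|w (x + h) - w x - dot b h - qf A h| <= e2 * `|h| ^+ 2.
  by near: h; exact: jw.
have H4 : `|w (x + h) - w x - dot b h - qf A h| <= 1 * `|h| ^+ 2.
  by near: h; exact: jw.
have H5 : (cA + 1) * `|h| <= e3.
  have : `|h| < e3 / (cA + 1).
    by near: h; apply: near0_norm; rewrite divr_gt0// ltr_wpDl.
  by rewrite ltr_pdivlMr ?ltr_wpDl// mulrC => /ltW.
set k := w (x + h) - w x in H1 H3 H4 *.
have kd : `|k| < d.
  by apply: le_lt_trans H1 _; rewrite -ltr_pdivlMl// mulrC.
have := Hd _ kd; rewrite {1}/k addrCA subrr addr0 => H6.
have H7 : `|k - dot b h| <= (cA + 1) * `|h| ^+ 2.
  have := HA h; rewrite (_ : k - _ = (k - dot b h - qf A h) + qf A h); last by ring.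
  by have := ler_normD (k - dot b h - qf A h) (qf A h); lra.
have H8 : `|k + dot b h| <= (n%:R * `|b| + c) * `|h|.
  have := dot_le b h; have := ler_normD k (dot b h); lra.
rewrite dotZl qfD !qfZ qf_outer.
(* Three errors: that of f at the increment k, that of w multiplied by [f1], and k^2 - (b.h)^2,
   which factors into a term of order |h|^2 and one of order |h|. The constants [e1], [e2], [e3]
   bound each of them by e / 4 |h|^2. *)
rewrite (_ : _ - _ = (f (w (x + h)) - f (w x) - f1 * k - f2 * k ^+ 2) +
   f1 * (k - dot b h - qf A h) + f2 * ((k - dot b h) * (k + dot b h))); last by ring.
have h0 : 0 <= `|h| ^+ 2 by rewrite exprn_ge0.
have E1 : e1 * k ^+ 2 <= e / 4 * `|h| ^+ 2.
  rewrite /e1 -[k ^+ 2]real_normK ?num_real//.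
  apply: le_trans (_ : e / (4 * c ^+ 2) * (c * `|h|) ^+ 2 <= _).
    apply: ler_wpM2l; first exact: (ltW e10).
    by rewrite lerXn2r// nnegrE// mulr_ge0// ltW.
  apply: le_eq; field.
  by rewrite gt_eqF.
have E2 : `|f1 * (k - dot b h - qf A h)| <= e / 4 * `|h| ^+ 2.
  rewrite normrM; apply: le_trans (_ : (`|f1| + 1) * (e2 * `|h| ^+ 2) <= _).
    by rewrite ler_pM// lerDl.
  apply: le_eq; rewrite /e2; field.
  by rewrite gt_eqF// ltr_wpDl.
have E3 : `|f2 * ((k - dot b h) * (k + dot b h))| <= e / 4 * `|h| ^+ 2.
  rewrite !normrM.
  apply: le_trans (_ : `|f2| * (((cA + 1) * `|h| ^+ 2) * ((n%:R * `|b| + c) * `|h|)) <= _).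
    by rewrite ler_wpM2l// ler_pM.
  rewrite (_ : _ * _ = (`|f2| * (n%:R * `|b| + c)) * ((cA + 1) * `|h|) * `|h| ^+ 2); last by ring.
  rewrite ler_wpM2r//.
  apply: le_trans (_ : C * e3 <= _).
    rewrite ler_pM ?mulr_ge0 ?addr_ge0 ?mulr_ge0//; try exact: ltW.
    by rewrite /C lerDl.
  apply: le_eq; rewrite /e3; field.
  by rewrite gt_eqF.
apply: le_trans (ler_normD _ _) _.
have := ler_normD (f (w (x + h)) - f (w x) - f1 * k - f2 * k ^+ 2) (f1 * (k - dot b h - qf A h)).
have : 0 <= e * `|h| ^+ 2 by rewrite mulr_ge0// ltW.
lra.
Unshelve. all: by end_near. Qed.

Lemma jet1_sqr (s : R) : jet1 (fun t => t ^+ 2) s (2 * s) 1.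
Proof.
move=> e e0; exists 1 => // k _.
rewrite (_ : _ - _ = 0); last by ring.
by rewrite normr0 mulr_ge0 ?sqr_ge0// ltW.
Qed.

(* Polarization reduces products to squares. *)
Lemma jetM w v x b c A B : jet w x b A -> jet v x c B ->
  jet (fun y => w y * v y) x (w x *: c + v x *: b)
    (w x *: B + v x *: A + 2^-1 *: (b^T *m c + c^T *m b)).
Proof.
move=> jw jv.
have j1 := jet_comp (jetD jw jv) (jet1_sqr (w x + v x)).
have j2 := jet_comp (jetB jw jv) (jet1_sqr (w x - v x)).
have := jetZ 4^-1 (jetB j1 j2).
rewrite (_ : (fun y => _) = (fun y => w y * v y)); last first.
  by apply/funext => y; field.
rewrite (_ : 4^-1 *: _ = w x *: c + v x *: b); last first.
  by apply/rowP => i; rewrite !mxE; field.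
rewrite (_ : 4^-1 *: _ = (w x *: B + v x *: A + 2^-1 *: (b^T *m c + c^T *m b)))//.
by apply/matrixP => i j; rewrite !(mxE, big_ord1); field.
Qed.

Lemma jet_affine w (z : V) (M : 'M[R]_n) x b A :
  jet w (z + x *m M) b A ->
  jet (fun y => w (z + y *m M)) x (b *m M^T) (M *m A *m M^T).
Proof.
move=> jw e e0.
pose c := n%:R * `|M| + 1; have c0 : 0 < c by rewrite ltr_wpDl// mulr_ge0.
have e2 : 0 < e / c ^+ 2 by rewrite divr_gt0// exprn_gt0.
have /near0P[d d0 Hd] := jw _ e2.
apply/near0P; exists (d / c); first by rewrite divr_gt0.
move=> h; rewrite ltr_pdivlMr// => hd.
have hM : `|h *m M| <= c * `|h|.
  by apply: le_trans (mulmx_le _ _) _; rewrite ler_wpM2r// lerDl.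
have /Hd : `|h *m M| < d by apply: le_lt_trans hM _; rewrite mulrC.
rewrite mulmxDl addrA dot_mxl trmxK /qf.
rewrite (_ : dot (h *m (M *m A *m M^T)) h = dot (h *m M *m A) (h *m M)); last first.
  by rewrite dot_mxr !mulmxA.
move=> /le_trans; apply.
apply: le_trans (_ : e / c ^+ 2 * (c * `|h|) ^+ 2 <= _).
  apply: ler_wpM2l; first exact: ltW.
  by rewrite lerXn2r// nnegrE// mulr_ge0// ltW.
apply: le_eq; field.
by rewrite gt_eqF.
Qed.

Lemma jet_is_derive w x b A (u : V) : jet w x b A -> is_derive x u w (dot b u).
Proof.
move=> jw.
have [cA cA0 HA] := qf_le A.
have cv : (fun k : R => k^-1 *: ((w \o shift x) (k *: u) - w x)) @ 0^' --> dot b u.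
  apply/cvgrPdist_le => e e0.
  pose c := (cA + 1) * `|u| ^+ 2 + 1.
  have c0 : 0 < c by rewrite ltr_wpDl// mulr_ge0 ?exprn_ge0// addr_ge0.
  have /near0P[d d0 Hd] := jw _ ltr01.
  have u1 : 0 < `|u| + 1 by rewrite ltr_wpDl.
  near=> k.
  have k0 : k != 0 by near: k; exact: nbhs_dnbhs_neq.
  have kd : `|k| < d / (`|u| + 1).
    near: k; apply: dnbhs0_lt; rewrite divr_gt0//.
  have kc : `|k| < e / c by near: k; apply: dnbhs0_lt; rewrite divr_gt0.
  have ku : `|k *: u| < d.
    rewrite normrZ; apply: le_lt_trans (_ : `|k| * (`|u| + 1) < _).
      by rewrite ler_wpM2l// lerDl.
    by rewrite -ltr_pdivlMr.
  have := Hd _ ku; rewrite dotZr qfhZ /= [k *: u + x]addrC => H.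
  have kk : 0 < `|k| by rewrite normr_gt0.
  rewrite -(ler_pM2l kk) -normrM.
  rewrite (_ : k * _ = - (w (x + k *: u) - w x - k * dot b u - k ^+ 2 * qf A u) - k ^+ 2 * qf A u); last first.
    by rewrite [_ *: _]mulrC; field.
  apply: le_trans (ler_normD _ _) _; rewrite !normrN.
  have H3 : `|k ^+ 2 * qf A u| <= `|k| ^+ 2 * (cA * `|u| ^+ 2).
    by rewrite normrM normrX ler_wpM2l ?exprn_ge0.
  move: H; rewrite normrZ => H.
  apply: le_trans (lerD H H3) _.
  rewrite (_ : _ + _ = `|k| * (`|k| * ((cA + 1) * `|u| ^+ 2))); last by ring.
  rewrite ler_wpM2l//.
  apply: le_trans (_ : `|k| * c <= _); first by rewrite ler_wpM2l// lerDl.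
  by rewrite -ler_pdivlMr// ltW.
apply: DeriveDef; first by apply/cvg_ex; exists (dot b u).
exact: cvg_lim cv.
Unshelve. all: by end_near. Qed.
End jets.

Lemma dir_shift_derive {R : realType} {W : normedModType R} (G : W -> R) (y u : W) (t : R) :
  derivable G (y + t *: u) u ->
  is_derive t (1 : R) (fun s : R => G (y + s *: u)) ('D_u G (y + t *: u)).
Proof.
move=> /derivableP[/cvg_ex[l Hl] _].
have E : (fun h : R => h^-1 *: (((fun s : R => G (y + s *: u)) \o shift t) (h *: (1 : R)) - G (y + t *: u)))
  = (fun h => h^-1 *: ((G \o shift (y + t *: u)) (h *: u) - G (y + t *: u))).
  apply/funext => h /=; congr (_ *: (G _ - _)).
  by rewrite [h *: 1]mulr1 scalerDl; rewrite addrCA.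
apply: DeriveDef; first by apply/cvg_ex; exists l; rewrite /= E.
by rewrite /derive E.
Qed.

Lemma dir_bound {R : realType} {W : normedModType R} (G : W -> R) (y u : W) (k B : R) :
  (forall t, `|t| <= `|k| -> derivable G (y + t *: u) u /\ `|'D_u G (y + t *: u)| <= B) ->
  `|G (y + k *: u) - G y| <= B * `|k|.
Proof.
move=> H.
have Hd t : `|t| <= `|k| -> is_derive t (1 : R) (fun s : R => G (y + s *: u)) ('D_u G (y + t *: u)).
  by move=> /H[] ? _; exact: dir_shift_derive.
have key (a b : R) : a <= b -> `|a| <= `|k| -> `|b| <= `|k| ->
    `|G (y + b *: u) - G (y + a *: u)| <= B * (b - a).
  move=> ab ak bk.
  have Hab t : t \in `[a, b] -> `|t| <= `|k|.
    by rewrite in_itv/= => /andP[at_ tb]; move: ak bk; rewrite !ler_norml; lra.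
  have := @MVT_segment R (fun s : R => G (y + s *: u)) (fun t => 'D_u G (y + t *: u)) a b ab.
  case.
  - by move=> t tab; apply: Hd; apply: Hab; exact: subset_itv_oo_cc tab.
  - apply: derivable_within_continuous => t tab.
    by have [] := Hd _ (Hab _ tab).
  move=> c cab ->; rewrite normrM (ger0_norm (_ : 0 <= b - a)) ?subr_ge0//.
  by rewrite ler_wpM2r ?subr_ge0//; have [] := H _ (Hab _ cab).
have [k0|k0] := leP 0 k.
  have := key 0 k k0; rewrite scale0r addr0 subr0 normr0 => /(_ (normr_ge0 _) (lexx _)).
  by rewrite (ger0_norm k0).
have := key k 0 (ltW k0); rewrite scale0r addr0 sub0r normr0 distrC.
by move=> /(_ (lexx _) (normr_ge0 _)); rewrite (ltr0_norm k0).
Qed.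

(** The mean value inequality is applied to f minus its quadratic Taylor polynomial, whose
    derivative is o(t - s) because [df] is differentiable at s. *)
Lemma jet1_derive {R : realType} (f df : R -> R) (s d f2 : R) : 0 < d ->
  (forall t, `|t - s| < d -> is_derive t (1 : R) f (df t)) ->
  is_derive s (1 : R) df (2 * f2) -> jet1 f s (df s) f2.
Proof.
move=> d0 Hf Hdf e e0.
have /cvgrPdist_le/(_ _ e0) : (fun h : R => h^-1 *: ((df \o shift s) (h *: (1 : R)) - df s)) @ 0^' --> 2 * f2.
  by case: Hdf => dd <-; exact: dd.
rewrite near_withinE => /nbhs_ballP[d1 /= d10 Hd1].
exists (Num.min d d1); first by rewrite lt_min d0.
move=> k; rewrite lt_min => /andP[kd kd1].
pose g (t : R) := f t - (df s * (t - s) + f2 * (t - s) ^+ 2).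
have Hg t : `|t - s| < d -> is_derive t (1 : R) g (df t - (df s + f2 * (2 * (t - s)))).
  move=> ts; have Ht := Hf _ ts.
  rewrite /g; apply: is_derive_eq.
  rewrite /GRing.scale /=; ring.
have H := @dir_bound R R g s 1 k (e * `|k|).
rewrite (_ : _ - _ - _ = g (s + k *: 1) - g s); last first.
  by rewrite /g [k *: 1]mulr1; ring.
rewrite -[k ^+ 2]real_normK ?num_real// expr2 mulrA.
apply: H => t tk; rewrite [t *: 1]mulr1.
have ts : `|s + t - s| < d by rewrite addrAC subrr add0r (le_lt_trans tk).
have Hgt := Hg _ ts; split => //; rewrite derive_val.
rewrite addrAC subrr add0r.
have [->|t0] := eqVneq t 0; first by rewrite addr0 !mulr0 addr0 subrr normr0 mulr_ge0// ltW.
have := Hd1 t; rewrite -ball_normE /= sub0r normrN => /(_ (le_lt_trans tk kd1) t0).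
have t0' : 0 < `|t| by rewrite normr_gt0.
rewrite -(ler_pM2r t0') -normrM [t *: 1]mulr1 => Hle.
rewrite distrC; apply: le_trans (_ : e * `|t| <= _); last by rewrite ler_wpM2l// ltW.
apply: le_trans Hle; apply: le_eq; congr `|_|.
by rewrite /GRing.scale /= [t + s]addrC; field.
Qed.

Lemma jet1_powR {R : realType} (p s : R) : 0 < s ->
  jet1 (fun t => t `^ p) s (p * s `^ (p - 1)) (2^-1 * (p * ((p - 1) * s `^ (p - 2)))).
Proof.
move=> s0; apply: (@jet1_derive _ _ (fun t => p * t `^ (p - 1)) _ s) => //.
  move=> t ts; have t0 : 0 < t by move: ts; rewrite ltr_norml; lra.
  exact: is_derive1_powR.
have := is_derive1_powR (p - 1) s0 => H.
apply: is_derive_eq.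
rewrite /GRing.scale /= (_ : p - 1 - 1 = p - 2); last by ring.
by field.
Qed.

Section C2_jet.
Context {R : realType} {n : nat}.
Local Notation V := 'rV[R]_n.
Implicit Types (x y h b : V) (A B : 'M[R]_n) (w v G : V -> R).

(** The Laplacian read off from an expansion at one point. Being a relation, it applies to functions
    given by formulas without computing their iterated partial derivatives. *)
Definition lap w x (l : R) : Prop := exists b A, jet w x b A /\ l = 2 * \tr A.

Let trunc (k : nat) h : V := \row_i (if (i < k)%N then h ord0 i else 0).

Let frac_le (e : R) : 0 < e -> n%:R * (e / (n%:R + 1)) <= e.
Proof.
move=> e0; have n0 : (0 : R) <= n%:R by [].
by rewrite mulrCA ger_pMr// ler_pdivrMr ?mul1r ?lerDl// ltr_wpDl.
Qed.

Lemma near0_forall m (P : 'I_m -> V -> Prop) :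
  (forall i, \forall h \near (0 : V), P i h) ->
  \forall h \near (0 : V), forall i, P i h.
Proof. exact: (@filter_forall V 'I_m P (nbhs (0 : V)) (nbhs_filter (0 : V))). Qed.

(* Moving one coordinate at a time, only derivatives at points whose last
   coordinates vanish are used. *)
Lemma triangular_bound G x (d B : R) (m : nat) : 0 <= B ->
  (forall h (k : 'I_n), `|h| < d -> (forall j : 'I_n, (k < j)%N -> h ord0 j = 0) ->
     derivable G (x + h) (delta_mx ord0 k) /\
     `|'D_(delta_mx ord0 k) G (x + h)| <= B * `|h| ^+ m) ->
  forall h, `|h| < d -> `|G (x + h) - G x| <= n%:R * (B * `|h| ^+ m.+1).
Proof.
move=> B0 H h hd.
have trunc_le k (t : R) (i : 'I_n) : (k <= i)%N -> `|t| <= `|h ord0 i| ->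
    `|trunc k h + t *: delta_mx ord0 i| <= `|h|.
  move=> ki ti; apply: norm_le => // j; rewrite !mxE eqxx /=.
  have [->|ji] := eqVneq j i.
    by rewrite ltnNge ki /= add0r mulr1 (le_trans ti)// coord_le.
  by rewrite mulr0 addr0; case: ifP => _; rewrite ?normr0// coord_le.
suff key k : (k <= n)%N -> `|G (x + trunc k h) - G x| <= k%:R * (B * `|h| ^+ m.+1).
  have := key n (leqnn n); rewrite (_ : trunc n h = h)//.
  by apply/rowP => i; rewrite !mxE ltn_ord.
elim: k => [_|k IH kn].
  rewrite (_ : trunc 0 h = 0); last by apply/rowP => i; rewrite !mxE.
  by rewrite addr0 subrr normr0 mul0r.
pose i := Ordinal kn.
have E : trunc k.+1 h = trunc k h + h ord0 i *: delta_mx ord0 i.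
  apply/rowP => j; rewrite !mxE eqxx /= ltnS leq_eqVlt -val_eqE /=.
  case: eqP => [ji|_] /=.
    by rewrite -ji ltnn add0r mulr1; congr (h _ _); exact: val_inj.
  by rewrite mulr0 addr0.
have S : `|G (x + trunc k.+1 h) - G (x + trunc k h)| <= B * `|h| ^+ m.+1.
  rewrite E addrA.
  apply: le_trans (_ : B * `|h| ^+ m * `|h ord0 i| <= _); last first.
    rewrite exprSr mulrA ler_wpM2l ?coord_le// mulr_ge0//; exact: exprn_ge0.
  apply: dir_bound => t ti; rewrite -addrA.
  have tn := @trunc_le k t i (leqnn _) ti.
  have [|j kj|D1 D2] := H (trunc k h + t *: delta_mx ord0 i) i.
  - exact: le_lt_trans tn hd.
  - rewrite !mxE eqxx /= ltnNge (ltnW kj)/= add0r.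
    by rewrite -val_eqE /= gtn_eqF// mulr0.
  split=> //; apply: le_trans D2 _; rewrite ler_wpM2l//.
  by rewrite lerXn2r// nnegrE.
have := IH (ltnW kn).
have -> : G (x + trunc k.+1 h) - G x = (G (x + trunc k.+1 h) - G (x + trunc k h)) + (G (x + trunc k h) - G x) by ring.
move=> IH'; apply: le_trans (ler_normD _ _) _.
by rewrite -natr1 mulrDl mul1r addrC lerD.
Qed.

Lemma C1_expansion w x (p : 'I_n -> V -> R) :
  (\forall h \near (0 : V), forall k, is_derive (x + h) (delta_mx ord0 k) w (p k (x + h))) ->
  (forall k, {for x, continuous (p k)}) ->
  forall e, 0 < e -> \forall h \near (0 : V),
    `|w (x + h) - w x - \sum_k p k x * h ord0 k| <= e * `|h|.
Proof.
move=> Hd Hc e e0.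
pose b : V := \row_k p k x.
have bE h : \sum_k p k x * h ord0 k = dot b h.
  by apply: eq_bigr => k _; rewrite mxE.
have e1 : 0 < e / (n%:R + 1) by rewrite divr_gt0// ltr_wpDl.
have /near0P[d d0 Hd'] : \forall h \near (0 : V), forall k,
    is_derive (x + h) (delta_mx ord0 k) w (p k (x + h)) /\
    `|p k (x + h) - p k x| < e / (n%:R + 1).
  have Hp : \forall h \near (0 : V), forall k, `|p k (x + h) - p k x| < e / (n%:R + 1).
    by apply: near0_forall => k; have /cvg_near0P := Hc k; exact.
  near=> h; have H1 : forall k, is_derive (x + h) (delta_mx ord0 k) w (p k (x + h)) by near: h.
  have H2 : forall k, `|p k (x + h) - p k x| < e / (n%:R + 1) by near: h.
  by move=> k; split.
apply/near0P; exists d => // h hd; rewrite bE.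
pose G y := w y - dot b y.
rewrite (_ : _ - _ = G (x + h) - G x); last by rewrite /G dotDr; ring.
apply: le_trans (_ : n%:R * (e / (n%:R + 1) * `|h| ^+ 1) <= _); last first.
  by rewrite expr1 mulrA ler_wpM2r// frac_le.
apply: (@triangular_bound G x d (e / (n%:R + 1)) 0) => //; first exact: ltW.
move=> k' i kd _; have [D1 D2] := Hd' _ kd i.
have Db := jet_is_derive (delta_mx ord0 i) (jet_dot b (x + k')).
have DG : is_derive (x + k') (delta_mx ord0 i) G (p i (x + k') - p i x).
  have := is_deriveB D1 Db; rewrite dot_delta mxE; exact.
split=> //; rewrite derive_val mulr1; exact: ltW.
Unshelve. all: by end_near. Qed.

Lemma C2_lap (D : set V) (u : V -> R) x : open D -> Ck_on 2 D u -> D x ->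
  lap u x (laplacian u x).
Proof.
move=> oD CD Dx.
have nD : \forall h \near (0 : V), D (x + h).
  have /nbhs_ballP[d /= d0 Hd] : nbhs x D by exact: open_nbhs_nbhs.
  apply/near0P; exists d => // h hd; apply: Hd.
  by rewrite -ball_normE /= opprD addrA subrr sub0r normrN.
have d1 y k : D y -> is_derive y (delta_mx ord0 k) u (partial k u y).
  move=> Dy; have [_ H] := CD [::] isT.
  by apply/derivableP; have := H isT _ Dy; exact.
have d2 y j k : D y -> is_derive y (delta_mx ord0 j) (partial k u) (partial j (partial k u) y).
  move=> Dy; have [_ H] := CD [:: k] isT.
  by apply/derivableP; have := H isT _ Dy; exact.
have c2 j k : {for x, continuous (partial j (partial k u))}.
  have [H _] := CD [:: j; k] isT; move: H; rewrite continuous_open_subspace//.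
  by apply; rewrite inE.
pose b : V := \row_k partial k u x.
(* The path of [triangular_bound] moves coordinate k where the later coordinates of the increment
   vanish. Hence only mixed derivatives with j < k are met, in one order, and a triangular matrix
   carries each of them in full and the pure ones by halves. *)
pose A : 'M[R]_n := \matrix_(k, j) (if j == k then 2^-1 * partial k (partial k u) x
  else if (j < k)%N then partial j (partial k u) x else 0).
exists b, A; split; last first.
  rewrite /laplacian /mxtrace mulr_sumr; apply: eq_bigr => k _.
  by rewrite mxE eqxx; field.
move=> e e0.
have e1 : 0 < e / (n%:R + 1) by rewrite divr_gt0// ltr_wpDl.
have exp1 k : \forall h \near (0 : V),
    `|partial k u (x + h) - partial k u x - \sum_j partial j (partial k u) x * h ord0 j|
    <= e / (n%:R + 1) * `|h|.
  apply: (@C1_expansion _ _ (fun j => partial j (partial k u))) => //.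
  by apply: filterS nD => h Dh j; exact: d2.
have /near0P[d d0 Hd] : \forall h \near (0 : V), D (x + h) /\ forall k,
    `|partial k u (x + h) - partial k u x - \sum_j partial j (partial k u) x * h ord0 j|
    <= e / (n%:R + 1) * `|h|.
  near=> h; split; first by near: h; exact: nD.
  by near: h; exact: near0_forall.
apply/near0P; exists d => // h hd.
pose G y := u y - (dot b y + qf A (y - x)).
have GE : `|u (x + h) - u x - dot b h - qf A h| = `|G (x + h) - G x|.
  congr `|_|; rewrite /G dotDr (_ : x + h - x = h) ?subrr ?qf0; first by ring.
  by rewrite addrAC subrr add0r.
rewrite GE.
apply: le_trans (_ : n%:R * (e / (n%:R + 1) * `|h| ^+ 2) <= _); last first.
  by rewrite mulrA ler_wpM2r ?exprn_ge0// frac_le.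
apply: (@triangular_bound G x d (e / (n%:R + 1)) 1) => //; first exact: ltW.
move=> h' k kd hk; have [Dh /(_ k) Hk] := Hd _ kd.
have Db := jet_is_derive (delta_mx ord0 k) (jet_dot b (x + h')).
have jq : jet (fun y => qf A (y - x)) (x + h') (h' *m (A + A^T)) A.
  have := @jet_affine _ _ (qf A) (- x) 1%:M (x + h') _ _ _.
  rewrite trmx1 => /(_ (h' *m (A + A^T)) A); rewrite !mulmx1 mul1mx.
  rewrite [- x + _]addrC addrAC subrr add0r => /(_ (jet_qf _ _)).
  by under eq_fun do rewrite mulmx1 addrC.
have Dq := jet_is_derive (delta_mx ord0 k) jq.
have Dk := d1 _ k Dh.
have DG := is_deriveB Dk (is_deriveD Db Dq).
have {DG} : is_derive (x + h') (delta_mx ord0 k) G (partial k u (x + h') -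
    (dot b (delta_mx ord0 k) + dot (h' *m (A + A^T)) (delta_mx ord0 k))) by [].
rewrite !dot_delta !mxE => DG; split=> //; rewrite derive_val expr1.
rewrite opprD addrA (_ : \sum_j _ = \sum_j partial j (partial k u) x * h' ord0 j)//.
apply: eq_bigr => j _; rewrite !mxE mulrC eq_sym.
have [->|jk] := eqVneq k j; first by congr (_ * _); field.
case: ltngtP => [jk'|jk'|/val_inj jk']; last by rewrite jk' eqxx in jk.
- by rewrite hk// !mulr0.
- by rewrite add0r.
Unshelve. all: by end_near. Qed.
End C2_jet.

(** * Laplacians of powers of |x| and of the Kelvin transform *)

Section explicit_laplacians.
Context {R : realType} {n : nat}.
Local Notation V := 'rV[R]_n.
Implicit Types (x y z h b : V) (A B : 'M[R]_n) (u w v : V -> R).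

Lemma lapD w v x k l : lap w x k -> lap v x l -> lap (fun y => w y + v y) x (k + l).
Proof.
move=> [b [A [jw ->]]] [c [B [jv ->]]]; exists (b + c), (A + B).
by split; [exact: jetD|rewrite linearD/=; ring].
Qed.
Lemma lapZ c w x k : lap w x k -> lap (fun y => c * w y) x (c * k).
Proof.
move=> [b [A [jw ->]]]; exists (c *: b), (c *: A).
by split; [exact: jetZ|rewrite linearZ/=; ring].
Qed.
Lemma lapN w x k : lap w x k -> lap (fun y => - w y) x (- k).
Proof.
move=> [b [A [jw ->]]]; exists (- b), (- A).
by split; [exact: jetN|rewrite linearN/=; ring].
Qed.
Lemma lapB w v x k l : lap w x k -> lap v x l -> lap (fun y => w y - v y) x (k - l).
Proof. by move=> H /lapN; exact: lapD. Qed.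
Lemma lap_cst c x : lap (fun=> c) x 0.
Proof. by exists 0, 0; split; [exact: jet_cst|rewrite linear0 mulr0]. Qed.
Lemma jet_nsq x : jet nsq x (2 *: x) 1%:M.
Proof.
have := jet_qf 1%:M x; rewrite trmx1 mulmxDr mulmx1.
rewrite (_ : x + x = 2 *: x); last by rewrite scaler_nat mulr2n.
by rewrite (_ : qf _ = nsq)//; apply/funext => h; exact: qf1.
Qed.
Lemma lap_nsq x : lap nsq x (2 * n%:R).
Proof. by exists (2 *: x), 1%:M; split; [exact: jet_nsq|rewrite mxtrace1]. Qed.
Lemma lap_cont w x l : lap w x l -> {for x, continuous w}.
Proof. by case=> b [A [/jet_cont]]. Qed.
(** M is a similarity of ratio sqrt s: translations, dilations and reflections are instances, and
    the trace is cyclic. *)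
Lemma lap_affine w z (M : 'M[R]_n) (s : R) x l : M^T *m M = s%:M ->
  lap w (z + x *m M) l -> lap (fun y => w (z + y *m M)) x (s * l).
Proof.
move=> MM [b [A [jw ->]]]; exists (b *m M^T), (M *m A *m M^T).
split; first exact: jet_affine.
by rewrite mxtrace_mulC mulmxA MM mul_scalar_mx linearZ/=; ring.
Qed.
Lemma lap_dot_powR (p : R) b (c : R) x : 0 < c + dot b x ->
  lap (fun y => (c + dot b y) `^ p) x
    (p * (p - 1) * (c + dot b x) `^ (p - 2) * nsq b).
Proof.
move=> p0; have jl := jetD (jet_cst c x) (jet_dot b x).
have := jet_comp jl (jet1_powR p p0).
set f1 := p * _; set f2 := 2^-1 * _ => j.
eexists; eexists; split; first exact: j.
rewrite !add0r mxtraceD !mxtraceZ mxtrace0 mulr0 add0r.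
have -> : \tr (b^T *m b) = nsq b by rewrite tr_outer.
by rewrite /f2; field.
Qed.

Lemma jet_nsq_powR (m : R) x : x != 0 ->
  jet (fun y => nsq y `^ (- m)) x ((- 2 * m * nsq x `^ (- m - 1)) *: x)
   ((- m * nsq x `^ (- m - 1)) *: 1%:M +
    (2 * m * (m + 1) * nsq x `^ (- m - 2)) *: (x^T *m x)).
Proof.
move=> x0; have s0 : 0 < nsq x by rewrite nsq_gt0.
have := jet_comp (jet_nsq x) (jet1_powR (- m) s0).
have -> : (2 *: x)^T = 2 *: x^T by apply/matrixP => i j; rewrite !mxE.
rewrite scalerA -scalemxAl -scalemxAr !scalerA.
rewrite (_ : - m * nsq x `^ (- m - 1) * 2 = - 2 * m * nsq x `^ (- m - 1)); last by ring.
rewrite (_ : 2^-1 * _ * 2 * 2 = 2 * m * (m + 1) * nsq x `^ (- m - 2))//.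
by field.
Qed.

Lemma tr_nsq_powR (m : R) x : x != 0 ->
  \tr ((- m * nsq x `^ (- m - 1)) *: 1%:M +
    (2 * m * (m + 1) * nsq x `^ (- m - 2)) *: (x^T *m x)) =
  m * (2 * m + 2 - n%:R) * nsq x `^ (- m - 1).
Proof.
move=> x0; have s0 : nsq x != 0 by rewrite nsq_eq0.
rewrite mxtraceD !mxtraceZ mxtrace1.
have -> : \tr (x^T *m x) = nsq x by rewrite tr_outer.
have -> : nsq x `^ (- m - 1) = nsq x `^ (- m - 2) * nsq x.
  rewrite -[X in _ * X]powRr1 ?nsq_ge0// -powRD ?s0 ?implybT//.
  by congr (_ `^ _); ring.
ring.
Qed.

(** The function is |y|^(-2m). For m > 0 it is harmonic if 2m + 2 = n and strictly subharmonic if 2m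
    + 2 > n; both cases serve as barriers. *)
Lemma lap_nsq_powR (m : R) x : x != 0 ->
  lap (fun y => nsq y `^ (- m)) x
    (2 * m * (2 * m + 2 - n%:R) * nsq x `^ (- m - 1)).
Proof.
move=> x0; eexists; eexists; split; first exact: jet_nsq_powR.
by rewrite tr_nsq_powR//; ring.
Qed.

Lemma lapM w v x b c A B : jet w x b A -> jet v x c B ->
  lap (fun y => w y * v y) x (2 * (w x * \tr B + v x * \tr A + dot b c)).
Proof.
move=> jw jv; eexists; eexists; split; first exact: (jetM jw jv).
by rewrite !(mxtraceD, mxtraceZ) !tr_outer (dotC c); field.
Qed.

(** Inversion in the sphere of centre 0 and radius sqrt c; for 2k + 2 = n the weight is the
    classical (radius / |y|)^(n - 2). *)
Definition kelvin (k c : R) u (y : V) : R :=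
  (c / nsq y) `^ k * u ((c / nsq y) *: y).

Lemma nsq_inversion (c : R) x y : x != 0 -> y != 0 ->
  nsq ((c / nsq y) *: y - (c / nsq x) *: x) =
  c ^+ 2 * nsq (y - x) / (nsq y * nsq x).
Proof.
move=> x0 y0; rewrite !nsqB !nsqZ dotZl dotZr; field.
by rewrite !nsq_eq0 x0.
Qed.

(** It suffices to transform the second-order Taylor polynomial of u at the image point: inversion
    is Lipschitz near y, so the remainder stays o(|h|^2). The result is a sum of powers of |y| times
    polynomials, and 2k + 2 = n cancels everything but the trace term. *)
Lemma lap_kelvin (k c l : R) u y : 0 < c -> 2 * k + 2 = n%:R -> y != 0 ->
  lap u ((c / nsq y) *: y) l ->
  lap (kelvin k c u) y ((c / nsq y) `^ (k + 2) * l).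
Proof.
move=> c0 kn y0 [b [A [ju ->]]].
have s0 : 0 < nsq y by rewrite nsq_gt0.
set z0 := (c / nsq y) *: y in ju.
pose a := u z0 - dot b z0 + qf A z0.
pose b' := b - z0 *m (A + A^T).
(* Transform of the Taylor polynomial at [z0], regrouped around 0 with constant term [a], linear
   part [b'] and quadratic part [A]. *)
pose F x := a * c `^ k * nsq x `^ (- k) +
  (c `^ (k + 1) * (nsq x `^ (- (k + 1)) * dot b' x) +
   c `^ (k + 2) * (nsq x `^ (- (k + 2)) * qf A x)).
have ny x : x != 0 -> (c / nsq x) `^ k * (u z0 + dot b ((c / nsq x) *: x - z0)
    + qf A ((c / nsq x) *: x - z0)) = F x.
  move=> x0; have sx : 0 < nsq x by rewrite nsq_gt0.
  have cx : 0 <= c / nsq x by rewrite divr_ge0 ?ltW.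
  have cxn : c / nsq x != 0 by rewrite gt_eqF// divr_gt0.
  have P m : (c / nsq x) `^ m = c `^ m * nsq x `^ (- m).
    by rewrite powRM ?invr_ge0 ?ltW// -powR_inv1 ?ltW// -powRrM mulN1r.
  have S1 : c `^ (k + 1) * nsq x `^ (- (k + 1)) = (c / nsq x) `^ k * (c / nsq x).
    by rewrite -P powRD ?cxn ?implybT// powRr1.
  have S2 : c `^ (k + 2) * nsq x `^ (- (k + 2)) = (c / nsq x) `^ k * (c / nsq x) ^+ 2.
    by rewrite -P powRD ?cxn ?implybT// powR_mulrn.
  rewrite /F !mulrA S1 S2 -(mulrA a) -P.
  rewrite (addrC _ (- z0)) qfDr /b' /a dotDr dotNr dotZr dotBl qfhZ.
  rewrite (_ : qf A (- z0) = qf A z0); last first.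
    by rewrite -scaleN1r qfhZ sqrrN expr1n mul1r.
  rewrite mulNmx dotNl dotZr.
  ring.
have jF : lap F y ((c / nsq y) `^ (k + 2) * (2 * \tr A)).
  have j0 := lapZ (a * c `^ k) (lap_nsq_powR k y0).
  have j1 := lapZ (c `^ (k + 1)) (lapM (jet_nsq_powR (k + 1) y0) (jet_dot b' y)).
  have j2 := lapZ (c `^ (k + 2)) (lapM (jet_nsq_powR (k + 2) y0) (jet_qf A y)).
  have := lapD j0 (lapD j1 j2); rewrite !tr_nsq_powR//.
  rewrite mxtrace0 !dotZl dot_mxr.
  have -> : (A + A^T)^T = A^T + A by apply/matrixP => i j; rewrite !mxE.
  have -> : dot (y *m (A^T + A)) y = 2 * qf A y.
    by rewrite /qf mulmxDr dotDl (dot_mxl A^T) trmxK dotC; ring.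
  rewrite -kn.
  have E m : nsq y `^ (- m) = nsq y `^ (- m - 1) * nsq y.
    rewrite -[X in _ * X]powRr1 ?nsq_ge0// -powRD ?(gt_eqF s0) ?implybT//.
    by congr (_ `^ _); ring.
  have -> : (c / nsq y) `^ (k + 2) = c `^ (k + 2) * nsq y `^ (- (k + 2)).
    rewrite powRM ?invr_ge0 ?ltW// -powR_inv1 ?ltW// -powRrM mulN1r//.
  rewrite (dotC y b').
  congr (lap F y _).
  ring.
have [bF [AF [jF1 E]]] := jF; exists bF, AF; split; last exact: E.
have nF : \forall h \near (0 : V), y + h != 0 /\ nsq y / 2 < nsq (y + h) /\
    (c / nsq (y + h)) `^ k <= (c / nsq y) `^ k + 1.
  have cs : {for y, continuous nsq} by exact: jet_cont (jet_nsq y).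
  have cn : {for y, continuous (fun x => c `^ k * nsq x `^ (- k))}.
    by have [? [? [/jet_cont]]] := lapZ (c `^ k) (lap_nsq_powR k y0).
  have s2 : 0 < nsq y / 2 by rewrite divr_gt0.
  have /cvg_near0P/(_ _ s2) H1 := cs.
  have /cvg_near0P/(_ _ ltr01) H2 := cn.
  apply: filterS2 H1 H2 => h; rewrite !ltr_norml => /andP[h1 _] /andP[_ h2].
  have h3 : nsq y / 2 < nsq (y + h) by lra.
  have h4 : 0 < nsq (y + h) by lra.
  split; first by rewrite -nsq_gt0.
  split => //.
  rewrite !(powRM _ (ltW c0)) ?invr_ge0 ?ltW// -!powR_inv1 ?ltW// -!powRrM !mulN1r.
  lra.
have Fy : kelvin k c u y = F y.
  by rewrite -(ny y y0) subrr dot0r qf0 !addr0.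
apply: (jet_eq Fy jF1) => e e0.
pose C1 := (c / nsq y) `^ k + 1.
have C10 : 0 < C1 by rewrite ltr_wpDl// powR_ge0.
pose C2 := 2 * c ^+ 2 / nsq y ^+ 2 * n%:R + 1.
have C20' : 0 <= 2 * c ^+ 2 / nsq y ^+ 2 * n%:R.
  by apply: mulr_ge0 => //; apply: divr_ge0; [apply: mulr_ge0 => //|]; exact: sqr_ge0.
have C20 : 0 < C2 by rewrite ltr_wpDl.
have e1 : 0 < e / (C1 * C2) by rewrite divr_gt0// mulr_gt0.
have /near0P[d d0 Hd] := ju _ e1.
near=> h.
have [yh [sh ph]] : y + h != 0 /\ nsq y / 2 < nsq (y + h) /\
    (c / nsq (y + h)) `^ k <= C1 by near: h; exact: nF.
have hd : `|h| < d / (C2 + 1).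
  by near: h; apply: near0_norm; rewrite divr_gt0// addr_gt0.
set z := (c / nsq (y + h)) *: (y + h).
have zz : `|z - z0| ^+ 2 <= C2 * `|h| ^+ 2.
  apply: le_trans (norm_sqr_le _) _; rewrite nsq_inversion//.
  rewrite addrAC subrr add0r; have := nsq_le h => nh.
  have s1 : 0 < nsq (y + h) by rewrite nsq_gt0.
  rewrite ler_pdivrMr ?mulr_gt0//.
  apply: le_trans (_ : c ^+ 2 * (n%:R * `|h| ^+ 2) <= _).
    by rewrite ler_wpM2l ?sqr_ge0.
  apply: le_trans (_ : (2 * c ^+ 2 / nsq y ^+ 2 * n%:R) * `|h| ^+ 2 * (nsq y / 2 * nsq y) <= _).
    by apply: le_eq; field; rewrite gt_eqF.
  apply: ler_pM.
  - by apply: mulr_ge0 => //; exact: sqr_ge0.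
  - by rewrite mulr_ge0 ?divr_ge0 ?ltW.
  - by rewrite ler_wpM2r ?sqr_ge0// lerDl.
  - by rewrite ler_pM2r// ltW.
have zd : `|z - z0| < d.
  have C21 : 0 <= C2 + 1 by rewrite addr_ge0// ltW.
  have q : (C2 + 1) * `|h| < d by rewrite mulrC -ltr_pdivlMr// ltr_wpDl// ltW.
  rewrite -(@ltr_pXn2r _ 2)// ?nnegrE ?(ltW d0)//.
  apply: le_lt_trans zz _.
  apply: le_lt_trans (_ : ((C2 + 1) * `|h|) ^+ 2 < _).
    rewrite exprMn ler_wpM2r ?sqr_ge0//; nra.
  by rewrite ltr_pXn2r// nnegrE ?(ltW d0)// mulr_ge0.
have := Hd _ zd; rewrite (addrC z0) subrK => H.
rewrite /kelvin -/z -(ny _ yh) -/z -mulrBr normrM (ger0_norm (powR_ge0 _ _)).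
rewrite opprD addrA opprD addrA.
apply: le_trans (_ : C1 * (e / (C1 * C2) * `|z - z0| ^+ 2) <= _).
  by rewrite ler_pM ?powR_ge0.
apply: le_trans (_ : C1 * (e / (C1 * C2) * (C2 * `|h| ^+ 2)) <= _).
  by rewrite (ler_wpM2l (ltW C10))// (ler_wpM2l (ltW e1)).
by apply: le_eq; field; rewrite !gt_eqF.
Unshelve. all: by end_near. Qed.
End explicit_laplacians.

(** * The Laplacian and the maximum principle *)

Section closure_laplacian.
Context {R : realType} {n : nat}.
Local Notation V := 'rV[R]_n.
Implicit Types (x y z h b : V) (A B : 'M[R]_n) (u w v f g : V -> R) (D K : set V).

Definition cube x (r : R) : set V := [set y | `|y - x| <= r].

Lemma cont_normP {W : normedModType R} (F : V -> W) x :
  (forall e : R, 0 < e -> exists2 d : R, 0 < d &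
     forall y, `|y - x| < d -> `|F y - F x| < e) -> {for x, continuous F}.
Proof.
move=> H; apply/(cvgrPdist_lt (FF := nbhs_filter x)) => e /H[d d0 Hd].
apply/nbhs_ballP; exists d => //= y; rewrite -ball_normE /= distrC => yd.
by rewrite distrC; exact: Hd.
Qed.

Lemma cube_compact x r : compact (cube x r).
Proof.
apply: bounded_closed_compact.
  exists (`|x| + r); split; first exact: num_real.
  move=> M MM y /= yr; apply: le_trans (ltW MM).
  by rewrite -[y](subrK x) addrC; apply: le_trans (ler_normD _ _) _; rewrite lerD2l.
rewrite (_ : cube x r = (fun y : V => `|y - x|) @^-1` [set t | t <= r])//.
apply: (@preimage_closed _ _ (fun y : V => `|y - x|)); last exact: closed_le.
move=> y _; apply: cont_normP => e e0; exists e => // z zy.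
apply: le_lt_trans (ler_dist_dist _ _) _.
by rewrite opprB addrA subrK.
Qed.

Lemma nbhs_cube x (P : set V) : nbhs x P <-> exists2 r, 0 < r & cube x r `<=` P.
Proof.
split=> [/nbhs_ballP[d /= d0 H]|[r r0 H]].
  exists (d / 2); first by rewrite divr_gt0.
  move=> y /= yd; apply: H; rewrite -ball_normE /= distrC.
  by apply: le_lt_trans yd _; rewrite ltr_pdivrMr// ltr_pMr// ltrDr.
apply/nbhs_ballP; exists r => //= y; rewrite -ball_normE /= distrC => yr.
by apply: H; exact: ltW.
Qed.

Lemma open_cube D x : open D -> D x -> exists2 r, 0 < r & cube x r `<=` D.
Proof. by move=> oD Dx; apply/nbhs_cube; exact: open_nbhs_nbhs. Qed.

Lemma cube_center x (r : R) : 0 <= r -> cube x r x.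
Proof. by move=> r0; rewrite /cube/= subrr normr0. Qed.

Lemma compact_max K w : compact K -> K !=set0 ->
  (forall x, K x -> {for x, continuous w}) ->
  exists2 x, K x & forall y, K y -> w y <= w x.
Proof.
move=> cK K0 cw.
have [|x /set_mem Kx H] := @EVT_max_rV R n w K K0 cK.
  by apply: continuous_in_subspaceT => x /set_mem; exact: cw.
by exists x => // y Ky; apply: H; exact: mem_set.
Qed.

Lemma compact_min K w : compact K -> K !=set0 ->
  (forall x, K x -> {for x, continuous w}) ->
  exists2 x, K x & forall y, K y -> w x <= w y.
Proof.
move=> cK K0 cw.
have [|x /set_mem Kx H] := @EVT_min_rV R n w K K0 cK.
  by apply: continuous_in_subspaceT => x /set_mem; exact: cw.
by exists x => // y Ky; apply: H; exact: mem_set.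
Qed.

Lemma compact_ubound K w : compact K ->
  (forall x, K x -> {for x, continuous w}) ->
  exists2 c, 0 < c & forall x, K x -> w x <= c.
Proof.
move=> cK cw; have [K0|K0] := pselect (K !=set0); last first.
  by exists 1 => // x Kx; exfalso; apply: K0; exists x.
have [x Kx H] := compact_max cK K0 cw.
exists (`|w x| + 1); first by rewrite ltr_wpDl.
by move=> y /H wy; apply: le_trans wy _; rewrite ler_wpDr// ler_norm.
Qed.

(* The closure, for locally uniform convergence of the function together with
   its Laplacian, of the equation Laplacian u = f in D. It is linear, it passes
   to limits, and it still obeys the maximum principle. *)
Definition Lap D u f : Prop := forall K, compact K -> K `<=` D ->
  forall e : R, 0 < e -> exists w g, forall x, K x ->
    [/\ lap w x (g x), `|w x - u x| <= e & `|g x - f x| <= e].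

Lemma Lap_lap D u f : (forall x, D x -> lap u x (f x)) -> Lap D u f.
Proof.
move=> H K cK KD e e0; exists u, f => x /KD /H ?; split => //.
  by rewrite subrr normr0 ltW.
by rewrite subrr normr0 ltW.
Qed.

Lemma Lap_stable D u f :
  (forall K, compact K -> K `<=` D -> forall e : R, 0 < e ->
     exists D' u' f', [/\ Lap D' u' f', K `<=` D' &
       forall x, K x -> `|u' x - u x| <= e /\ `|f' x - f x| <= e]) ->
  Lap D u f.
Proof.
move=> H K cK KD e e0; have e2 : 0 < e / 2 by rewrite divr_gt0.
have [D' [u' [f' [L KD' H']]]] := H K cK KD _ e2.
have [w [g Hw]] := L K cK KD' _ e2.
exists w, g => x Kx; have [l1 l2 l3] := Hw x Kx; have [h1 h2] := H' x Kx.
split => //.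
  rewrite (_ : w x - u x = (w x - u' x) + (u' x - u x)); last by ring.
  by apply: le_trans (ler_normD _ _) _; lra.
rewrite (_ : g x - f x = (g x - f' x) + (f' x - f x)); last by ring.
by apply: le_trans (ler_normD _ _) _; lra.
Qed.

Lemma Lap_eq D D' u u' f f' : Lap D u f -> D' `<=` D ->
  (forall x, D' x -> u x = u' x /\ f x = f' x) -> Lap D' u' f'.
Proof.
move=> L DD H; apply: Lap_stable => K cK KD e e0; exists D, u, f; split => //.
  exact: subset_trans KD DD.
by move=> x /KD /H[-> ->]; rewrite !subrr normr0 ltW.
Qed.

Lemma Lap_sub D D' u f : Lap D u f -> D' `<=` D -> Lap D' u f.
Proof. by move=> L DD; apply: Lap_eq L DD _. Qed.

Lemma LapD D u v f g : Lap D u f -> Lap D v g ->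
  Lap D (fun x => u x + v x) (fun x => f x + g x).
Proof.
move=> L1 L2 K cK KD e e0; have e2 : 0 < e / 2 by rewrite divr_gt0.
have [w1 [g1 H1]] := L1 K cK KD _ e2; have [w2 [g2 H2]] := L2 K cK KD _ e2.
exists (fun x => w1 x + w2 x), (fun x => g1 x + g2 x) => x Kx.
have [a1 a2 a3] := H1 x Kx; have [b1 b2 b3] := H2 x Kx.
split; first exact: lapD.
  rewrite (_ : _ - _ = (w1 x - u x) + (w2 x - v x)); last by ring.
  by apply: le_trans (ler_normD _ _) _; lra.
rewrite (_ : _ - _ = (g1 x - f x) + (g2 x - g x)); last by ring.
by apply: le_trans (ler_normD _ _) _; lra.
Qed.

Lemma LapZ D c u f : Lap D u f -> Lap D (fun x => c * u x) (fun x => c * f x).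
Proof.
move=> L1 K cK KD e e0.
have c1 : 0 < `|c| + 1 by rewrite ltr_wpDl.
have e2 : 0 < e / (`|c| + 1) by rewrite divr_gt0.
have [w1 [g1 H1]] := L1 K cK KD _ e2.
have aux t : `|t| <= e / (`|c| + 1) -> `|c * t| <= e.
  rewrite ler_pdivlMr// normrM => /(le_trans _); apply.
  by rewrite mulrC ler_wpM2l// lerDl.
exists (fun x => c * w1 x), (fun x => c * g1 x) => x Kx.
have [a1 a2 a3] := H1 x Kx.
by split; [exact: lapZ|rewrite -mulrBr aux|rewrite -mulrBr aux].
Qed.

Lemma LapN D u f : Lap D u f -> Lap D (fun x => - u x) (fun x => - f x).
Proof.
move=> /(LapZ (-1)) L; apply: (Lap_eq L) => // x _.
by rewrite !mulN1r.
Qed.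

Lemma LapB D u v f g : Lap D u f -> Lap D v g ->
  Lap D (fun x => u x - v x) (fun x => f x - g x).
Proof. by move=> L /LapN; exact: LapD. Qed.

Lemma affine_continuous z (M : 'M[R]_n) : continuous (fun y : V => z + y *m M).
Proof.
move=> y; apply: cont_normP => e e0.
have c0 : 0 < n%:R * `|M| + 1 by rewrite ltr_wpDl// mulr_ge0.
exists (e / (n%:R * `|M| + 1)); first by rewrite divr_gt0.
move=> t; rewrite ltr_pdivlMr// opprD addrACA subrr add0r -mulmxBl => H.
apply: le_lt_trans (mulmx_le _ _) (le_lt_trans _ H).
by rewrite mulrC ler_wpM2l// lerDl.
Qed.

Lemma Lap_affine D u f z (M : 'M[R]_n) (s : R) : M^T *m M = s%:M ->
  Lap D u f -> Lap [set y | D (z + y *m M)] (fun y => u (z + y *m M))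
    (fun y => s * f (z + y *m M)).
Proof.
move=> MM L K cK KD e e0.
have s1 : 0 < `|s| + 1 by rewrite ltr_wpDl.
have e2 : 0 < e / (`|s| + 1) by rewrite divr_gt0.
have cK' : compact ((fun y : V => z + y *m M) @` K).
  apply: continuous_compact => //.
  by apply: continuous_subspaceT; exact: affine_continuous.
have [|w [g H]] := L _ cK' _ _ e2; first by move=> _ [y Ky <-]; exact: KD.
exists (fun y => w (z + y *m M)), (fun y => s * g (z + y *m M)) => x Kx.
have [|h1 h2 h3] := H (z + x *m M); first by exists x.
split; first exact: lap_affine.
  by apply: le_trans h2 _; rewrite ler_pdivrMr// -[leLHS]mulr1 (ler_wpM2l (ltW e0))// lerDr.
rewrite -mulrBr normrM; apply: le_trans (_ : (`|s| + 1) * (e / (`|s| + 1)) <= _).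
  by rewrite ler_pM// lerDl.
by apply: le_eq; field; rewrite gt_eqF.
Qed.

Lemma Lap_translate D u f z : Lap D u f ->
  Lap [set y | D (z + y)] (fun y => u (z + y)) (fun y => f (z + y)).
Proof.
move=> /(@Lap_affine D u f z 1%:M 1); rewrite mulmx1 trmx1 => /(_ erefl) L.
by apply: (Lap_eq L) => y /=; rewrite mulmx1// mul1r.
Qed.

Lemma Lap_scale D u f z (s : R) : Lap D u f ->
  Lap [set y | D (z + s *: y)] (fun y => u (z + s *: y)) (fun y => s ^+ 2 * f (z + s *: y)).
Proof.
move=> /(@Lap_affine D u f z s%:M (s ^+ 2)) L.
have sE y : y *m s%:M = s *: y by rewrite mul_mx_scalar.
apply: (Lap_eq (L _)) => [|y /=|y /=]; rewrite ?sE//.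
by rewrite tr_scalar_mx -scalar_mxM expr2.
Qed.

Lemma Lap_kelvin D u f (k c : R) : 0 < c -> 2 * k + 2 = n%:R -> Lap D u f ->
  Lap [set y | y != 0 /\ D ((c / nsq y) *: y)] (kelvin k c u)
    (fun y => (c / nsq y) `^ (k + 2) * f ((c / nsq y) *: y)).
Proof.
move=> c0 kn L K cK KD e e0.
have cp m x : x != 0 -> {for x, continuous (fun y : V => (c / nsq y) `^ m)}.
  move=> x0; have [b [A [/jet_cont H _]]] := lapZ (c `^ m) (lap_nsq_powR m x0).
  rewrite (_ : (fun y => _) = (fun y : V => c `^ m * nsq y `^ (- m)))//.
  apply/funext => y.
  by rewrite powRM ?invr_ge0 ?nsq_ge0 ?(ltW c0)// -powR_inv1 ?nsq_ge0// -powRrM mulN1r.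
have [|B1 B10 HB1] := compact_ubound (w := fun y : V => (c / nsq y) `^ k) cK.
  by move=> x /KD[/cp].
have [|B2 B20 HB2] := compact_ubound (w := fun y : V => (c / nsq y) `^ (k + 2)) cK.
  by move=> x /KD[/cp].
have cK' : compact ((fun y : V => (c / nsq y) *: y) @` K).
  apply: continuous_compact => //; apply: continuous_in_subspaceT => x /set_mem /KD[x0 _].
  apply: (@cvgZ R V V (nbhs x) (nbhs_filter x) (fun y => c / nsq y) id); last exact: cvg_id.
  have : {for x, continuous (fun y : V => (c / nsq y) `^ 1)} by exact: cp.
  rewrite (_ : (fun y => _) = (fun y : V => c / nsq y))//.
  by apply/funext => y; rewrite powRr1// divr_ge0 ?nsq_ge0// ltW.
have e2 : 0 < e / (B1 + B2) by rewrite divr_gt0// addr_gt0.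
have [|w [g H]] := L _ cK' _ _ e2; first by move=> _ [y Ky <-]; have [] := KD _ Ky.
exists (kelvin k c w), (fun y => (c / nsq y) `^ (k + 2) * g ((c / nsq y) *: y)) => x Kx.
have [|h1 h2 h3] := H ((c / nsq x) *: x); first by exists x.
have [x0 _] := KD _ Kx.
have aux (b t : R) : 0 <= b -> b <= B1 + B2 -> `|t| <= e / (B1 + B2) -> b * `|t| <= e.
  move=> b0 bB tB; apply: le_trans (_ : (B1 + B2) * (e / (B1 + B2)) <= _).
    by rewrite ler_pM.
  by apply: le_eq; field; rewrite gt_eqF// addr_gt0.
split; first exact: lap_kelvin.
  rewrite /kelvin -mulrBr normrM ger0_norm ?powR_ge0// aux ?powR_ge0//.
  by rewrite ler_wpDr ?HB1// ltW.
rewrite -mulrBr normrM ger0_norm ?powR_ge0// aux ?powR_ge0//.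
by rewrite ler_wpDl ?HB2// ltW.
Qed.

(** Adding the expansions for t e_i and - t e_i cancels the first-order term and leaves the sign of
    each diagonal entry of A. *)
Lemma lap_max w x l : lap w x l -> (\forall h \near (0 : V), w (x + h) <= w x) -> l <= 0.
Proof.
move=> [b [A [jw ->]]] Hm.
suff H i : A i i <= 0 by rewrite pmulr_rle0//; apply: sumr_le0 => i _.
rewrite leNgt; apply/negP => Ai.
have e0 : 0 < A i i / 2 by rewrite divr_gt0.
have /near0P[d d0 Hd] : \forall h \near (0 : V), w (x + h) <= w x /\
   `|w (x + h) - w x - dot b h - qf A h| <= A i i / 2 * `|h| ^+ 2.
  by apply: filterS2 Hm (jw _ e0).
have [t [t0 t_d]] : exists t : R, 0 < t /\ t < d by exists (d / 2); lra.
pose e := delta_mx ord0 i : V.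
have te : `|t *: e| <= t by rewrite normrZ (gtr0_norm t0) (ler_piMr (ltW t0))//; exact: norm_delta.
have td : `|t *: e| < d by exact: le_lt_trans te _.
have [h1] := Hd _ td; have [] := Hd (- (t *: e)); first by rewrite normrN.
rewrite -scaleNr !dotZr !qfhZ qf_delta sqrrN !normrZ !exprMn normrN !real_normK ?num_real// !ler_norml.
move=> h2 /andP[h3 _] /andP[h4 _].
have : `|e| ^+ 2 <= 1 by rewrite expr_le1//; exact: norm_delta.
move: h1 h2 h3 h4; rewrite -/e; set a := `|e| ^+ 2 => h1 h2 h3 h4 a1.
have : 0 < t ^+ 2 * A i i by rewrite mulr_gt0// exprn_gt0.
have : A i i / 2 * (t ^+ 2 * a) <= A i i / 2 * t ^+ 2.
  by rewrite (ler_wpM2l (ltW e0))// ler_piMr// sqr_ge0.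
lra.
Qed.

Lemma nearP0 x (P : set V) : (\forall y \near x, P y) <-> \forall h \near (0 : V), P (x + h).
Proof.
split=> [/nbhs_ballP[d /= d0 H]|/near0P[d d0 H]].
  apply/near0P; exists d => // h hd; apply: H.
  by rewrite -ball_normE /= opprD addrA subrr sub0r normrN.
apply/nbhs_ballP; exists d => //= y; rewrite -ball_normE /= distrC => /H.
by rewrite addrC subrK.
Qed.

(** An approximation w of u is lowered by d |y - x|^2, which forces its maximum over a cube into the
    interior. If c were positive, d of order c / n and an accuracy e at most c / 4 and d r^2 / 4
    would leave a positive Laplacian at that maximum. *)
Lemma Lap_max_principle D u f x (c : R) : open D -> Lap D u f -> D x ->
  (\forall y \near x, u y <= u x) -> (\forall y \near x, c <= f y) -> c <= 0.
Proof.
move=> oD L Dx um fc; rewrite leNgt; apply/negP => c0.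
have [r r0 Hr] : exists2 r, 0 < r & cube x r `<=` [set y | [/\ D y, u y <= u x & c <= f y]].
  apply/nbhs_cube; near=> y; split; near: y => //.
  exact: open_nbhs_nbhs.
pose d := c / (4 * (n%:R + 1)).
have n1 : (0 : R) < n%:R + 1 by rewrite ltr_wpDl.
have d0 : 0 < d by rewrite divr_gt0// mulr_gt0.
pose e := Num.min (c / 4) (d * r ^+ 2 / 4).
have e0 : 0 < e by rewrite lt_min !divr_gt0// mulr_gt0// exprn_gt0.
have [e1 e2] : e <= c / 4 /\ e <= d * r ^+ 2 / 4 by rewrite !ge_min !lexx orbT.
have [|w [g H]] := L (cube x r) (@cube_compact x r) _ e e0; first by move=> y /Hr[].
pose v y := w y - d * nsq (y - x).
have lv y : cube x r y -> lap v y (g y - d * (2 * n%:R)).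
  move=> yr; apply: lapB; first by have [] := H y yr.
  apply: lapZ.
  have := @lap_affine _ _ nsq (- x) 1%:M 1 y (2 * n%:R).
  rewrite mulmx1 trmx1 mul1r => /(_ erefl (lap_nsq _)).
  by under eq_fun do rewrite mulmx1 addrC.
have xr : cube x r x by apply: cube_center; exact: ltW.
have [||y yr ym] := @compact_max (cube x r) v (@cube_compact x r).
- by exists x.
- by move=> y /lv /lap_cont.
have [wx1 wx2 wx3] := H x xr.
have [wy1 wy2 wy3] := H y yr.
have [_ uy fy] := Hr y yr.
have ylt : `|y - x| < r.
  rewrite ltNge; apply/negP => ry.
  have := ym x xr; rewrite /v subrr nsq0 mulr0 subr0.
  have : d * r ^+ 2 <= d * nsq (y - x).
    rewrite (ler_wpM2l (ltW d0))//; apply: le_trans (norm_sqr_le _).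
    by rewrite lerXn2r// nnegrE// ltW.
  have := mulr_gt0 d0 (exprn_gt0 2 r0).
  move: wx2 wy2; rewrite !ler_norml => /andP[? ?] /andP[? ?]; lra.
have := lap_max (lv y yr); have /[swap] /[apply] : \forall h \near (0 : V), v (y + h) <= v y.
  apply/near0P; exists (r - `|y - x|); first by rewrite subr_gt0.
  move=> h hr; apply: ym; rewrite /cube /= addrAC.
  by apply: le_trans (ler_normD _ _) _; rewrite -lerBrDl ltW.
have : d * (2 * n%:R) <= c / 2.
  rewrite (_ : d * _ = c / 2 * (n%:R / (n%:R + 1))); last first.
    by rewrite /d; field; rewrite gt_eqF.
  rewrite ler_piMr//; first by rewrite divr_ge0// ltW.
  by rewrite ler_pdivrMr ?mul1r ?lerDl.
move: wy3; rewrite ler_norml => /andP[? ?]; lra.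
Unshelve. all: by end_near. Qed.
End closure_laplacian.

(** * Comparison, reflections and the interior gradient estimate *)

Section interior_estimate.
Context {R : realType} {n : nat}.
Local Notation V := 'rV[R]_n.
Implicit Types (x y z h b nu : V) (u w v f g : V -> R) (D K : set V).

Lemma norm_attained x (i : 'I_n) : exists j, `|x ord0 j| = `|x|.
Proof.
have [->|x0] := eqVneq x 0; first by exists i; rewrite mxE !normr0.
have nz : mx_norm x != 0 by rewrite -[mx_norm x]/(`|x|) normr_eq0.
by have [[k j] /=] := mx_norm_neq0 nz; rewrite (ord1 k) => H; exists j; rewrite -H.
Qed.

(** The alternative stands for boundary conditions: at a maximum of w over K either the sign is
    already known, or the maximum is interior with a source bounded below by a positive constant,
    which the maximum principle excludes. *)
Lemma Lap_le0 D K w f : open D -> Lap D w f -> compact K ->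
  (forall x, K x -> {for x, continuous w}) ->
  (forall x, K x -> w x <= 0 \/ [/\ D x, nbhs x K &
     exists2 c : R, 0 < c & \forall y \near x, c <= f y]) ->
  forall x, K x -> w x <= 0.
Proof.
move=> oD L cK cw H x Kx.
have [|y Ky ym] := compact_max cK _ cw; first by exists x.
apply: le_trans (ym _ Kx) _.
have [//|[Dy nK [c c0 fc]]] := H y Ky.
have := Lap_max_principle oD L Dy _ fc; rewrite leNgt c0 => /(_ _)/negP[]//.
by apply: filterS nK => t /ym.
Qed.

Lemma contD u v x : {for x, continuous u} -> {for x, continuous v} ->
  {for x, continuous (fun y => u y + v y)}.
Proof. by move=> cu cv; exact: (@continuousD R R V u v x cu cv). Qed.
Lemma contZ (c : R) u x : {for x, continuous u} -> {for x, continuous (fun y => c * u y)}.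
Proof. by move=> cu; exact: (@continuousM R V (cst c) u x (@cst_continuous _ _ _ _) cu). Qed.
Lemma contB u v x : {for x, continuous u} -> {for x, continuous v} ->
  {for x, continuous (fun y => u y - v y)}.
Proof.
move=> cu cv; apply: contD => //.
by rewrite (_ : (fun y => - v y) = (fun y => -1 * v y)); [exact: contZ|apply/funext => y; rewrite mulN1r].
Qed.
Lemma contM u v x : {for x, continuous u} -> {for x, continuous v} ->
  {for x, continuous (fun y => u y * v y)}.
Proof. by move=> cu cv; exact: (@continuousM R V u v x cu cv). Qed.

Definition refl nu (c : R) x : V := x - (2 * (dot nu x - c)) *: nu.

Lemma reflE nu c x : refl nu c x = (2 * c) *: nu + x *m (1%:M - 2 *: (nu^T *m nu)).
Proof.
rewrite /refl mulmxBr mulmx1 -scalemxAr mulmxA.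
have -> : x *m nu^T = (dot nu x)%:M.
  apply/matrixP => i j; rewrite !ord1 !mxE eqxx mulr1n.
  by apply: eq_bigr => k _; rewrite mxE mulrC.
rewrite mul_scalar_mx scalerA mulrBr scalerBl.
by rewrite opprB addrCA addrA.
Qed.

Lemma refl_continuous nu c : continuous (refl nu c).
Proof.
rewrite (_ : refl nu c = (fun x => (2 * c) *: nu + x *m (1%:M - 2 *: (nu^T *m nu)))).
  exact: affine_continuous.
by apply/funext => x; exact: reflE.
Qed.

Lemma dot_refl nu c x : nsq nu = 1 -> dot nu (refl nu c x) = 2 * c - dot nu x.
Proof. by move=> n1; rewrite /refl dotBr dotZr -/(nsq nu) n1; ring. Qed.

Lemma Lap_refl D u f nu c : nsq nu = 1 -> Lap D u f ->
  Lap [set y | D (refl nu c y)] (fun y => u (refl nu c y)) (fun y => f (refl nu c y)).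
Proof.
move=> n1 L.
have MM : (1%:M - 2 *: (nu^T *m nu))^T *m (1%:M - 2 *: (nu^T *m nu)) = 1%:M.
  have -> : (1%:M - 2 *: (nu^T *m nu))^T = 1%:M - 2 *: (nu^T *m nu).
    apply/matrixP => i j; rewrite !(mxE, big_ord1) eq_sym.
    by rewrite (mulrC (nu _ _)).
  rewrite mulmxBl mul1mx mulmxBr mulmx1 -!(scalemxAl, scalemxAr) mulmxA.
  rewrite -(mulmxA _ nu) (_ : nu *m nu^T = 1%:M); last first.
    apply/matrixP => i j; rewrite !ord1 !mxE eqxx mulr1n -n1.
    by apply: eq_bigr => k _; rewrite !mxE.
  rewrite mulmx1 scalerA.
  by apply/matrixP => i j; rewrite !mxE; ring.
have L2 := @Lap_affine _ _ _ _ _ ((2 * c) *: nu) _ _ MM L.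
apply: (Lap_eq L2) => y /=.
  by rewrite reflE.
by rewrite mul1r reflE.
Qed.

Lemma cont_comp_refl u nu c x : {for refl nu c x, continuous u} ->
  {for x, continuous (fun y => u (refl nu c y))}.
Proof. by move=> cu; apply: (@continuous_comp _ _ _ (refl nu c) u) => //; exact: refl_continuous. Qed.

(* Comparison on a half-cube of the odd part of u with a quadratic polynomial
   (Gilbarg-Trudinger, Theorem 3.9). *)
Lemma interior_estimate_center D u f z (i : 'I_n) (d M G s : R) :
  open D -> cube z d `<=` D -> 0 < d -> Lap D u f ->
  (forall x, cube z d x -> {for x, continuous u}) ->
  (forall x, cube z d x -> `|u x| <= M) ->
  (forall x, cube z d x -> `|f x| <= G) -> 0 < G -> 0 <= s <= d ->
  u (z + s *: delta_mx ord0 i) - u (z - s *: delta_mx ord0 i)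
    <= 2 * (n%:R * M / d + d * G) * s.
Proof.
move=> oD QD d0 L cu uM fG G0 /andP[s0 sd].
set e := delta_mx ord0 i.
have n1 : 1 <= n%:R :> R by rewrite ler1n (leq_ltn_trans _ (ltn_ord i)).
have M0 : 0 <= M.
  apply: le_trans (normr_ge0 (u z)) _; apply: uM.
  by apply: cube_center; exact: ltW.
have e1 : nsq e = 1 by exact: nsq_delta.
pose S := refl e (z ord0 i).
have dotS y : dot e (y - z) = y ord0 i - z ord0 i.
  by rewrite dotC dot_delta !mxE.
have SE y : S y - z = (y - z) - (2 * (y - z) ord0 i) *: e.
  by rewrite /S /refl dotC dot_delta !mxE addrAC.
have QS y : cube z d y -> cube z d (S y).
  rewrite /cube /= SE => yd; apply: norm_le => [|j]; first exact: ltW.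
  apply: le_trans yd; rewrite !mxE eqxx /=.
  have := coord_le (y - z) j; rewrite !mxE.
  case: (eqVneq j i) => [->|_]; last by rewrite mulr0 subr0.
  rewrite (_ : _ - 2 * _ * _ = - (y ord0 i - z ord0 i)) ?normrN//.
  by rewrite mulr1n; ring.
pose K := cube z d `&` [set y | 0 <= (y - z) ord0 i].
have cK : compact K.
  apply: compact_closedI; first exact: cube_compact.
  rewrite (_ : [set y | _] = dot e @^-1` [set t | z ord0 i <= t]); last first.
    by apply/funext => y /=; rewrite dotC dot_delta !mxE subr_ge0.
  apply: preimage_closed; last exact: closed_ge.
  by move=> y _; exact: jet_cont (jet_dot e y).
pose t y := dot e (y - z).
(* q is harmonic, since |y - z|^2 and n t^2 have the same Laplacian, and on K it is at least d^2
   where |y - z| = d in the sup norm; r has Laplacian - 2 and is nonnegative for t between 0 and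
   d. *)
pose q y := nsq (y - z) + (- n%:R) * (t y) ^+ 2 + n%:R * d * t y.
pose r y := d * t y - t y ^+ 2.
have ltr y b A w : jet w (y - z) b A -> jet (fun x => w (x - z)) y b A.
  have := @jet_affine _ _ w (- z) 1%:M y b A.
  rewrite !trmx1 !mulmx1 mul1mx addrC => H /H.
  by under eq_fun do rewrite mulmx1 addrC.
have jt y : jet t y e 0 by apply: ltr; exact: jet_dot.
have lt y : lap t y 0 by exists e, 0; split => //; rewrite mxtrace0 mulr0.
have ltt y : lap (fun x => t x ^+ 2) y 2.
  have := lapM (jt y) (jt y); rewrite mxtrace0 !mulr0 !add0r -/(nsq e) e1 mulr1.
  by under eq_fun do rewrite -expr2.
have lq y : lap q y 0.
  have ln : lap (fun x => nsq (x - z)) y (2 * n%:R).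
    exists (2 *: (y - z)), 1%:M; split; last by rewrite mxtrace1.
    by apply: ltr; exact: jet_nsq.
  have := lapD (lapD ln (lapZ (- n%:R) (ltt y))) (lapZ (n%:R * d) (lt y)).
  by congr (lap _ _ _); ring.
have lr y : lap r y (- 2).
  have := lapB (lapZ d (lt y)) (ltt y).
  by congr (lap _ _ _); ring.
(* Its Laplacian is - 2 G, while that of [phi] below is at most G in absolute value: [phi - psi] has
   a source at least G. *)
pose psi y := M / d ^+ 2 * q y + G * r y.
have lpsi y : lap psi y (- 2 * G).
  have := lapD (lapZ (M / d ^+ 2) (lq y)) (lapZ G (lr y)).
  by congr (lap _ _ _); ring.
pose phi y := 2^-1 * (u y - u (S y)).
pose D' := [set y | D y /\ D (S y)].
have oD' : open D'.
  apply: openI => //; apply: open_comp => // y _; exact: refl_continuous.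
have Lw : Lap D' (fun y => phi y - psi y) (fun y => 2^-1 * (f y - f (S y)) - (- 2 * G)).
  apply: LapB; last by apply: Lap_lap.
  apply: LapZ; apply: LapB; first by apply: (Lap_sub L) => y [].
  by apply: (Lap_sub (@Lap_refl _ _ _ _ (z ord0 i) e1 L)) => y [].
have tsq y : t y ^+ 2 <= nsq (y - z).
  by have := CauchySchwarz e (y - z); rewrite e1 mul1r.
have c0 : 0 <= M / d ^+ 2 by rewrite divr_ge0// sqr_ge0.
have KQ y : K y -> cube z d y by case.
have tK y : K y -> 0 <= t y <= d.
  move=> [yd /=]; rewrite /t dotS !mxE => ->/=; apply: le_trans yd.
  by have := coord_le (y - z) i; rewrite !mxE; apply: le_trans; exact: ler_norm.
have q0 y : K y -> nsq (y - z) - t y ^+ 2 <= q y.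
  move=> /tK/andP[t0 td]; rewrite /q.
  have : 0 <= (n%:R - 1) * (t y * (d - t y)) by rewrite !mulr_ge0// subr_ge0.
  have : 0 <= t y * d by rewrite mulr_ge0// ltW.
  lra.
have r0 y : K y -> 0 <= G * r y.
  move=> /tK/andP[t0 td]; rewrite /r expr2 -mulrBl mulr_ge0 ?(ltW G0)//.
  by rewrite mulr_ge0// subr_ge0.
have phiM y : K y -> phi y <= M.
  move=> /KQ yQ; have := uM _ yQ; have := uM _ (QS _ yQ).
  by rewrite !ler_norml /phi => /andP[? ?] /andP[? ?]; lra.
have psi0 y : K y -> 0 <= psi y.
  move=> Ky; rewrite addr_ge0 ?r0// mulr_ge0//.
  by apply: le_trans (q0 _ Ky); rewrite subr_ge0.
have main : forall y, K y -> phi y - psi y <= 0.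
  apply: (Lap_le0 oD' Lw cK).
    move=> y /KQ yQ; apply: contB; last exact: lap_cont (lpsi y).
    apply: contZ; apply: contB; first exact: cu.
    by apply: cont_comp_refl; apply: cu; exact: QS.
  move=> y Ky; have yQ := KQ _ Ky.
  have [t0|t0] := eqVneq (t y) 0.
    left; have -> : phi y = 0.
      rewrite /phi (_ : S y = y) ?subrr ?mulr0//.
      by rewrite /S /refl; move: t0; rewrite /t dotBr (dotC e z) dot_delta => ->; rewrite mulr0 scale0r subr0.
    by rewrite sub0r oppr_le0 psi0.
  have tgt : 0 < t y by have /andP[] := tK _ Ky; rewrite le_eqVlt eq_sym (negbTE t0).
  have [yd|yd] := leP d `|y - z|.
    left; rewrite subr_le0; apply: le_trans (phiM _ Ky) _.
    rewrite /psi -[leLHS]addr0 lerD ?r0//.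
    rewrite mulrAC ler_pdivlMr ?exprn_gt0// ler_wpM2l//.
    have yd' : `|y - z| = d by apply/eqP; rewrite eq_le yd andbT.
    have [j jd] := norm_attained (y - z) i; rewrite yd' in jd.
    have [ji|ji] := eqVneq j i.
      have td : t y = d.
        have /andP[t1 _] := tK _ Ky.
        by rewrite -(ger0_norm t1) /t dotC dot_delta -ji jd.
      have := tsq y; rewrite /q td; lra.
    apply: le_trans (q0 _ Ky).
    rewrite nsqE (bigD1 i)//= (bigD1 j)//= /t (dotC e) dot_delta addrAC subrr add0r.
    rewrite -jd real_normK ?num_real// lerDl sumr_ge0// => k _; exact: sqr_ge0.
  right; split.
  - by split; apply: QD => //; exact: QS.
  - apply/nbhs_cube.
    exists (Num.min (t y) (d - `|y - z|)); first by rewrite lt_min tgt subr_gt0.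
    move=> x; rewrite /cube /= le_min => /andP[x1 x2]; split.
      rewrite /cube /= (_ : x - z = (x - y) + (y - z)); last by rewrite addrA subrK.
      by apply: le_trans (ler_normD _ _) _; rewrite -lerBrDr.
    have := le_trans (coord_le (x - y) i) x1.
    by rewrite /= /t dotS !mxE ler_norml => /andP[+ _]; lra.
  - exists G => //.
    have [r' r'0 Hr'] : exists2 r, 0 < r & cube y r `<=` cube z d.
      exists (d - `|y - z|); first by rewrite subr_gt0.
      move=> x; rewrite /cube /= => x2; rewrite (_ : x - z = (x - y) + (y - z)); last by rewrite addrA subrK.
      by apply: le_trans (ler_normD _ _) _; rewrite -lerBrDr.
    apply/nbhs_cube; exists r' => // x /Hr' xQ /=.
    have := fG _ xQ; have := fG _ (QS _ xQ).
    by rewrite !ler_norml => /andP[? ?] /andP[? ?]; lra.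
pose y := z + s *: e.
have yz : y - z = s *: e by rewrite /y addrC addKr.
have Sy : S y = z - s *: e.
  rewrite /S /refl /y dotDr dotZr -/(nsq e) e1 (dotC e) dot_delta.
  by apply/rowP => j; rewrite !mxE; ring.
have Ky : K y.
  split; rewrite /cube /= yz; last by rewrite !mxE !eqxx mulr1.
  by rewrite normrZ ger0_norm//; apply: le_trans sd; rewrite ler_piMr//; exact: norm_delta.
have := main _ Ky; rewrite /phi Sy /psi /q /r /t yz nsqZ dotZr -/(nsq e) e1 !mulr1 => H.
have : M / d ^+ 2 * (s ^+ 2 + - n%:R * s ^+ 2 + n%:R * d * s) <= n%:R * M / d * s.
  rewrite (_ : n%:R * M / d * s = M / d ^+ 2 * (n%:R * d * s)); last by field; rewrite gt_eqF.
  rewrite ler_wpM2l// gerDr.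
  have := mulr_ge0 (_ : 0 <= n%:R - 1 :> R) (sqr_ge0 s); rewrite subr_ge0 => /(_ n1); lra.
have : G * (d * s - s ^+ 2) <= d * G * s.
  have := mulr_ge0 (ltW G0) (sqr_ge0 s); lra.
rewrite -/y; lra.
Qed.

(** An increment along one axis is the centred estimate at its midpoint, on a cube of half the size;
    x and y are then joined by n axis-parallel increments, hence the factor n. *)
Lemma interior_lipschitz D u f z (d M G : R) :
  open D -> cube z d `<=` D -> 0 < d -> Lap D u f ->
  (forall x, cube z d x -> {for x, continuous u}) ->
  (forall x, cube z d x -> `|u x| <= M) ->
  (forall x, cube z d x -> `|f x| <= G) -> 0 < G ->
  forall x y, cube z (d / 2) x -> cube z (d / 2) y ->
    `|u x - u y| <= n%:R * (2 * n%:R * M / d + d * G) * `|x - y|.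
Proof.
move=> oD QD d0 L cu uM fG G0.
pose C := 2 * n%:R * M / d + d * G / 2.
have M0 : 0 <= M.
  apply: le_trans (normr_ge0 (u z)) _; apply: uM.
  by apply: cube_center; exact: ltW.
have d2 : 0 < d / 2 by rewrite divr_gt0.
have step p t (i : 'I_n) : cube z (d / 2) p -> cube z (d / 2) (p + t *: delta_mx ord0 i) ->
    `|u (p + t *: delta_mx ord0 i) - u p| <= C * `|t|.
  move=> pQ pQ'; pose m := p + (t / 2) *: delta_mx ord0 i.
  have mQ : cube z (d / 2) m.
    rewrite /cube /= (_ : m - z = 2^-1 *: ((p - z) + (p + t *: delta_mx ord0 i - z))); last first.
      by apply/rowP => j; rewrite !mxE; field.
    rewrite normrZ gtr0_norm ?invr_gt0// ler_pdivrMl//.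
    apply: le_trans (ler_normD _ _) _.
    by move: pQ pQ'; rewrite /cube /=; lra.
  have mQQ x : cube m (d / 2) x -> cube z d x.
    rewrite /cube /= => xm; rewrite (_ : x - z = (x - m) + (m - z)); last by rewrite addrA subrK.
    by apply: le_trans (ler_normD _ _) _; move: mQ; rewrite /cube /=; lra.
  have td : `|t| / 2 <= d / 2.
    have : `|t| <= d.
      have := coord_le ((p + t *: delta_mx ord0 i - z) - (p - z)) i.
      rewrite !mxE !eqxx mulr1 (_ : _ - _ = t); last by ring.
      move=> /le_trans; apply; apply: le_trans (ler_normB _ _) _.
      by move: pQ pQ'; rewrite /cube /=; lra.
    lra.
  have t20 : 0 <= `|t| / 2 by rewrite divr_ge0.
  have key v g : Lap D v g ->
     (forall x, cube z d x -> {for x, continuous v}) ->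
     (forall x, cube z d x -> `|v x| <= M) ->
     (forall x, cube z d x -> `|g x| <= G) ->
     v (m + (`|t| / 2) *: delta_mx ord0 i) - v (m - (`|t| / 2) *: delta_mx ord0 i) <= C * `|t|.
    move=> Lv cv vM gG.
    have := @interior_estimate_center D v g m i (d / 2) M G (`|t| / 2) oD _ d2 Lv.
    move=> H; apply: le_trans (H _ _ _ _ _ _) _ => //.
    - by move=> x /mQQ /QD.
    - by move=> x /mQQ /cv.
    - by move=> x /mQQ /vM.
    - by move=> x /mQQ /gG.
    - by rewrite t20.
    - by apply: le_eq; rewrite /C; field; rewrite gt_eqF.
  have k1 := key _ _ L cu uM fG.
  have := key _ _ (LapN L).
  have k2 : (fun x => - u x) (m + (`|t| / 2) *: delta_mx ord0 i) - (fun x => - u x) (m - (`|t| / 2) *: delta_mx ord0 i) <= C * `|t|.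
    apply: (key _ _ (LapN L)) => x xQ; rewrite ?normrN; [|exact: uM|exact: fG].
    have := @contZ (-1) u x (cu _ xQ).
    by rewrite (_ : (fun y => -1 * u y) = (fun y => - u y))//; apply/funext => y; rewrite mulN1r.
  move: k1 k2 => /=; move=> k1 k2 _.
  have E : (p + t *: delta_mx ord0 i = m + (`|t| / 2) *: delta_mx ord0 i /\
      p = m - (`|t| / 2) *: delta_mx ord0 i) \/
     (p + t *: delta_mx ord0 i = m - (`|t| / 2) *: delta_mx ord0 i /\
      p = m + (`|t| / 2) *: delta_mx ord0 i).
    have [t0|t0] := leP 0 t; [left|right].
      by rewrite ger0_norm//; split; apply/rowP => j; rewrite !mxE; field.
    by rewrite ltr0_norm//; split; apply/rowP => j; rewrite !mxE; field.
  rewrite ler_norml; case: E => [[E1 E2]|[E1 E2]]; rewrite E1 E2; lra.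
move=> x y xQ yQ.
pose w k : V := \row_i (if (i < k)%N then x ord0 i else y ord0 i).
have wQ k : cube z (d / 2) (w k).
  rewrite /cube /=; apply: norm_le => [|i]; first exact: ltW.
  rewrite !mxE; have := coord_le (x - z) i; have := coord_le (y - z) i.
  rewrite !mxE => y1 x1; case: ifP => _.
    exact: le_trans x1 xQ.
  exact: le_trans y1 yQ.
have C0 : 0 <= C.
  by apply: addr_ge0; apply: mulr_ge0; rewrite ?mulr_ge0 ?invr_ge0 ?(ltW d0) ?(ltW G0).
suff key k : (k <= n)%N -> `|u (w k) - u y| <= k%:R * (C * `|x - y|).
  have := key n (leqnn n); rewrite (_ : w n = x); last first.
    by apply/rowP => i; rewrite mxE ltn_ord.
  move=> /le_trans; apply; rewrite mulrA ler_wpM2r// ler_wpM2l// /C.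
  have := mulr_ge0 (ltW d0) (ltW G0); lra.
elim: k => [_|k IH kn].
  rewrite (_ : w 0 = y); last by apply/rowP => i; rewrite !mxE.
  by rewrite subrr normr0 mul0r.
pose i := Ordinal kn.
have E : w k.+1 = w k + (x - y) ord0 i *: delta_mx ord0 i.
  apply/rowP => j; rewrite !mxE eqxx /= ltnS leq_eqVlt -val_eqE /=.
  case: eqP => [ji|_] /=; last by rewrite mulr0 addr0.
  rewrite -ji ltnn mulr1 (_ : i = j); last exact: val_inj.
  by rewrite addrC subrK.
have S : `|u (w k.+1) - u (w k)| <= C * `|x - y|.
  have wk := wQ k.+1; rewrite E in wk *.
  by apply: le_trans (step _ _ _ (wQ k) wk) _; rewrite ler_wpM2l// coord_le.
have -> : u (w k.+1) - u y = (u (w k.+1) - u (w k)) + (u (w k) - u y) by ring.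
apply: le_trans (ler_normD _ _) _.
by rewrite -natr1 mulrDl mul1r addrC lerD// IH// ltnW.
Qed.

End interior_estimate.

(** * Limits along an ultrafilter and the strong maximum principle *)

Lemma powR_diff_le {R : realType} (p x y : R) : 1 <= p -> 0 <= y <= x ->
  x `^ p - y `^ p <= p * x `^ (p - 1) * (x - y).
Proof.
move=> p1 /andP[y0 yx].
have [y0'|y0'] := eqVneq y 0.
  rewrite y0' powR0 ?subr0; last by rewrite gt_eqF// (lt_le_trans _ p1).
  have x0 : 0 <= x by apply: le_trans yx.
  rewrite -mulrA (mulrC _ x) mulr_powRB1// ?(lt_le_trans _ p1)//.
  by rewrite ler_peMl// powR_ge0.
have yg : 0 < y by rewrite lt_neqAle eq_sym y0'.
have [|t|c cyx ->] := @MVT_segment R (fun t => t `^ p) (fun t => p * t `^ (p - 1)) y x yx.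
- by move=> t; rewrite in_itv/= => /andP[yt _]; apply: is_derive1_powR; apply: lt_trans yt.
- apply: derivable_within_continuous => s; rewrite in_itv/= => /andP[ys _].
  have s0 : 0 < s by apply: lt_le_trans ys.
  by have [] := is_derive1_powR p s0.
move: cyx; rewrite in_itv/= => /andP[yc cx].
rewrite ler_wpM2r ?subr_ge0// ler_wpM2l//; first by rewrite (le_trans _ p1).
by rewrite ge0_ler_powR ?nnegrE ?subr_ge0// ?(le_trans _ yc)// (le_trans _ yx).
Qed.

Lemma powR_lip {R : realType} (p x y : R) : 1 <= p -> 0 <= x <= 1 -> 0 <= y <= 1 ->
  `|x `^ p - y `^ p| <= p * `|x - y|.
Proof.
move=> p1; wlog yx : x y / y <= x.
  move=> H x1 y1; have [yx|/ltW xy] := leP y x; first exact: H.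
  by rewrite distrC (distrC x); exact: H.
move=> /andP[x0 x1] /andP[y0 y1].
have p0 : 0 <= p by apply: le_trans p1.
rewrite !ger0_norm ?subr_ge0// ?ge0_ler_powR// ?nnegrE//.
apply: le_trans (powR_diff_le p1 _) _; first by rewrite y0.
rewrite ler_wpM2r ?subr_ge0// -[leRHS]mulr1 ler_wpM2l//.
apply: le_trans (_ : x `^ (p - 1) <= 1 `^ (p - 1)) _; last by rewrite powR1.
by rewrite ge0_ler_powR ?nnegrE// subr_ge0.
Qed.

Section ultralimits.
Context {R : realType} {n : nat}.
Local Notation V := 'rV[R]_n.
Variables (F : set_system nat).
Context {FU : UltraFilter F}.
Implicit Types (x y z : V) (u w v f g : V -> R) (D K : set V).

Let FP : ProperFilter F. Proof. exact: ultra_proper. Qed.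

(** A cluster point of an ultrafilter is a limit, because the preimage of a neighbourhood or its
    complement belongs to F. *)
Lemma ultra_compact (T : topologicalType) (A : set T) (a : nat -> T) :
  compact A -> (\forall k \near F, A (a k)) -> exists2 l, A l & a k @[k --> F] --> l.
Proof.
move=> cA FA.
have [l [Al cl]] : A `&` cluster (a k @[k --> F]) !=set0.
  exact: cA (fmap_proper_filter a FP) FA.
exists l => // U Ul.
have [//|H] := in_ultra_setVsetC (a @^-1` U) FU.
by have [t []] := cl (~` U) U H Ul.
Qed.

Lemma ultra_real (a : nat -> R) (B : R) :
  (\forall k \near F, `|a k| <= B) ->
  exists2 l, `|l| <= B & forall e, 0 < e -> \forall k \near F, `|a k - l| < e.
Proof.
move=> aB.
have [|l lB al] := @ultra_compact R `[- B, B]%classic a (@segment_compact _ _ _).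
  by apply: filterS aB => k; rewrite /= in_itv/= ler_norml.
exists l; first by move: lB; rewrite /= in_itv/= ler_norml.
move=> e e0; have /cvgrPdist_lt/(_ _ e0) := al.
by apply: filterS => k; rewrite distrC.
Qed.

Lemma ultra_rV K (a : nat -> V) : compact K -> (\forall k \near F, K (a k)) ->
  exists2 l, K l & forall e : R, 0 < e -> \forall k \near F, `|a k - l| < e.
Proof.
move=> cK aK; have [l Kl al] := ultra_compact cK aK.
exists l => // e e0; have /cvgrPdist_lt/(_ _ e0) := al.
by apply: filterS => k; rewrite distrC.
Qed.

Lemma ultra_le (a : nat -> R) (l c : R) :
  (forall e, 0 < e -> \forall k \near F, `|a k - l| < e) ->
  (\forall k \near F, a k <= c) -> l <= c.
Proof.
move=> al ac; rewrite leNgt; apply/negP => cl.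
have e0 : 0 < (l - c) by rewrite subr_gt0.
have [k [h1 h2]] := filter_ex (filterI (al _ e0) ac).
by move: h1; rewrite ltr_norml => /andP[? ?]; lra.
Qed.

Definition lip (L : R) u := forall x y, `|u x - u y| <= L * `|x - y|.

Lemma lip_cont L u : lip L u -> forall x, {for x, continuous u}.
Proof.
move=> uL x; apply: cont_normP => e e0.
have L1 : 0 < `|L| + 1 by rewrite ltr_wpDl.
exists (e / (`|L| + 1)); first by rewrite divr_gt0.
move=> y; rewrite ltr_pdivlMr// => H; apply: le_lt_trans (uL _ _) (le_lt_trans _ H).
by rewrite mulrC ler_wpM2l// ler_wpDr// ler_norm.
Qed.

(** Arzela-Ascoli along an ultrafilter. Boundedness gives pointwise limits; if convergence were not
    uniform on K, points where it fails would converge to some l in K, and the common Lipschitz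
    bound would contradict convergence at l. *)
Lemma ultra_fun (v : nat -> V -> R) (B L : R) :
  (forall k y, `|v k y| <= B) -> (forall k, lip L (v k)) ->
  exists w, [/\ forall y (e : R), 0 < e -> \forall k \near F, `|v k y - w y| < e,
    lip L w, forall y, `|w y| <= B &
    forall K, compact K -> forall e : R, 0 < e ->
      \forall k \near F, forall y, K y -> `|v k y - w y| <= e].
Proof.
move=> vB vL.
have /choice[w Hw] y : exists l, `|l| <= B /\ forall e, 0 < e -> \forall k \near F, `|v k y - l| < e.
  have [|l l1 l2] := @ultra_real (fun k => v k y) B; last by exists l.
  by apply: filterE => k; exact: vB.
have cw y e : 0 < e -> \forall k \near F, `|v k y - w y| < e by have [_] := Hw y; exact.
have wL : lip L w.
  move=> x y; rewrite leNgt; apply/negP => H.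
  pose e := (`|w x - w y| - L * `|x - y|) / 2.
  have e0 : 0 < e by rewrite divr_gt0// subr_gt0.
  have [k [h1 h2]] := filter_ex (filterI (cw x _ e0) (cw y _ e0)).
  have := vL k x y; have := ler_normD (w x - v k x) ((v k x - v k y) + (v k y - w y)).
  have := ler_normD (v k x - v k y) (v k y - w y).
  rewrite (_ : _ + (_ + (_ - w y)) = w x - w y); last by ring.
  rewrite distrC in h1; move: h1 h2; rewrite /e; lra.
exists w; split => //; first by move=> y; have [] := Hw y.
move=> K cK e e0.
have [//|H] := in_ultra_setVsetC [set k | forall y, K y -> `|v k y - w y| <= e] FU.
exfalso.
have /choice[a Ha] k : exists y, (exists2 y, K y & e < `|v k y - w y|) -> K y /\ e < `|v k y - w y|.
  have [[y Ky yk]|nk] := pselect (exists2 y, K y & e < `|v k y - w y|); first by exists y.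
  by exists 0 => /nk.
have H2 : \forall k \near F, K (a k) /\ e < `|v k (a k) - w (a k)|.
  apply: filterS H => k /=; apply: contra_notP => nk y Ky.
  rewrite leNgt; apply/negP => yk; apply: nk; apply: Ha; by exists y.
have [|l Kl al] := @ultra_rV K a cK; first by apply: filterS H2 => k [].
have L1 : 0 < `|L| + 1 by rewrite ltr_wpDl.
have e3 : 0 < e / 3 by rewrite divr_gt0.
have e3L : 0 < e / 3 / (`|L| + 1) by rewrite divr_gt0.
have [k [[k1 k2] [k3 k4]]] := filter_ex (filterI H2 (filterI (al _ e3L) (cw l _ e3))).
have LL : L * `|a k - l| <= e / 3.
  apply: le_trans (_ : (`|L| + 1) * `|a k - l| <= _).
    by rewrite ler_wpM2r// ler_wpDr// ler_norm.
  by rewrite mulrC -ler_pdivlMr// ltW.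
have := vL k (a k) l; have := wL l (a k); rewrite (distrC l).
have := ler_normD (v k (a k) - v k l) ((v k l - w l) + (w l - w (a k))).
have := ler_normD (v k l - w l) (w l - w (a k)).
rewrite (_ : _ + (_ + (_ - w (a k))) = v k (a k) - w (a k)); last by ring.
lra.
Qed.

Lemma Lap_ultra D u f (v : nat -> V -> R) :
  (forall K, compact K -> K `<=` D -> forall e : R, 0 < e ->
     \forall k \near F, exists D' g, [/\ Lap D' (v k) g, K `<=` D',
       forall x, K x -> `|g x - f x| <= e & forall x, K x -> `|v k x - u x| <= e]) ->
  Lap D u f.
Proof.
move=> H; apply: Lap_stable => K cK KD e e0.
have [k [D' [g [h1 h2 h3 h4]]]] := filter_ex (H K cK KD e e0).
exists D', (v k), g; split => // x Kx; split; [exact: h4|exact: h3].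
Qed.
End ultralimits.

Section strong_maximum_principle.
Context {R : realType} {n : nat}.
Local Notation V := 'rV[R]_n.
Implicit Types (x y z : V) (u w v f g : V -> R) (D K : set V).

Lemma lap_shift w z x (l : R) : lap w (x - z) l -> lap (fun y => w (y - z)) x l.
Proof.
move=> lw; have := @lap_affine _ _ w (- z) 1%:M 1 x l.
rewrite trmx1 mul1r !mulmx1 (addrC (- z)) => /(_ erefl lw).
by under eq_fun do rewrite mulmx1 addrC.
Qed.

Lemma cont_nsqB z x : {for x, continuous (fun y : V => nsq (y - z))}.
Proof.
exact: lap_cont (lap_shift (lap_nsq (x - z))).
Qed.

(** Positivity spreads from the centre of a ball: on an annulus w is compared with a multiple of |x
    - z|^(-2m) - s2^(-m), strictly subharmonic for m = n + 1 and zero on the outer sphere. All radii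
    are squared. *)
Lemma SMP_ball D w f z (r : R) : open D -> Lap D w f ->
  (forall x, D x -> {for x, continuous w}) ->
  (forall x, D x -> f x <= 0) -> (forall x, D x -> 0 <= w x) ->
  (forall x, nsq (x - z) < r -> D x) -> 0 < w z ->
  forall y, nsq (y - z) < r -> 0 < w y.
Proof.
move=> oD L cw f0 w0 rD wz y yr.
have [->//|yz] := eqVneq y z.
pose s1 := nsq (y - z); have s10 : 0 < s1 by rewrite nsq_gt0 subr_eq0.
pose s2 := (s1 + r) / 2.
have s12 : s1 < s2 by rewrite /s2 /s1; lra.
have s2r : s2 < r by rewrite /s2 /s1; lra.
have Dz : D z by apply: rD; rewrite subrr nsq0 (lt_trans s10 yr).
have [rho rho0 [rho1 Hrho]] : exists2 rho, 0 < rho & rho <= s1 / 2 /\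
    forall x, nsq (x - z) <= rho -> w z / 2 <= w x.
  have wz2 : 0 < w z / 2 by rewrite divr_gt0.
  have /cvg_near0P/(_ _ wz2)/near0P[d d0 Hd] := cw _ Dz.
  exists (Num.min (d ^+ 2 / 2) (s1 / 2)).
    by rewrite lt_min !divr_gt0// exprn_gt0.
  split; first by rewrite ge_min lexx orbT.
  move=> x; rewrite le_min => /andP[xd _].
  have : `|x - z| < d.
    rewrite -(@ltr_pXn2r _ 2)// ?nnegrE ?(ltW d0)//.
    apply: le_lt_trans (norm_sqr_le _) (le_lt_trans xd _).
    have := exprn_gt0 2 d0; lra.
  by move=> /Hd; rewrite (addrC z) subrK ltr_norml => /andP[? ?]; lra.
pose m : R := n%:R + 1.
have m0 : 0 < m by rewrite ltr_wpDl.
pose c0 := w z / 2; have c00 : 0 < c0 by rewrite divr_gt0.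
(* Keeps the barrier below w z / 2 on the inner sphere, where w is at least that much. *)
pose eta := c0 * rho `^ m; have eta0 : 0 < eta by rewrite mulr_gt0// powR_gt0.
pose psi x := eta * (nsq (x - z) `^ (- m) - s2 `^ (- m)).
pose D' := D `&` [set x | x != z].
have oD' : open D'.
  apply: openI => //.
  rewrite (_ : [set x | x != z] = (fun x : V => nsq (x - z)) @^-1` [set t | 0 < t]).
    by apply: open_comp; [move=> x _; exact: cont_nsqB|exact: open_gt].
  by apply/funext => x /=; rewrite nsq_gt0 subr_eq0.
pose l x := eta * (2 * m * (2 * m + 2 - n%:R) * nsq (x - z) `^ (- m - 1)).
have lpsi x : x != z -> lap psi x (l x).
  move=> xz; apply: lapZ.
  have xz' : x - z != 0 by rewrite subr_eq0.
  have := lapB (lap_shift (lap_nsq_powR m xz')) (lap_cst (s2 `^ (- m)) x).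
  by rewrite subr0.
have Lw : Lap D' (fun x => psi x - w x) (fun x => l x - f x).
  apply: LapB; first by apply: Lap_lap => x [_]; exact: lpsi.
  by apply: Lap_sub L _ => x [].
pose K := [set x | rho <= nsq (x - z) <= s2].
have Kz x : K x -> x != z.
  move=> /andP[rx _]; rewrite -subr_eq0 -nsq_gt0; exact: lt_le_trans rx.
have KD x : K x -> D x by move=> /andP[_ xs]; apply: rD; exact: le_lt_trans xs s2r.
have cK : compact K.
  rewrite (_ : K = cube z (s2 + 1) `&` K); last first.
    apply/seteqP; split => x; last by case.
    move=> Kx; split => //; rewrite /cube /=; have /andP[_ xs] := Kx.
    have : `|x - z| ^+ 2 <= s2 by apply: le_trans (norm_sqr_le _) xs.
    have : 0 < s2 by apply: lt_trans s12.
    have := normr_ge0 (x - z); nra.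
  apply: compact_closedI; first exact: cube_compact.
  apply: (@preimage_closed _ _ (fun x : V => nsq (x - z)) `[rho, s2]%classic).
    by move=> x _; exact: cont_nsqB.
  exact: itv_closed.
have rs2 : rho < s2 by move: rho1 s12; lra.
have powlt (a b k : R) : 0 < a -> a <= b -> 0 < k -> b `^ (- k) <= a `^ (- k).
  move=> a0 ab k0; rewrite !powRN lef_pV2 ?posrE ?powR_gt0//; last exact: lt_le_trans ab.
  by rewrite ge0_ler_powR ?nnegrE ?(ltW k0) ?(ltW a0)// (le_trans (ltW a0)).
have main : forall x, K x -> psi x - w x <= 0.
  apply: (Lap_le0 oD' Lw cK).
    move=> x Kx; apply: contB; last by apply: cw; exact: KD.
    by apply: lap_cont (lpsi _ (Kz _ Kx)).
  move=> x Kx; have /andP[x1 x2] := Kx.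
  have [xrho|xrho] := leP (nsq (x - z)) rho.
    left; rewrite subr_le0; apply: le_trans (Hrho _ xrho).
    have xe : nsq (x - z) = rho by apply/eqP; rewrite eq_le xrho.
    have E : rho `^ m * rho `^ (- m) = 1 by rewrite powRN divff// gt_eqF// powR_gt0.
    rewrite /psi xe mulrBr {1}/eta -mulrA E mulr1 gerBl.
    by rewrite mulr_ge0 ?powR_ge0// ltW.
  have [xs|xs] := leP s2 (nsq (x - z)).
    left; rewrite subr_le0; apply: le_trans (w0 _ (KD _ Kx)).
    have xe : nsq (x - z) = s2 by apply/eqP; rewrite eq_le xs x2.
    by rewrite /psi xe subrr mulr0.
  have nK : nbhs x (fun y => rho < nsq (y - z) < s2).
    have /cvg_near0P cx := @cont_nsqB z x.
    have e0 : 0 < Num.min (nsq (x - z) - rho) (s2 - nsq (x - z)).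
      by rewrite lt_min !subr_gt0 xrho.
    apply/nearP0; apply: filterS (cx _ e0) => h.
    by rewrite lt_min => /andP[]; rewrite !ltr_norml => /andP[? ?] /andP[? ?]; lra.
  right; split.
  - by split; [exact: KD|exact: Kz].
  - by apply: filterS nK => t /andP[t1 t2]; rewrite /K/= !ltW.
  - exists (eta * (2 * m * (2 * m + 2 - n%:R) * s2 `^ (- m - 1))).
      rewrite mulr_gt0// mulr_gt0 ?powR_gt0//; last exact: lt_trans s12.
      rewrite mulr_gt0 ?mulr_gt0// /m; have : (0 : R) <= n%:R by [].
      lra.
    apply: filterS nK => t /andP[t1 t2].
    have Kt : K t by rewrite /K/= !ltW.
    have ft := f0 _ (KD _ Kt).
    rewrite -[leLHS]subr0 lerB// /l ler_wpM2l ?(ltW eta0)// ler_wpM2l//.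
      rewrite mulr_ge0 ?mulr_ge0 ?(ltW m0)// /m; have : (0 : R) <= n%:R by [].
      lra.
    rewrite -opprD; apply: powlt; [exact: lt_trans t1|exact: ltW t2|].
    by rewrite ltr_wpDl// ltW.
have Ky : K y by rewrite /K/= -/s1 (ltW s12) andbT; lra.
have := main _ Ky; rewrite subr_le0; apply: lt_le_trans.
rewrite /psi mulr_gt0// subr_gt0 !powRN ltf_pV2 ?posrE ?powR_gt0//; last exact: lt_trans s12.
by rewrite gt0_ltr_powR ?nnegrE ?(ltW s10)// (ltW (lt_trans s10 s12)).
Qed.

(** A chain of balls of squared radius r along the segment. As N exceeds |y - z|^2 / r, consecutive
    centres are at squared distance |y - z|^2 / N^2 < r. *)
Lemma SMP_segment D w f z y (r : R) : open D -> Lap D w f ->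
  (forall x, D x -> {for x, continuous w}) ->
  (forall x, D x -> f x <= 0) -> (forall x, D x -> 0 <= w x) -> 0 < r ->
  (forall x s, 0 <= s <= 1 -> nsq (x - (z + s *: (y - z))) < r -> D x) ->
  0 < w z -> 0 < w y.
Proof.
move=> oD L cw f0 w0 r0 rD wz.
pose N := (Num.truncn (nsq (y - z) / r)).+1.
have Nr : nsq (y - z) < N%:R * r.
  by rewrite -ltr_pdivrMr// /N; exact: truncnS_gt.
have N0 : (0 : R) < N%:R by [].
suff key k : (k <= N)%N -> 0 < w (z + (k%:R / N%:R) *: (y - z)).
  by have := key N (leqnn N); rewrite divff ?gt_eqF// scale1r addrC subrK.
elim: k => [_|k IH kN]; first by rewrite mul0r scale0r addr0.
apply: (@SMP_ball D w f (z + (k%:R / N%:R) *: (y - z)) r) => //.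
- move=> x; apply: rD; rewrite divr_ge0//= ler_pdivrMr// mul1r ler_nat; exact: ltnW.
- exact: IH (ltnW kN).
- rewrite opprD addrACA subrr add0r -scalerBl -mulrBl -natrB// subSnn mul1r nsqZ.
  rewrite exprVn ltr_pdivrMl ?exprn_gt0//; apply: lt_le_trans Nr _.
  by rewrite ler_wpM2r ?(ltW r0)// expr2 ler_peMl// ler1n /N.
Qed.
End strong_maximum_principle.

(** * The Liouville theorem in the space *)

Section whole_space.
Context {R : realType} {n : nat}.
Local Notation V := 'rV[R]_n.
Implicit Types (x y z : V) (u w v f g : V -> R) (D K : set V).

Lemma contN u x : {for x, continuous u} -> {for x, continuous (fun y => - u y)}.
Proof. by move=> cu; exact: (@continuousN R R V u x cu). Qed.

Lemma cont_near_gt f x (c : R) : {for x, continuous f} -> c < f x ->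
  \forall y \near x, c <= f y.
Proof.
move=> cf cfx; have e0 : 0 < f x - c by rewrite subr_gt0.
have /cvg_near0P/(_ _ e0) H := cf; apply/nearP0; apply: filterS H => h.
by rewrite ltr_norml => /andP[? ?]; lra.
Qed.

Lemma Lap_max_cont D u f x : open D -> Lap D u f -> D x ->
  (\forall y \near x, u y <= u x) -> {for x, continuous f} -> f x <= 0.
Proof.
move=> oD L Dx um cf; rewrite leNgt; apply/negP => f0.
have f2 : f x / 2 < f x by lra.
have := Lap_max_principle oD L Dx um (cont_near_gt cf f2); lra.
Qed.

Lemma Lap_le0_cont D K w f : open D -> Lap D w f -> compact K ->
  (forall x, K x -> {for x, continuous w}) ->
  (forall x, K x -> w x <= 0 \/ [/\ D x, nbhs x K, {for x, continuous f} & 0 < f x]) ->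
  forall x, K x -> w x <= 0.
Proof.
move=> oD L cK cw H; apply: (Lap_le0 oD L cK cw) => x /H[|[? ? cf f0]]; [by left|right].
split => //; exists (f x / 2); first lra.
by apply: cont_near_gt cf _; lra.
Qed.

Lemma cont_nsq x : {for x, continuous (nsq : V -> R)}.
Proof. exact: jet_cont (jet_nsq x). Qed.

Lemma annulus_compact (a b : R) : compact [set y : V | a <= nsq y <= b].
Proof.
set K := [set _ | _].
rewrite (_ : K = cube 0 (`|b| + 1) `&` K); last first.
  apply/seteqP; split => x; last by case.
  move=> Kx; split => //; rewrite /cube /= subr0; have /andP[_ xs] := Kx.
  have : `|x| ^+ 2 <= `|b|.
    by apply: le_trans (norm_sqr_le _) (le_trans xs _); exact: ler_norm.
  by have := normr_ge0 x; have := normr_ge0 b; nra.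
apply: compact_closedI; first exact: cube_compact.
apply: (@preimage_closed _ _ (nsq : V -> R) `[a, b]%classic).
  by move=> x _; exact: cont_nsq.
exact: itv_closed.
Qed.

Lemma annulus_nbhs (a b : R) x : a < nsq x < b -> nbhs x [set y : V | a < nsq y < b].
Proof.
move=> /andP[ax xb].
have e0 : 0 < Num.min (nsq x - a) (b - nsq x) by rewrite lt_min !subr_gt0 ax.
have /cvg_near0P/(_ _ e0) H := @cont_nsq x.
apply/nearP0; apply: filterS H => h.
by rewrite lt_min => /andP[]; rewrite !ltr_norml /= => /andP[? ?] /andP[? ?]; lra.
Qed.

Lemma open_nsq_gt (a : R) : open [set y : V | a < nsq y].
Proof.
apply: (@open_comp _ _ (nsq : V -> R) [set t : R | a < t]); last exact: open_gt.
by move=> x _; exact: cont_nsq.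
Qed.

(** Comparison with b (|y|^(-2k) - S^(-k)), which vanishes for |y|^2 = S; S is so large that b
    S^(-k) is below a supposed defect. The condition n <= 2k + 2 makes this barrier subharmonic, and
    f < 0 gives strictness. *)
Lemma exterior_lower_bound D w f (k rho b : R) :
  0 < k -> n%:R <= 2 * k + 2 -> 0 < rho -> 0 < b -> open D ->
  (forall y, rho <= nsq y -> D y) -> Lap D w f ->
  (forall y, D y -> {for y, continuous w}) ->
  (forall y, D y -> {for y, continuous f}) ->
  (forall y, rho < nsq y -> f y < 0) ->
  (forall y, rho <= nsq y -> 0 <= w y) ->
  (forall y, nsq y = rho -> b * rho `^ (- k) <= w y) ->
  forall y, rho <= nsq y -> b * nsq y `^ (- k) <= w y.
Proof.
move=> k0 kn rho0 b0 oD rD L cw cf f0 w0 wb y1 y1r.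
have ne y : rho <= nsq y -> y != 0.
  by move=> ry; rewrite -nsq_gt0; exact: lt_le_trans ry.
rewrite leNgt; apply/negP => H.
pose e := b * nsq y1 `^ (- k) - w y1; have e0 : 0 < e by rewrite subr_gt0.
pose S := Num.max (nsq y1 + 1) ((b / e + 1) `^ (k^-1)).
have S1 : nsq y1 < S by rewrite lt_max ltrDl ltr01.
have S0 : 0 < S by apply: lt_trans S1; apply: lt_le_trans y1r.
have be0 : 0 < b / e by rewrite divr_gt0.
have Sk : b / e + 1 <= S `^ k.
  have -> : b / e + 1 = ((b / e + 1) `^ k^-1) `^ k.
    by rewrite -powRrM mulVf ?gt_eqF// powRr1// addr_ge0// ltW.
  apply: ge0_ler_powR; rewrite ?nnegrE ?powR_ge0 ?(ltW k0) ?(ltW S0)//.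
  by rewrite /S le_max lexx orbT.
have bS : b * S `^ (- k) < e.
  rewrite powRN ltr_pdivrMr ?powR_gt0//; apply: lt_le_trans (_ : e * (b / e + 1) <= _).
    by rewrite mulrDr mulr1 mulrCA divff ?mulr1 ?gt_eqF// ltrDl.
  by rewrite ler_wpM2l// ltW.
pose l y := b * (2 * k * (2 * k + 2 - n%:R) * nsq y `^ (- k - 1)).
pose D' := D `&` [set y : V | 0 < nsq y].
have oD' : open D'.
  by apply: openI => //; exact: open_nsq_gt.
have Lw : Lap D' (fun y => b * nsq y `^ (- k) - b * S `^ (- k) - w y) (fun y => l y - 0 - f y).
  apply: LapB; last by apply: Lap_sub L _ => x [].
  apply: Lap_lap => x [_ /=]; rewrite nsq_gt0 => x0; apply: lapB; last exact: lap_cst.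
  by apply: lapZ; exact: lap_nsq_powR.
have cl y : y != 0 -> {for y, continuous l}.
  move=> y0; rewrite /l; apply: contZ; apply: contZ.
  have /lap_cont := lap_nsq_powR (k + 1) y0.
  by rewrite opprD.
have D'K y : rho <= nsq y -> D' y.
  by move=> ry; split; [exact: rD|exact: lt_le_trans ry].
have main : forall y, rho <= nsq y <= S -> b * nsq y `^ (- k) - b * S `^ (- k) - w y <= 0.
  apply: (Lap_le0_cont oD' Lw (@annulus_compact rho S)).
    move=> y /andP[ry _]; apply: contB; last by apply: cw; exact: rD.
    apply: contB; last exact: cst_continuous.
    by apply: contZ; exact: lap_cont (lap_nsq_powR k (ne _ ry)).
  move=> y /andP[ry yS].
  have [yr|yr] := leP (nsq y) rho.
    left; have yr' : nsq y = rho by apply/eqP; rewrite eq_le yr.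
    have := wb _ yr'; rewrite yr'; have := mulr_ge0 (ltW b0) (powR_ge0 S (- k)); lra.
  have [Sy|Sy] := leP S (nsq y).
    left; have yr' : nsq y = S by apply/eqP; rewrite eq_le yS.
    by rewrite yr' subrr sub0r oppr_le0; exact: w0.
  right; split.
  - exact: D'K.
  - have /annulus_nbhs : rho < nsq y < S by rewrite yr.
    by apply: filterS => t /andP[t1 t2]; rewrite /= !ltW.
  - apply: contB; last by apply: cf; exact: rD.
    by apply: contB; [exact: cl (ne _ ry)|exact: cst_continuous].
  - rewrite subr0 subr_gt0; apply: lt_le_trans (f0 _ yr) _.
    rewrite /l !mulr_ge0 ?(ltW b0) ?(ltW k0) ?powR_ge0//.
    by rewrite subr_ge0.
have := main y1; rewrite y1r (ltW S1) => /(_ isT).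
move: bS; rewrite /e; lra.
Qed.

Lemma sphere_pos_min w (k rho : R) : 0 < rho -> (forall y, nsq y = rho -> {for y, continuous w}) ->
  (forall y, nsq y = rho -> 0 < w y) ->
  exists2 b, 0 < b & forall y, nsq y = rho -> b * rho `^ (- k) <= w y.
Proof.
move=> rho0 cw w0.
have rk : 0 < rho `^ (- k) by rewrite powR_gt0.
have KE y : (rho <= nsq y <= rho) <-> nsq y = rho.
  by split=> [/andP[? ?]|->]; [apply/eqP; rewrite eq_le; apply/andP|rewrite lexx].
have [K0|K0] := pselect ([set y : V | rho <= nsq y <= rho] !=set0); last first.
  by exists 1 => // y yr; exfalso; apply: K0; exists y; exact/KE.
have [|x Kx H] := compact_min (@annulus_compact rho rho) K0 (w := w).
  by move=> x /KE; exact: cw.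
exists (w x / rho `^ (- k)); first by rewrite divr_gt0// w0//; exact/KE.
by move=> y yr; rewrite divfK ?gt_eqF//; apply: H; exact/KE.
Qed.

Lemma cont_inversion (c : R) y : y != 0 -> {for y, continuous (fun y : V => (c / nsq y) *: y)}.
Proof.
move=> y0; apply: (@cvgZ R V V (nbhs y) (nbhs_filter y) (fun y => c / nsq y) id); last exact: cvg_id.
apply: (@contZ R n c (fun y => (nsq y)^-1)).
have := lap_cont (lap_nsq_powR 1 y0).
rewrite (_ : (fun y => _) = (fun y : V => (nsq y)^-1))//.
by apply/funext => x; rewrite powR_inv1 ?nsq_ge0.
Qed.

Lemma cont_ratio_powR (m c : R) y : 0 <= c -> y != 0 ->
  {for y, continuous (fun y : V => (c / nsq y) `^ m)}.
Proof.
move=> c0 y0; rewrite (_ : (fun y => _) = (fun y : V => c `^ m * nsq y `^ (- m))).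
  by apply: contZ; exact: lap_cont (lap_nsq_powR m y0).
apply/funext => x.
by rewrite powRM ?invr_ge0 ?nsq_ge0// -powR_inv1 ?nsq_ge0// -powRrM mulN1r.
Qed.

Lemma cont_comp_inversion u (c : R) y : y != 0 -> continuous u ->
  {for y, continuous (fun y : V => u ((c / nsq y) *: y))}.
Proof.
move=> y0 cu; apply: (@continuous_comp _ _ _ (fun y : V => (c / nsq y) *: y) u).
  exact: cont_inversion.
exact: cu.
Qed.

(** * Moving spheres centred at the origin *)

Section moving_spheres.
Variables (p L k : R) (u : V -> R).
Hypotheses (p1 : 1 < p) (pk : k * p < k + 2) (k0 : 0 < k) (kn : 2 * k + 2 = n%:R).
Hypotheses (uL : lip L u) (u0 : forall y, 0 < u y) (u1 : forall y, u y <= 1).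
Hypothesis uE : Lap setT u (fun y => - u y `^ p).

Let cu : continuous u. Proof. by move=> y; exact: lip_cont uL _. Qed.
Let p0 : 0 < p. Proof. exact: lt_trans p1. Qed.
Let n0 : 0 < n%:R :> R. Proof. by rewrite -kn addr_gt0// mulr_gt0. Qed.

Let cup : continuous (fun y => u y `^ p).
Proof.
move=> y; apply: (@lip_cont _ _ (p * L)) => s t.
apply: le_trans (powR_lip (ltW p1) _ _) _; rewrite ?(ltW (u0 _)) ?u1//.
by rewrite -mulrA ler_wpM2l ?(ltW p0).
Qed.

(** Difference between u and its inversion in the sphere |y|^2 = c; G is its Laplacian. The method
    consists in showing W >= 0 outside the sphere. Throughout, c is a squared radius. *)
Let W (c : R) y := u y - kelvin k c u y.
Let G (c : R) y := - u y `^ p - (c / nsq y) `^ (k + 2) * - u ((c / nsq y) *: y) `^ p.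

Let LW c : 0 < c -> Lap [set y | y != 0] (W c) (G c).
Proof.
move=> c0; apply: LapB; first exact: Lap_sub uE _.
by apply: Lap_sub (Lap_kelvin c0 kn uE) _ => y.
Qed.

Let open_ne0 : open [set y : V | y != 0].
Proof.
rewrite (_ : [set y : V | y != 0] = [set y : V | 0 < nsq y]).
  exact: open_nsq_gt.
by apply/funext => x /=; rewrite nsq_gt0.
Qed.

Let cW c y : 0 < c -> y != 0 -> {for y, continuous (W c)}.
Proof.
move=> c0 y0; apply: contB; first exact: cu.
apply: contM; first by apply: cont_ratio_powR => //; exact: ltW.
exact: cont_comp_inversion.
Qed.

Let cG c y : 0 < c -> y != 0 -> {for y, continuous (G c)}.
Proof.
move=> c0 y0.
have c1 := @cup y; have c2 := @cont_ratio_powR (k + 2) c y (ltW c0) y0.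
have c3 : {for y, continuous (fun y => u ((c / nsq y) *: y) `^ p)}.
  exact: (@cont_comp_inversion (fun y => u y `^ p) c y y0 cup).
rewrite (_ : G c = (fun y => -1 * u y `^ p + (c / nsq y) `^ (k + 2) * u ((c / nsq y) *: y) `^ p)).
  by apply: contD; [exact: contZ|exact: contM].
by apply/funext => z; rewrite /G; ring.
Qed.

Let ne0 c y : 0 < c -> c <= nsq y -> y != 0.
Proof. by move=> c0 cy; rewrite -nsq_gt0 (lt_le_trans c0). Qed.

(** Subcriticality enters here: outside the sphere c / |y|^2 <= 1 and k p < k + 2, so minus the
    Laplacian of the transform is at most its p-th power. *)
Let kelvin_pow c y : 0 < c -> c <= nsq y ->
  (c / nsq y) `^ (k + 2) * u ((c / nsq y) *: y) `^ p <= kelvin k c u y `^ p.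
Proof.
move=> c0 cy; have s0 : 0 < nsq y by exact: lt_le_trans cy.
rewrite /kelvin powRM ?powR_ge0 ?(ltW (u0 _))// -powRrM.
rewrite ler_wpM2r ?powR_ge0// ger_powR//; last exact: ltW.
by rewrite divr_gt0//= ler_pdivrMr// mul1r.
Qed.

Let kelvin_pow_lt c y : 0 < c -> c < nsq y ->
  (c / nsq y) `^ (k + 2) * u ((c / nsq y) *: y) `^ p < kelvin k c u y `^ p.
Proof.
move=> c0 cy; have s0 : 0 < nsq y by exact: lt_trans cy.
rewrite /kelvin powRM ?powR_ge0 ?(ltW (u0 _))// -powRrM.
rewrite ltr_pM2r ?powR_gt0//.
have r0 : 0 < c / nsq y by rewrite divr_gt0.
have r1 : c / nsq y < 1 by rewrite ltr_pdivrMr// mul1r.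
rewrite (_ : k + 2 = k * p + (k + 2 - k * p)); last by ring.
rewrite powRD; last by rewrite (gt_eqF r0) implybT.
rewrite gtr_pMr ?powR_gt0//.
have := @gt0_ltr_powR R (k + 2 - k * p) _ (c / nsq y) 1.
by rewrite powR1; apply; rewrite ?nnegrE ?subr_gt0// ltW.
Qed.

Let kelvin_le1 c y : 0 < c -> c <= nsq y -> kelvin k c u y <= 1.
Proof.
move=> c0 cy; have s0 : 0 < nsq y by exact: lt_le_trans cy.
rewrite /kelvin -[leRHS]mulr1 ler_pM ?powR_ge0 ?(ltW (u0 _))//.
have := @ge0_ler_powR R k (ltW k0) (c / nsq y) 1.
rewrite powR1; apply; rewrite ?nnegrE ?divr_ge0 ?(ltW c0) ?(ltW s0)//.
by rewrite ler_pdivrMr// mul1r.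
Qed.

(** With this width minus the Laplacian of the function [zeta] below is 2n / delta = 4p. The
    linearized coefficient is at most p, since u and its transform are at most 1, and [zeta] is at
    most 2, so 4p exceeds what is needed. *)
Let delta : R := n%:R / (2 * p).
Let delta0 : 0 < delta. Proof. by rewrite divr_gt0// mulr_gt0. Qed.

(* On the shell c <= |y|^2 <= c + delta the function 2 - (|y|^2 - c) / delta is
   a positive strict supersolution of the linearized equation. *)
Let shell c r : 0 < c -> r <= c + delta ->
  (forall y, nsq y = r -> 0 <= W c y) ->
  forall y, c <= nsq y <= r -> 0 <= W c y.
Proof.
move=> c0 rc Wr y1 y1K; rewrite leNgt; apply/negP => W1.
pose zeta y := (2 + c / delta) - delta^-1 * nsq y.
have zetaE y : zeta y = 2 - (nsq y - c) / delta by rewrite /zeta; ring.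
have lz y : lap zeta y (0 - delta^-1 * (2 * n%:R)).
  by apply: lapB; [exact: lap_cst|apply: lapZ; exact: lap_nsq].
pose K := [set y : V | c <= nsq y <= r].
have zK y : K y -> 1 <= zeta y <= 2.
  move=> /andP[cy yr]; rewrite zetaE.
  have : 0 <= (nsq y - c) / delta by rewrite divr_ge0 ?subr_ge0// ltW.
  have : (nsq y - c) / delta <= 1 by rewrite ler_pdivrMr// mul1r; lra.
  by move=> ? ?; apply/andP; split; lra.
pose Q y := W c y / zeta y.
have cQ y : K y -> {for y, continuous Q}.
  move=> Ky; have /andP[cy _] := Ky; have /andP[z1 _] := zK _ Ky.
  apply: contM; first exact: cW c0 (ne0 c0 cy).
  by apply: (@cvgV _ _ (nbhs y) _ zeta); [rewrite gt_eqF// (lt_le_trans _ z1)|exact: lap_cont (lz y)].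
have [|y0 Ky0 Qm] := compact_min (@annulus_compact c r) _ cQ; first by exists y1.
pose m := Q y0.
have zpos y : K y -> 0 < zeta y by move=> /zK/andP[z1 _]; exact: lt_le_trans z1.
have m0 : m < 0.
  apply: le_lt_trans (Qm y1 y1K) _.
  by rewrite /Q pmulr_llt0// invr_gt0 zpos.
have /andP[cy0 y0r] := Ky0.
have Wy0 : W c y0 = m * zeta y0 by rewrite /m /Q divfK// gt_eqF// zpos.
have [yc|yc] := leP (nsq y0) c.
  have e : nsq y0 = c by apply/eqP; rewrite eq_le yc.
  move: Wy0; rewrite /W /kelvin e divff ?gt_eqF// powR1 mul1r scale1r subrr => /esym/eqP.
  by rewrite mulf_eq0 (lt_eqF m0) gt_eqF// zpos.
have [yr|yr] := leP r (nsq y0).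
  have /Wr : nsq y0 = r by apply/eqP; rewrite eq_le y0r.
  by rewrite Wy0 nmulr_rge0// leNgt zpos.
(* As m is the minimum of W / zeta, the function m zeta - W has a local maximum, equal to 0, at
   [y0]; its Laplacian there is at most 0. *)
have L1 := LapB (Lap_lap (D := [set y | y != 0]) (fun y _ => lapZ m (lz y))) (LW c0).
have y00 := ne0 c0 cy0.
have H0 := Lap_max_cont open_ne0 L1 y00.
suff : G c y0 < m * (0 - delta^-1 * (2 * n%:R)).
  apply/negP; rewrite -leNgt -subr_le0; apply: H0; last first.
    by apply: contB; [exact: cst_continuous|exact: cG].
  have /annulus_nbhs : c < nsq y0 < r by rewrite yc.
  apply: filterS => t /andP[t1 t2]; rewrite Wy0 subrr subr_le0.
  have Kt : K t by rewrite /K /= !ltW.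
  by have := Qm _ Kt; rewrite ler_pdivlMr ?zpos.
have -> : m * (0 - delta^-1 * (2 * n%:R)) = - m * (4 * p).
  by rewrite /delta; field; rewrite !gt_eqF.
set kap := kelvin k c u y0.
have Wk : u y0 - kap = m * zeta y0 by [].
have /andP[z1 z2] := zK _ Ky0.
have uk : u y0 <= kap by nra.
have kap0 : 0 < kap by rewrite mulr_gt0// powR_gt0// divr_gt0// (lt_trans c0).
have H1 := kelvin_pow c0 cy0.
have H2 : kap `^ p - u y0 `^ p <= p * kap `^ (p - 1) * (kap - u y0).
  by apply: powR_diff_le; [exact: ltW|rewrite (ltW (u0 _))].
have H3 : kap `^ (p - 1) <= 1.
  have := @ge0_ler_powR R (p - 1) _ kap 1.
  by rewrite powR1; apply; rewrite ?nnegrE ?subr_ge0 ?(ltW p1) ?(ltW kap0)// kelvin_le1.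
have H4 : p * kap `^ (p - 1) * (kap - u y0) <= p * (kap - u y0).
  by rewrite ler_wpM2r ?subr_ge0// ler_piMr// ltW.
have H6 : 0 < - m * p by rewrite mulr_gt0// oppr_gt0.
have H5 : p * (kap - u y0) <= - m * (2 * p).
  have -> : kap - u y0 = - m * zeta y0 by lra.
  have : 0 <= (- m * p) * (2 - zeta y0) by rewrite mulr_ge0 ?subr_ge0// ltW.
  lra.
rewrite /G; move: H1; rewrite -/kap; lra.
Qed.

(** The effect of a change of radius is measured against |y|^(-2k), the decay rate in
    [exterior_lower_bound], so that positivity of W absorbs it at infinity as well. *)
Let kelvin_modulus (c eta : R) : 0 < c -> 0 < eta -> exists2 e, 0 < e &
  forall c', `|c' - c| < e -> forall y, c / 2 <= nsq y ->
    `|kelvin k c' u y - kelvin k c u y| <= eta * nsq y `^ (- k).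
Proof.
move=> c0 eta0.
have L0 : 0 <= `|L| by [].
pose B := c `^ k * (`|L| * (1 + 2 / c)) + 1.
have B0 : 0 < B by rewrite ltr_wpDl// !mulr_ge0 ?powR_ge0// addr_ge0// divr_ge0// ltW.
have e2 : 0 < eta / 2 by rewrite divr_gt0.
have /cvgrPdist_lt/(_ _ e2) : {for c, continuous (fun t : R => t `^ k)}.
  apply: differentiable_continuous; apply/derivable1_diffP.
  by have [] := is_derive1_powR k c0.
move=> /nbhs_ballP[d /= d0 Hd].
exists (Num.min (Num.min d (c / 2)) (eta / 2 / B)).
  by rewrite !lt_min d0 !divr_gt0.
move=> c'; rewrite !lt_min => /andP[/andP[cd cc] cB] y ys.
have c'0 : 0 < c' by move: cc; rewrite ltr_norml => /andP[? ?]; lra.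
have s0 : 0 < nsq y by apply: lt_le_trans ys; rewrite divr_gt0.
have E t : 0 < t -> kelvin k t u y = nsq y `^ (- k) * (t `^ k * u ((t / nsq y) *: y)).
  move=> t0; rewrite /kelvin powRM ?invr_ge0 ?(ltW t0) ?(ltW s0)//.
  by rewrite -powR_inv1 ?(ltW s0)// -powRrM mulN1r; ring.
rewrite !E// -mulrBr normrM ger0_norm ?powR_ge0// mulrC ler_wpM2r ?powR_ge0//.
set a := u _; set b := u _.
rewrite (_ : _ - _ = (c' `^ k - c `^ k) * a + c `^ k * (a - b)); last by ring.
apply: le_trans (ler_normD _ _) _; rewrite !normrM.
have H1 : `|c' `^ k - c `^ k| * `|a| <= eta / 2.
  rewrite -[leRHS]mulr1 ler_pM//.
    rewrite distrC ltW//; apply: Hd; rewrite -ball_normE /= distrC//.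
  by rewrite ger0_norm ?(ltW (u0 _))// u1.
have H2 : `|c `^ k| * `|a - b| <= eta / 2.
  rewrite (ger0_norm (powR_ge0 _ _)).
  have : `|a - b| <= `|L| * (1 + 2 / c) * `|c' - c|.
    apply: le_trans (uL _ _) _; rewrite -scalerBl -mulrBl normrZ normrM.
    rewrite -mulrA; apply: le_trans (_ : `|L| * (`|c' - c| * `|(nsq y)^-1| * `|y|) <= _).
      by rewrite ler_wpM2r ?mulr_ge0// ler_norm.
    rewrite ler_wpM2l// -mulrA mulrC ler_wpM2r//.
    rewrite ger0_norm ?invr_ge0 ?(ltW s0)// mulrC ler_pdivrMr//.
    have y2 : `|y| ^+ 2 <= nsq y by exact: norm_sqr_le.
    have : 1 <= 2 / c * nsq y.
      by rewrite mulrAC ler_pdivlMr// mul1r; lra.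
    have : `|y| <= 1 + `|y| ^+ 2 by have := sqr_ge0 (`|y| - 1); nra.
    have := normr_ge0 y; nra.
  move=> H; apply: le_trans (_ : B * `|c' - c| <= _); last first.
    by rewrite mulrC -ler_pdivlMr// ltW.
  apply: le_trans (ler_wpM2l (powR_ge0 c k) H) _.
  by rewrite mulrA ler_wpM2r// lerDl.
by apply: le_trans (lerD H1 H2) _; lra.
Qed.

Let good c := forall y, c <= nsq y -> 0 <= W c y.

(** W >= 0 has to be checked only beyond |y|^2 = rho; [shell] covers the rest. *)
Let good_of c rho : 0 < c -> rho <= c + delta ->
  (forall y, rho <= nsq y -> 0 <= W c y) -> good c.
Proof.
move=> c0 rc H y cy; have [ry|ry] := leP rho (nsq y); first exact: H.
apply: (shell c0 rc) => [z zr|]; first by apply: H; rewrite zr.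
by rewrite cy ltW.
Qed.

(** Since u <= 1, the transform is at most c^k |y|^(-2k), whereas u is at least b |y|^(-2k) for
    |y|^2 >= delta; c^k <= b is enough. *)
Let good_small : exists2 c0, 0 < c0 & forall c, 0 < c <= c0 -> good c.
Proof.
have [b b0 Hb] := @sphere_pos_min u k delta delta0 (fun y _ => @cu y) (fun y _ => u0 y).
have ub : forall y, delta <= nsq y -> b * nsq y `^ (- k) <= u y.
  apply: (exterior_lower_bound k0 _ delta0 b0 openT _ uE) => //.
  - by rewrite kn.
  - by move=> y _; exact: cu.
  - by move=> y _; apply: contN; exact: cup.
  - by move=> y _; rewrite oppr_lt0 powR_gt0.
  - by move=> y _; exact: ltW.
exists (b `^ (k^-1)); first by rewrite powR_gt0.
move=> c /andP[c0 cb].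
have ckb : c `^ k <= b.
  rewrite -[leRHS]powRr1 ?(ltW b0)// -(mulVf (lt0r_neq0 k0)) powRrM.
  by rewrite ge0_ler_powR ?nnegrE ?powR_ge0 ?(ltW k0) ?(ltW c0).
apply: (@good_of c delta) => //; first by rewrite lerDr ltW.
move=> y dy; have s0 : 0 < nsq y by exact: lt_le_trans dy.
rewrite subr_ge0; apply: le_trans (ub _ dy).
rewrite /kelvin powRM ?invr_ge0 ?(ltW c0) ?(ltW s0)// -powR_inv1 ?(ltW s0)// -powRrM mulN1r.
rewrite -[leRHS]mulr1 ler_pM ?mulr_ge0 ?powR_ge0 ?(ltW (u0 _))//.
by rewrite ler_wpM2r ?powR_ge0.
Qed.

Let good_limit c : 0 < c -> (forall c', 0 < c' < c -> good c') -> good c.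
Proof.
move=> c0 H y cy; rewrite leNgt; apply/negP => Wn.
have s0 : 0 < nsq y by exact: lt_le_trans cy.
have nk : 0 < nsq y `^ (- k) by rewrite powR_gt0.
have eta0 : 0 < - W c y / nsq y `^ (- k) / 2 by rewrite !divr_gt0// oppr_gt0.
have [e e0 He] := kelvin_modulus c0 eta0.
pose c' := c - Num.min (e / 2) (c / 2).
have m0 : 0 < Num.min (e / 2) (c / 2) by rewrite lt_min !divr_gt0.
have m1 : Num.min (e / 2) (c / 2) <= e / 2 by rewrite ge_min lexx.
have m2 : Num.min (e / 2) (c / 2) <= c / 2 by rewrite ge_min lexx orbT.
have c'c : 0 < c' < c by rewrite /c'; apply/andP; split; lra.
have ce : `|c' - c| < e.
  rewrite /c' addrAC subrr sub0r normrN gtr0_norm//; lra.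
have := He _ ce y; rewrite (_ : _ / 2 * _ = - W c y / 2); last by field; rewrite gt_eqF.
have /(_ y) := H _ c'c; have /andP[c'1 c'2] := c'c.
move=> /(_ (le_trans (ltW c'2) cy)) W'; move=> /(_ _).
have c2 : c / 2 <= nsq y by lra.
move=> /(_ c2); rewrite ler_norml => /andP[h1 h2].
by move: Wn W' h1 h2; rewrite /W; lra.
Qed.

(** At c the difference W is positive off the sphere, hence at least b |y|^(-2k) beyond |y|^2 = c +
    delta / 2. There the modulus of continuity absorbs the passage from c to c', and the remaining
    shell is thinner than delta. *)
Let good_step c : 0 < c -> good c -> exists2 e, 0 < e & forall c', c <= c' < c + e -> good c'.
Proof.
move=> c0 gc.
have G0 y : c < nsq y -> G c y < 0.
  move=> cy; have s0 : 0 < nsq y by exact: lt_trans cy.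
  have := kelvin_pow_lt c0 cy.
  have : kelvin k c u y `^ p <= u y `^ p.
    have := gc y (ltW cy); rewrite subr_ge0 => H.
    by rewrite ge0_ler_powR ?nnegrE ?(ltW p0) ?(ltW (u0 _))// mulr_ge0 ?powR_ge0 ?(ltW (u0 _)).
  rewrite /G; lra.
have Wpos y : c < nsq y -> 0 < W c y.
  move=> cy; rewrite lt0r gc ?andbT; last exact: ltW.
  apply/eqP => Wy; have y0 : y != 0 by apply: ne0 c0 (ltW cy).
  have nc : \forall z \near y, c < nsq z.
    have /annulus_nbhs : c < nsq y < nsq y + 1 by rewrite cy ltrDl/=.
    by apply: filterS => z /andP[].
  have cN : {for y, continuous (fun y => - G c y)}.
    by apply: contN; exact: cG.
  have := Lap_max_cont open_ne0 (LapN (LW c0)) y0 _ cN.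
  have := G0 _ cy => ? /(_ _); rewrite leNgt oppr_gt0 (G0 _ cy).
  suff H : \forall z \near y, - W c z <= - W c y by move=> /(_ H).
  - by rewrite Wy oppr0; apply: filterS nc => z cz; rewrite oppr_le0 gc// ltW.
pose d := delta / 2; have d0 : 0 < d by rewrite divr_gt0.
pose rho := c + d; have rho0 : 0 < rho by rewrite addr_gt0.
have crho : c < rho by rewrite ltrDl.
have [||b b0 Hb] := @sphere_pos_min (W c) k rho rho0.
- by move=> y yr; apply: cW => //; apply: (ne0 rho0); rewrite yr.
- by move=> y yr; apply: Wpos; rewrite yr.
have Wb : forall y, rho <= nsq y -> b * nsq y `^ (- k) <= W c y.
  apply: (exterior_lower_bound k0 _ rho0 b0 open_ne0 _ (LW c0)) => //.
  - by rewrite kn.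
  - by move=> y ry; apply: (ne0 rho0).
  - by move=> y; exact: cW.
  - by move=> y; exact: cG.
  - by move=> y ry; apply: G0; exact: lt_trans ry.
  - by move=> y ry; apply: ltW; apply: Wpos; exact: lt_le_trans ry.
have [e e0 He] := kelvin_modulus c0 b0.
exists (Num.min e d); first by rewrite lt_min e0.
move=> c' /andP[cc']; rewrite -ltrBlDl lt_min => /andP[ce cd].
have c'0 : 0 < c' by exact: lt_le_trans cc'.
apply: (@good_of c' rho) => //; first by have := delta0; rewrite /rho /d; lra.
move=> y ry.
have c'e : `|c' - c| < e by rewrite ger0_norm// subr_ge0.
have c2 : c / 2 <= nsq y by move: ry crho; lra.
have := He _ c'e y c2; have := Wb _ ry; rewrite /W ler_norml => ? /andP[? ?]; lra.
Qed.

(** If some radius were not good, the supremum of those up to which all are good would itself be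
    good by [good_limit] and could be increased by [good_step]. *)
Lemma moving_spheres c y : 0 < c -> c <= nsq y -> kelvin k c u y <= u y.
Proof.
move=> c0 cy; rewrite -subr_ge0; move: y cy.
rewrite -/(good c); apply: contrapT => nc.
have [s s0 Hs] := good_small.
pose S := [set t : R | 0 < t /\ forall t', 0 < t' <= t -> good t'].
have Ss : S s by split.
have Sc t : S t -> t <= c.
  move=> [t0 Ht]; rewrite leNgt; apply/negP => ct; apply: nc; apply: Ht.
  by rewrite c0 ltW.
have hS : has_sup S by split; [exists s|exists c => t /Sc].
pose t := sup S.
have st : s <= t by apply: sup_upper_bound.
have t0 : 0 < t by exact: lt_le_trans st.
have below t' : 0 < t' < t -> good t'.
  move=> /andP[t'0 t't].
  have tt : 0 < t - t' by rewrite subr_gt0.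
  have [a [_ Ha] ta] := sup_adherent tt hS.
  by apply: Ha; rewrite t'0 ltW//; move: ta; rewrite -/t; lra.
have gt : good t by exact: good_limit.
have [e e0 He] := good_step t0 gt.
have St : S (t + e / 2).
  split; first by rewrite addr_gt0// divr_gt0.
  move=> t' /andP[t'0 t't]; have [tt|tt] := ltP t' t; first by apply: below; rewrite t'0.
  by apply: He; rewrite tt/=; lra.
have := sup_upper_bound hS St; rewrite -/t; lra.
Qed.
End moving_spheres.

(** A nonzero v would be positive and have a global minimum, where its Laplacian cannot be negative:
    for n >= 3 spheres of all centres and radii force v to be constant, and for n = 2 the minimum
    over the unit disc is global because v is superharmonic. *)
Lemma liouville_whole (p L : R) v : (2 <= n)%N -> 1 < p -> p * (n%:R - 2) < n%:R + 2 ->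
  lip L v -> (forall y, 0 <= v y <= 1) -> Lap setT v (fun y => - v y `^ p) ->
  forall y, v y = 0.
Proof.
move=> n2 p1 pn vL v01 Lv y0; apply/eqP; apply/negPn/negP => vy0.
have cv : continuous v by move=> y; exact: lip_cont vL _.
have v0 y : 0 <= v y by have /andP[] := v01 y.
have v1 y : v y <= 1 by have /andP[] := v01 y.
have vpos y : 0 < v y.
  apply: (@SMP_ball _ _ setT v _ y0 (nsq (y - y0) + 1) openT Lv) => //.
  - by move=> x _; exact: cv.
  - by move=> x _; rewrite oppr_le0 powR_ge0.
  - by rewrite lt_neqAle eq_sym vy0 v0.
  - by rewrite ltrDl.
have cvp : continuous (fun y => v y `^ p).
  move=> y; apply: (@lip_cont _ _ (p * L)) => s t.
  apply: le_trans (powR_lip (ltW p1) _ _) _; rewrite ?v0 ?v1//.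
  by rewrite -mulrA ler_wpM2l// ltW// (lt_trans _ p1).
have nomin z : ~ (forall y, v z <= v y).
  move=> vz; have cN : {for z, continuous (fun y => - - v y `^ p)}.
    by apply: contN; apply: contN; exact: cvp.
  have := @Lap_max_cont setT _ _ z openT (LapN Lv) I _ cN.
  suff H : \forall y \near z, - v y <= - v z by move=> /(_ H); rewrite opprK leNgt powR_gt0.
  by apply: filterE => y; rewrite lerN2; exact: vz.
have [n3|n3] := leqP 3 n; last first.
  have nE : n%:R = 2 :> R by have /eqP -> : n == 2%N by rewrite eqn_leq n2 -ltnS n3.
  have [|y _|z Kz vz] := compact_min (@annulus_compact 0 1) _ (w := v).
  - by exists 0; rewrite /= nsq0 lexx ler01.
  - exact: cv.
  apply: (nomin z) => y.
  have [y1|/ltW y1] := leP (nsq y) 1; first by apply: vz; rewrite /= nsq_ge0.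
  rewrite leNgt; apply/negP => vyz.
  (* In the plane every positive exponent satisfies n <= 2k + 2; letting it tend to 0 does the work
     of the logarithm as a comparison function. *)
  have lb eta : 0 < eta -> v z * nsq y `^ (- eta) <= v y.
    move=> eta0.
    apply: (exterior_lower_bound eta0 _ (@ltr01 R) (vpos z) openT _ Lv) => //.
    - by rewrite nE lerDr mulr_ge0// ltW.
    - by move=> t _; exact: cv.
    - by move=> t _; apply: contN; exact: cvp.
    - by move=> t _; rewrite oppr_lt0 powR_gt0.
    - by move=> t t1; rewrite powR1 mulr1; apply: vz; rewrite /= t1 ler01 lexx.
  have s0 : 0 < nsq y by exact: lt_le_trans y1.
  have ln0 : 0 <= ln (nsq y) by exact: ln_ge0.
  pose eta := (v z - v y) / (2 * (ln (nsq y) + 1) * v z).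
  have l1 : 0 < ln (nsq y) + 1 by rewrite ltr_wpDl.
  have eta0 : 0 < eta by rewrite divr_gt0 ?subr_gt0// !mulr_gt0.
  have := lb _ eta0.
  have : 1 - eta * ln (nsq y) <= nsq y `^ (- eta).
    by rewrite /powR gt_eqF//= mulNr; exact: expR_ge1Dx.
  have : v z * (eta * ln (nsq y)) <= (v z - v y) / 2.
    apply: le_trans (_ : v z * (eta * (ln (nsq y) + 1)) <= _).
      by rewrite ler_wpM2l// ler_wpM2l ?(ltW eta0)// lerDl.
    by apply: le_eq; rewrite /eta; field; rewrite !gt_eqF.
  move=> h1 h2; have := ler_wpM2l (v0 z) h2; rewrite mulrBr mulr1; lra.
pose k : R := (n%:R - 2) / 2.
have kn : 2 * k + 2 = n%:R by rewrite /k; field.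
have k0 : 0 < k by rewrite divr_gt0// subr_gt0 ltr_nat.
have pk : k * p < k + 2 by rewrite /k; lra.
have mono y z : v z <= v y.
  have [->//|yz] := eqVneq y z.
  rewrite leNgt; apply/negP => vyz.
  (* The sphere is centred at a point x of the line through y and z, beyond z, and its inversion
     maps y to z with weight rho^k = r. As v y < r v z, this violates [moving_spheres]. *)
  pose r := (v y / v z + 1) / 2.
  have q1 : v y / v z < 1 by rewrite ltr_pdivrMr// mul1r.
  have q0 : 0 < v y / v z by rewrite divr_gt0.
  have r0 : 0 < r by rewrite /r; lra.
  have r1 : r < 1 by rewrite /r; lra.
  pose rho := r `^ k^-1.
  have rho0 : 0 < rho by rewrite powR_gt0.
  have rho1 : rho < 1.
    have := @gt0_ltr_powR R k^-1 _ r 1; rewrite powR1; apply => //.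
    - by rewrite invr_gt0.
    - by rewrite nnegrE ltW.
    - by rewrite nnegrE.
  pose T := rho / (1 - rho).
  have T0 : 0 < T by rewrite divr_gt0// subr_gt0.
  pose e := y - z; have E0 : 0 < nsq e by rewrite nsq_gt0 subr_eq0.
  pose x := z - T *: e.
  pose u t := v (x + t).
  have Lu : Lap setT u (fun t => - u t `^ p).
    by apply: (Lap_sub (@Lap_translate _ _ _ _ _ x Lv)).
  have uL : lip L u by move=> s t; apply: le_trans (vL _ _) _; rewrite opprD addrACA subrr add0r.
  pose c := T * (1 + T) * nsq e.
  have T1 : 0 < 1 + T by rewrite addr_gt0.
  have c0 : 0 < c by rewrite /c mulr_gt0// mulr_gt0.
  have cle : c <= nsq ((1 + T) *: e).
    by rewrite nsqZ /c ler_pM2r// expr2 ler_wpM2r ?lerDr// addr_ge0// ltW.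
  have := @moving_spheres p L k u p1 pk k0 kn uL (fun t => vpos _) (fun t => v1 _) Lu c ((1 + T) *: e) c0 cle.
  have TT : T / (1 + T) = rho.
    have E : T = rho * (1 + T) by rewrite /T; field; rewrite gt_eqF// subr_gt0.
    by rewrite [X in X / _]E mulfK// gt_eqF.
  have cE : c / nsq ((1 + T) *: e) = rho.
    by rewrite nsqZ /c -TT; field; rewrite !gt_eqF.
  rewrite /kelvin cE /u -powRrM mulVf ?gt_eqF// powRr1 ?(ltW r0)//.
  have -> : x + rho *: ((1 + T) *: e) = z.
    by rewrite scalerA -TT divfK ?gt_eqF ?addr_gt0// /x subrK.
  have -> : x + (1 + T) *: e = y.
    by rewrite scalerDl scale1r addrCA /x subrK /e subrK.
  have : v y < r * v z.
    have E : v y = v y / v z * v z by rewrite divfK// gt_eqF.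
    by rewrite [ltLHS]E ltr_pM2r// /r; lra.
  lra.
apply: (nomin y0) => y; exact: mono.
Qed.
End whole_space.

(** * The Liouville theorem in a half-space *)

Section half_space.
Context {R : realType} {n : nat}.
Local Notation V := 'rV[R]_n.
Implicit Types (x y z : V) (u w v f g : V -> R) (D K : set V).

Variables (nu : V) (p L : R).
Hypotheses (nu1 : nsq nu = 1) (p1 : 1 < p).

(** Solutions extended by 0 across the boundary hyperplane, with uniform bounds: a class stable
    under tangential translations and under limits. *)
Definition half_solution v := [/\ lip L v, forall y, 0 <= v y <= 1,
  forall y, dot nu y <= 0 -> v y = 0 &
  Lap [set y | 0 < dot nu y] v (fun y => - v y `^ p)].

Let p0 : 0 < p. Proof. exact: lt_trans p1. Qed.

Lemma cont_dot (b : V) y : {for y, continuous (dot b)}.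
Proof. exact: jet_cont (jet_dot b y). Qed.

Lemma open_dot_gt (b : V) (a : R) : open [set y | a < dot b y].
Proof.
apply: (@open_comp _ _ (dot b) [set t : R | a < t]); last exact: open_gt.
by move=> x _; exact: cont_dot.
Qed.

Lemma open_dot_lt (b : V) (a : R) : open [set y | dot b y < a].
Proof.
apply: (@open_comp _ _ (dot b) [set t : R | t < a]); last exact: open_lt.
by move=> x _; exact: cont_dot.
Qed.

Lemma dot_unit_le x : dot nu x ^+ 2 <= nsq x.
Proof. by have := CauchySchwarz nu x; rewrite nu1 mul1r. Qed.

Lemma norm_unit : `|nu| <= 1.
Proof. by have := norm_sqr_le nu; rewrite nu1 expr_le1. Qed.

Section one_solution.
Variable v : V -> R.
Hypothesis hv : half_solution v.

Let vL : lip L v. Proof. by case: hv. Qed.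
Let v01 y : 0 <= v y <= 1. Proof. by case: hv. Qed.
Let vlow y : dot nu y <= 0 -> v y = 0. Proof. by case: hv => _ _ + _; exact. Qed.
Let vE : Lap [set y | 0 < dot nu y] v (fun y => - v y `^ p). Proof. by case: hv. Qed.
Let cv : continuous v. Proof. by move=> y; exact: lip_cont vL _. Qed.
Let v0 y : 0 <= v y. Proof. by have /andP[] := v01 y. Qed.
Let v1 y : v y <= 1. Proof. by have /andP[] := v01 y. Qed.

Let cvp : continuous (fun y => v y `^ p).
Proof.
move=> y; apply: (@lip_cont _ _ (p * L)) => s t.
apply: le_trans (powR_lip (ltW p1) (v01 _) (v01 _)) _.
by rewrite -mulrA ler_wpM2l ?(ltW p0).
Qed.

Lemma half_solution_pos z : 0 < v z -> forall y, 0 < dot nu y -> 0 < v y.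
Proof.
move=> vz y y0.
have z0 : 0 < dot nu z by rewrite ltNge; apply/negP => /vlow H; rewrite H ltxx in vz.
pose m := Num.min (dot nu z) (dot nu y).
have m0 : 0 < m by rewrite lt_min z0.
have H := @SMP_segment _ _ _ v _ z y (m ^+ 2) (@open_dot_gt nu 0) vE.
apply: H => //.
- by move=> x _; exact: cv.
- by move=> x _; rewrite oppr_le0 powR_ge0.
- by rewrite exprn_gt0.
move=> x s /andP[s0 s1] H /=.
have : m <= dot nu (z + s *: (y - z)).
  rewrite dotDr dotZr dotBr.
  have m1 : m <= dot nu z by rewrite ge_min lexx.
  have m2 : m <= dot nu y by rewrite ge_min lexx orbT.
  have : 0 <= s * (dot nu y - m) by rewrite mulr_ge0 ?subr_ge0.
  have : 0 <= (1 - s) * (dot nu z - m) by rewrite mulr_ge0 ?subr_ge0.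
  lra.
have := le_lt_trans (dot_unit_le (x - (z + s *: (y - z)))) H.
by rewrite dotBr; set a := dot nu x; set b := dot nu (z + _); nra.
Qed.

(** The quantity of the moving plane nu.y = mu, to be shown nonnegative between the boundary and the
    plane. *)
Definition mirror_gap (mu : R) y := v (refl nu mu y) - v y.

Let cgap mu : continuous (mirror_gap mu).
Proof. by move=> y; apply: contB; [apply: cont_comp_refl; exact: cv|exact: cv]. Qed.

Let strip mu : set V := [set y | 0 < dot nu y] `&` [set y | dot nu y < mu].

Let open_strip mu : open (strip mu).
Proof. by apply: openI; [exact: open_dot_gt|exact: open_dot_lt]. Qed.

Lemma Lap_gap mu : Lap (strip mu) (mirror_gap mu)
  (fun y => - v (refl nu mu y) `^ p - - v y `^ p).
Proof.
apply: LapB; last by apply: (Lap_sub vE) => y [].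
apply: (Lap_sub (@Lap_refl _ _ _ _ _ nu mu nu1 vE)) => y [/= y0 ymu].
by rewrite /= dot_refl//; lra.
Qed.

Lemma gap_boundary mu y : dot nu y = 0 \/ dot nu y = mu -> 0 <= mirror_gap mu y.
Proof.
case=> ye; first by rewrite /mirror_gap (vlow (y := y)) ?ye// subr0.
by rewrite /mirror_gap /refl ye subrr mulr0 scale0r subr0 subrr.
Qed.

(* The square root of mu + d - nu.y is a positive supersolution: its Laplacian
   is - zeta / (4 q^2) with q = mu + d - nu.y, large near the reflecting plane
   and bounded away from 0 in the whole strip. *)
Lemma gap_negative mu d : 0 < mu -> 0 < d ->
  (exists y, [/\ 0 <= dot nu y, dot nu y <= mu & mirror_gap mu y < 0]) ->
  exists y, [/\ 0 < dot nu y, dot nu y < mu, mirror_gap mu y < 0 &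
    (8 * (mu + d - dot nu y) ^+ 2)^-1 <= p * v y `^ (p - 1)].
Proof.
move=> mu0 d0 [y1 [y1a y1b w1]].
set w := mirror_gap mu in w1 *.
pose S := [set y | 0 <= dot nu y <= mu].
have Sy1 : S y1 by rewrite /S /= y1a.
pose q y := mu + d - dot nu y.
have qE y : q y = (mu + d) + dot (- nu) y by rewrite /q dotNl.
have qd y : S y -> d <= q y <= mu + d by move=> /andP[a b]; apply/andP; rewrite /q; lra.
have q0 y : S y -> 0 < q y by move=> /qd/andP[h _]; exact: lt_le_trans h.
pose zeta y := (mu + d + dot (- nu) y) `^ 2^-1.
have zE y : zeta y = q y `^ 2^-1 by rewrite /zeta -qE.
have z0 y : S y -> 0 < zeta y by move=> /q0 ?; rewrite zE powR_gt0.
have zd y : S y -> d `^ 2^-1 <= zeta y.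
  move=> Sy; have /andP[h _] := qd _ Sy.
  by rewrite zE ge0_ler_powR ?invr_ge0// nnegrE ltW// q0.
have sd0 : 0 < d `^ 2^-1 by rewrite powR_gt0.
have w_ge y : -1 <= w y by have := v0 (refl nu mu y); have := v1 y; rewrite /w /mirror_gap; lra.
pose Phi y := w y / zeta y.
have Phi_ge y : S y -> - (d `^ 2^-1)^-1 <= Phi y.
  move=> Sy; rewrite /Phi ler_pdivlMr ?z0//.
  apply: le_trans (w_ge y); rewrite mulNr lerN2 mulrC ler_pdivlMr// mul1r; exact: zd.
(* The strip is unbounded in tangential directions, so the infimum - I of w / zeta may fail to be
   attained. A small multiple of the squared distance to a near-minimizer [x0] is added, which
   localizes the minimum in the unit ball. *)
pose E := [set Phi y | y in S].
have hE : has_inf E.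
  by split; [exists (Phi y1); exists y1|exists (- (d `^ 2^-1)^-1) => _ [y Sy <-]; exact: Phi_ge].
pose I := - inf E.
have IE y : S y -> - I <= Phi y.
  by move=> Sy; rewrite opprK; apply: inf_lbound; [case: hE|exists y].
have I0 : 0 < I.
  rewrite oppr_gt0; apply: le_lt_trans (_ : Phi y1 < 0).
    by apply: inf_lbound; [case: hE|exists y1].
  by rewrite /Phi pmulr_llt0// invr_gt0 z0.
(* B zeta bounds from above the Laplacian of zeta |y - x0|^2 on the unit ball; C, hence e = I / C,
   is such that the penalization costs at most half of I in the final inequality. *)
pose B := 2 * n%:R + 2 / d.
have B0 : 0 < B by rewrite ltr_wpDl// divr_gt0.
pose C := 8 * (4^-1 + B * (mu + d) ^+ 2).
have C2 : 2 <= C.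
  have : 0 <= B * (mu + d) ^+ 2 by rewrite mulr_ge0 ?sqr_ge0// ltW.
  by rewrite /C; lra.
have C0 : 0 < C by lra.
pose e := I / C.
have e0 : 0 < e by rewrite divr_gt0.
have e2 : e <= I / 2 by rewrite ler_wpM2l ?(ltW I0)// lef_pV2 ?posrE.
have [_ [x0 Sx0 <-] x0I] := inf_adherent e0 hE.
have {}x0I : Phi x0 < - I + e by move: x0I; rewrite /I opprK.
pose P y := nsq (y - x0).
have cP y : {for y, continuous P} by exact: cont_nsqB.
pose K := S `&` [set y | P y <= 1].
have cK : compact K.
  have -> : K = cube x0 1 `&` (S `&` [set y | P y <= 1]).
    apply/seteqP; split => y; last by case.
    move=> [Sy Py]; split => //; rewrite /cube /=.
    by rewrite -(@expr_le1 _ 2)//; apply: le_trans (norm_sqr_le _) Py.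
  apply: compact_closedI; first exact: cube_compact.
  apply: closedI.
    apply: (@preimage_closed _ _ (dot nu) `[0, mu]%classic); last exact: itv_closed.
    by move=> y _; exact: cont_dot.
  apply: (@preimage_closed _ _ P [set t | t <= 1]); last exact: closed_le.
  by move=> y _; exact: cP.
have lz y : S y -> lap zeta y (- (4^-1) * q y `^ (2^-1 - 2)).
  move=> Sy; have qy : 0 < mu + d + dot (- nu) y by rewrite -qE q0.
  have := lap_dot_powR 2^-1 qy; rewrite nsqN nu1 mulr1 -qE.
  by congr (lap _ _ _); field.
have czeta y : S y -> {for y, continuous zeta} by move=> /lz /lap_cont.
pose Psi y := Phi y + e * P y.
have Kx0 : K x0 by split => //=; rewrite /P subrr nsq0 ler01.
have [||ys Kys ymin] := compact_min cK (w := Psi).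
- by exists x0.
- move=> y [Sy _]; apply: contD; last by apply: contZ.
  apply: contM; first exact: cgap.
  by apply: (@cvgV _ _ (nbhs y) _ zeta); [rewrite gt_eqF// z0|exact: czeta].
have [Sys Pys] := Kys.
pose th := - Psi ys.
have thI : I - e < th.
  have := ymin _ Kx0; rewrite /th /Psi /P subrr nsq0 mulr0 addr0; lra.
have th0 : 0 < th by lra.
have Ps0 : 0 <= P ys by exact: nsq_ge0.
have zys := z0 _ Sys.
have wys : w ys = - (th + e * P ys) * zeta ys.
  have -> : - (th + e * P ys) = Phi ys by rewrite /th /Psi; ring.
  by rewrite /Phi divfK// gt_eqF.
have wneg : w ys < 0.
  by rewrite wys pmulr_llt0// oppr_lt0 ltr_wpDr// mulr_ge0// ltW.
have thPI : th + e * P ys <= I.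
  have := IE _ Sys; rewrite /th /Psi; lra.
have sys0 : 0 < dot nu ys < mu.
  have /andP[a b] := Sys; rewrite !lt_neqAle a b !andbT.
  apply/andP; split; apply/eqP => H.
    by have := gap_boundary (mu := mu) (or_introl (esym H)); rewrite leNgt wneg.
  by have := gap_boundary (or_intror H); rewrite leNgt wneg.
have /andP[sa sb] := sys0.
have Pys1 : P ys < 1.
  rewrite lt_neqAle Pys andbT; apply/eqP => H.
  have := IE _ Sys; move: thI; rewrite /th /Psi H; lra.
have sStrip : strip mu ys by [].
have nS : \forall y \near ys, strip mu y by exact: open_nbhs_nbhs.
have SS y : strip mu y -> S y by move=> [/= a b]; rewrite /S /= !ltW.
have nP : \forall y \near ys, P y < 1.
  have Pe : 0 < 1 - P ys by rewrite subr_gt0.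
  have /cvg_near0P/(_ _ Pe) H := @cP ys; apply/nearP0; apply: filterS H => h.
  by rewrite ltr_norml => /andP[_ ?]; lra.
pose lzP y := 2 * (zeta y * n%:R + P y * (- (8^-1) * q y `^ (2^-1 - 2)) +
   dot ((2^-1 * q y `^ (2^-1 - 1)) *: (- nu)) (2 *: (y - x0))).
have lzPE y : S y -> lap (fun y => zeta y * P y) y (lzP y).
  move=> Sy; have qy : 0 < mu + d + dot (- nu) y by rewrite -qE q0.
  have j1 := jet_comp (jetD (jet_cst (mu + d) y) (jet_dot (- nu) y)) (jet1_powR 2^-1 qy).
  have j2 : jet P y (2 *: (y - x0)) 1%:M.
    have := @jet_affine _ _ nsq (- x0) 1%:M y (2 *: (y - x0)) 1%:M.
    rewrite trmx1 !mulmx1 (addrC (- x0)) => /(_ (jet_nsq _)).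
    by under eq_fun do rewrite mulmx1 addrC.
  have := lapM j1 j2; congr (lap _ _ _); rewrite /lzP -!qE !add0r mxtrace1.
  rewrite mxtraceD !mxtraceZ mxtrace0 tr_outer -/(nsq (- nu)) nsqN nu1 mulr0 add0r mulr1.
  rewrite -/(zeta y); congr (2 * (_ + P y * _ + _)).
    by rewrite zE.
  by field.
(* By the choice of [th] this function has a local maximum 0 at [ys]. The sign of its Laplacian
   there compares 1 / (4 q^2) with the linearized coefficient p v^(p - 1). *)
have L1 : Lap (strip mu) (fun y => - th * zeta y - e * (zeta y * P y) - w y)
   (fun y => - th * (- (4^-1) * q y `^ (2^-1 - 2)) - e * lzP y -
      (- v (refl nu mu y) `^ p - - v y `^ p)).
  apply: LapB; last exact: Lap_gap.
  apply: Lap_lap => y /SS Sy; apply: lapB; apply: lapZ; [exact: lz|exact: lzPE].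
have cqm m y : S y -> {for y, continuous (fun y => q y `^ m)}.
  move=> Sy; have qy : 0 < mu + d + dot (- nu) y by rewrite -qE q0.
  have := lap_cont (lap_dot_powR m qy).
  by rewrite (_ : (fun y => _) = (fun y => q y `^ m))//; apply/funext => t; rewrite qE.
have cf : {for ys, continuous (fun y => - th * (- (4^-1) * q y `^ (2^-1 - 2)) - e * lzP y -
      (- v (refl nu mu y) `^ p - - v y `^ p))}.
  apply: contB; last first.
    apply: contB; apply: contN; last exact: cvp.
    by apply: (@cont_comp_refl _ _ (fun y => v y `^ p)); exact: cvp.
  apply: contB; first by do 2 apply: contZ; exact: cqm.
  apply: contZ; apply: contZ; apply: contD.
    apply: contD.
      by apply: contM; [exact: czeta|exact: cst_continuous].
    by apply: contM; [exact: cP|apply: contZ; exact: cqm].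
  rewrite (_ : (fun y => _) = (fun y => q y `^ (2^-1 - 1) * (- (dot nu y - dot nu x0)))).
    apply: contM; first exact: cqm.
    by apply: contN; apply: contB; [exact: cont_dot|exact: cst_continuous].
  by apply/funext => y; rewrite dotZl dotNl dotZr dotBr; field.
have lm : \forall y \near ys, - th * zeta y - e * (zeta y * P y) - w y <=
   - th * zeta ys - e * (zeta ys * P ys) - w ys.
  have -> : - th * zeta ys - e * (zeta ys * P ys) - w ys = 0 by rewrite wys; ring.
  apply: filterS2 nS nP => y /SS Sy Py.
  have Ky : K y by split => //; exact: ltW.
  have := ymin _ Ky; rewrite -[Psi ys]opprK -/th => H.
  have : - th * zeta y <= Psi y * zeta y by rewrite ler_wpM2r// ltW// z0.
  by rewrite /Psi mulrDl /Phi divfK ?gt_eqF ?z0//; lra.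
have := Lap_max_cont (@open_strip mu) L1 sStrip lm cf.
have qys := q0 _ Sys.
have /andP[dq qmd] := qd _ Sys.
have zq2 : q ys `^ (2^-1 - 2) = zeta ys / q ys ^+ 2.
  rewrite zE powRB; last by rewrite (gt_eqF qys) implybT.
  by rewrite powR_mulrn// ltW.
have zq1 : q ys `^ (2^-1 - 1) = zeta ys / q ys.
  rewrite zE powRB; last by rewrite (gt_eqF qys) implybT.
  by rewrite powRr1// ltW.
rewrite /lzP zq2 zq1 dotZl dotNl dotZr dotBr.
set X := (dot nu ys - dot nu x0).
have X1 : `|X| <= 1.
  rewrite -(@expr_le1 _ 2)// real_normK ?num_real// /X -dotBr.
  by apply: le_trans (dot_unit_le _) Pys.
move=> H; exists ys; split => //.
rewrite -/(q ys).
have fw : v ys `^ p - v (refl nu mu ys) `^ p <= p * v ys `^ (p - 1) * (I * zeta ys).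
  apply: le_trans (powR_diff_le (ltW p1) _) _.
    by rewrite v0/=; move: wneg; rewrite /w /mirror_gap subr_lt0 => /ltW.
  rewrite ler_wpM2l ?mulr_ge0 ?powR_ge0 ?(ltW p0)//.
  have -> : v ys - v (refl nu mu ys) = - w ys by rewrite /w /mirror_gap opprB.
  by rewrite wys mulNr opprK ler_wpM2r// ltW.
set k := p * v ys `^ (p - 1) in fw *.
set Q := q ys in H qys dq qmd *.
have H1 : th * (zeta ys / (4 * Q ^+ 2)) <= e * B * zeta ys + k * I * zeta ys.
  have h1 : 2 * (2^-1 * (zeta ys / Q) * (- (2 * X))) <= (2 / d) * zeta ys.
    have -> : 2 * (2^-1 * (zeta ys / Q) * (- (2 * X))) = (2 * zeta ys) * (- X / Q) by field; rewrite gt_eqF.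
    have -> : 2 / d * zeta ys = (2 * zeta ys) * d^-1 by ring.
    rewrite ler_wpM2l ?mulr_ge0 ?(ltW zys)//.
    rewrite ler_pdivrMr//; apply: le_trans (_ : 1 <= _).
      by move: X1; rewrite ler_norml => /andP[? ?]; rewrite lerNl.
    by rewrite mulrC ler_pdivlMr// mul1r.
  have h2 : 0 <= P ys * (8^-1 * (zeta ys / Q ^+ 2)).
    by rewrite !mulr_ge0 ?invr_ge0 ?exprn_ge0 ?(ltW zys) ?(ltW qys).
  have h3 : 2 * (zeta ys * n%:R + P ys * (- 8^-1 * (zeta ys / Q ^+ 2)) +
       2^-1 * (zeta ys / Q) * - (2 * X)) <= B * zeta ys by rewrite /B; lra.
  have h4 := ler_wpM2l (ltW e0) h3.
  have -> : th * (zeta ys / (4 * Q ^+ 2)) = - th * (- 4^-1 * (zeta ys / Q ^+ 2)).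
    by field; rewrite gt_eqF.
  lra.
have H2 : th / (4 * Q ^+ 2) <= e * B + k * I.
  rewrite -(ler_pM2r zys); lra.
have QQ : 0 < Q ^+ 2 by rewrite exprn_gt0.
have H3 : th <= 4 * Q ^+ 2 * (e * B + k * I).
  by move: H2; rewrite ler_pdivrMr ?mulr_gt0// mulrC.
have Qle : Q ^+ 2 <= (mu + d) ^+ 2 by rewrite lerXn2r ?nnegrE// ?(ltW qys)// addr_ge0// ltW.
have eC : e * (4^-1 + B * (mu + d) ^+ 2) = I / 8.
  rewrite (_ : 4^-1 + B * (mu + d) ^+ 2 = C / 8); last by rewrite /C; field.
  by rewrite /e; field; rewrite gt_eqF.
have H4 : 4 * Q ^+ 2 * (e * B) <= 4 * (e * B * (mu + d) ^+ 2).
  by rewrite -mulrA ler_wpM2l// mulrC ler_wpM2l// mulr_ge0 ?(ltW e0) ?(ltW B0).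
have H5 : I / 2 <= 4 * Q ^+ 2 * (k * I) by lra.
have H6 : 1 <= 8 * Q ^+ 2 * k.
  have -> : 8 * Q ^+ 2 * k = 4 * Q ^+ 2 * (k * I) / (I / 2) by field; rewrite gt_eqF.
  by rewrite ler_pdivlMr ?mul1r ?divr_gt0.
by rewrite -[leLHS]mulr1 ler_pdivrMl ?mulr_gt0.
Qed.
End one_solution.
End half_space.

Section limits_of_solutions.
Context {R : realType} {n : nat}.
Local Notation V := 'rV[R]_n.
Implicit Types (x y z : V) (u w f g : V -> R) (D K : set V).
Variables (F : set_system nat).
Context {FU : UltraFilter F}.
Let FP : ProperFilter F. Proof. exact: ultra_proper. Qed.

Lemma ultra_unit (a : nat -> R) (l : R) :
  (forall e, 0 < e -> \forall k \near F, `|a k - l| < e) ->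
  (forall k, 0 <= a k <= 1) -> 0 <= l <= 1.
Proof.
move=> al a01; apply/andP; split.
  rewrite -oppr_le0; apply: (@ultra_le _ F _ (fun k => - a k) (- l)).
    by move=> e /al; apply: filterS => k; rewrite -opprD normrN.
  by apply: filterE => k; rewrite oppr_le0; have /andP[] := a01 k.
by apply: (ultra_le al); apply: filterE => k; have /andP[] := a01 k.
Qed.

Lemma Lap_powR_ultra (p : R) D (v : nat -> V -> R) w : 1 <= p ->
  (forall k y, 0 <= v k y <= 1) -> (forall y, 0 <= w y <= 1) ->
  (forall K, compact K -> forall e : R, 0 < e ->
      \forall k \near F, forall y, K y -> `|v k y - w y| <= e) ->
  (forall K, compact K -> K `<=` D -> forall e : R, 0 < e ->
     \forall k \near F, exists D' g, [/\ Lap D' (v k) g, K `<=` D' &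
       forall x, K x -> `|g x - - v k x `^ p| <= e]) ->
  Lap D w (fun y => - w y `^ p).
Proof.
move=> p1 v01 w01 vw H; apply: Lap_ultra => K cK KD e e0.
have p0 : 0 < p by exact: lt_le_trans p1.
have e2 : 0 < e / 2 by rewrite divr_gt0.
have e2p : 0 < e / (2 * p) by rewrite divr_gt0// mulr_gt0.
apply: filterS (filterI (H K cK KD _ e2) (filterI (vw K cK _ e2p) (vw K cK _ e0))).
move=> k [[D' [g [Lk KD' Hg]]] [h1 h2]].
exists D', g; split; [exact: Lk|exact: KD'|move=> x Kx|exact: h2].
have -> : g x - - w x `^ p = (g x - - v k x `^ p) + (w x `^ p - v k x `^ p) by ring.
apply: le_trans (ler_normD _ _) _.
have := Hg x Kx; have : `|w x `^ p - v k x `^ p| <= e / 2; last by lra.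
apply: le_trans (powR_lip p1 (w01 _) (v01 _ _)) _.
rewrite distrC; apply: le_trans (ler_wpM2l (ltW p0) (h1 x Kx)) _.
by apply: le_eq; field; rewrite gt_eqF.
Qed.
End limits_of_solutions.

Lemma nat_ultrafilter : exists F : set_system nat,
  UltraFilter F /\ forall P : set nat, (\forall k \near \oo, P k) -> F P.
Proof. by have [G [GU sG]] := @ultraFilterLemma nat \oo _; exists G. Qed.

Section half_space_liouville.
Context {R : realType} {n : nat}.
Local Notation V := 'rV[R]_n.
Implicit Types (x y z : V) (u v w f g : V -> R) (D K : set V).
Variables (nu : V) (p L : R).
Hypotheses (nu1 : nsq nu = 1) (p1 : 1 < p).

Local Notation half_solution := (half_solution nu p L).
Local Notation gap := (mirror_gap nu).

Lemma half_translate v z : half_solution v -> dot nu z = 0 ->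
  half_solution (fun y => v (z + y)).
Proof.
move=> [vL v01 vlow vE] z0; split => //.
- by move=> x y; apply: le_trans (vL _ _) _; rewrite opprD addrACA subrr add0r.
- by move=> y y0; apply: vlow; rewrite dotDr z0 add0r.
- by apply: (Lap_sub (@Lap_translate _ _ _ _ _ z vE)) => y; rewrite /= dotDr z0 add0r.
Qed.

Lemma half_ultra (F : set_system nat) (FU : UltraFilter F) (v : nat -> V -> R) :
  (forall k, half_solution (v k)) ->
  exists w, half_solution w /\
   forall y (e : R), 0 < e -> \forall k \near F, `|v k y - w y| < e.
Proof.
move=> hv.
have vL k : lip L (v k) by case: (hv k).
have v01 k y : 0 <= v k y <= 1 by case: (hv k).
have vB k y : `|v k y| <= 1.
  by have /andP[a b] := v01 k y; rewrite ger0_norm.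
have [w [wc wL wB wK]] := @ultra_fun R n F FU v 1 L vB vL.
have w01 y : 0 <= w y <= 1.
  by apply: (@ultra_unit R F FU (fun k => v k y)) => // e; exact: wc.
exists w; split => //; split => //.
- move=> y y0; apply/eqP; rewrite eq_le; have /andP[-> _] := w01 y; rewrite andbT.
  apply: (@ultra_le R F FU (fun k => v k y) (w y)) => [e|]; first exact: wc.
  apply: (@filterE _ F _); move=> k.
  by have [_ _ vl _] := hv k; rewrite vl.
- apply: (@Lap_powR_ultra R n F FU p _ v w (ltW p1) v01 w01 wK) => K cK KD e e0.
  apply: (@filterE _ F _) => k; have [_ _ _ vE] := hv k.
  exists [set y | 0 < dot nu y], (fun y => - v k y `^ p); split => // x _.
  by rewrite subrr normr0 ltW.
Qed.

Let good v mu := forall y, 0 <= dot nu y -> dot nu y <= mu -> 0 <= gap v mu y.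

Let delta : R := (8 * p)^-1.
Let p0 : 0 < p. Proof. exact: lt_trans p1. Qed.
Let delta0 : 0 < delta. Proof. by rewrite invr_gt0 mulr_gt0. Qed.
Let eta (mu : R) : R := ((8 * (mu + delta) ^+ 2 * p)^-1) `^ ((p - 1)^-1).

(** Two consequences of [gap_negative] with d = delta, where q = mu + delta - nu.y. As v <= 1, it
    gives q^2 >= delta, which for so small a delta implies q >= 2 delta, that is, distance at least
    delta to the mirror. As q <= mu + delta, it bounds v below by [eta mu]. *)
Let not_good v mu : half_solution v -> 0 < mu -> ~ good v mu ->
  exists y, [/\ 0 < dot nu y, dot nu y <= mu - delta, gap v mu y < 0 & eta mu <= v y].
Proof.
move=> hv mu0 ng.
have p10 : 0 < p - 1 by rewrite subr_gt0.
have [y [y0 ymu gy H]] : exists y, [/\ 0 < dot nu y, dot nu y < mu, gap v mu y < 0 &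
    (8 * (mu + delta - dot nu y) ^+ 2)^-1 <= p * v y `^ (p - 1)].
  apply: (gap_negative nu1 p1 hv mu0 delta0).
  apply: contrapT => ne; apply: ng => y y0 ymu; rewrite leNgt; apply/negP => g0.
  by apply: ne; exists y.
have [_ v01 _ _] := hv; have /andP[v0 v1] := v01 y.
set q := mu + delta - dot nu y in H.
have qd : delta < q by rewrite /q; lra.
have q0 : 0 < q by exact: lt_trans qd.
have qq : 0 < q ^+ 2 by rewrite exprn_gt0.
have v1p : v y `^ (p - 1) <= 1.
  have := @ge0_ler_powR R (p - 1) (ltW p10) (v y) 1.
  by rewrite powR1; apply; rewrite ?nnegrE.
exists y; split => //.
  have H1 : (8 * q ^+ 2)^-1 <= p.
    by apply: le_trans H _; rewrite ler_piMr// ltW.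
  rewrite leNgt; apply/negP => H2.
  have q2 : q < 2 * delta by rewrite /q; lra.
  have : q ^+ 2 < (2 * delta) ^+ 2 by rewrite ltr_pXn2r// nnegrE ltW// mulr_gt0.
  have d1 : 8 * p * delta = 1 by rewrite /delta divff// gt_eqF// mulr_gt0.
  have d2 : delta <= 8^-1 by rewrite /delta invfM ler_piMr// invf_le1// ltW.
  have : 1 <= p * (8 * q ^+ 2).
    by rewrite -ler_pdivrMr ?mulr_gt0// div1r.
  have : p * (8 * (2 * delta) ^+ 2) <= 2^-1.
    by rewrite (_ : p * _ = 4 * (8 * p * delta) * delta); [rewrite d1; lra|ring].
  have := ltr_pM2l p0; nra.
rewrite leNgt; apply/negP => H2.
have : v y `^ (p - 1) < eta mu `^ (p - 1).
  by rewrite gt0_ltr_powR// nnegrE// powR_ge0.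
have md : 0 < mu + delta by rewrite addr_gt0.
rewrite /eta -powRrM mulVf ?gt_eqF// powRr1 ?invr_ge0; last first.
  by rewrite !mulr_ge0 ?sqr_ge0// ltW.
apply/negP; rewrite -leNgt.
rewrite -(ler_pM2l p0); apply: le_trans H.
have -> : p * (8 * (mu + delta) ^+ 2 * p)^-1 = (8 * (mu + delta) ^+ 2)^-1.
  by field; rewrite !gt_eqF.
rewrite lef_pV2 ?posrE ?mulr_gt0 ?exprn_gt0//.
rewrite ler_pM2l// lerXn2r ?nnegrE ?(ltW q0) ?(ltW md)//.
by rewrite /q; lra.
Qed.

Let gap_lip v mu mu' y : half_solution v ->
  `|gap v mu y - gap v mu' y| <= `|L| * (2 * `|mu - mu'|).
Proof.
move=> [vL _ _ _]; rewrite /gap opprB addrA subrK.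
apply: le_trans (vL _ _) _.
apply: le_trans (_ : `|L| * `|refl nu mu y - refl nu mu' y| <= _).
  by rewrite ler_wpM2r// ler_norm.
rewrite ler_wpM2l// /refl.
rewrite (_ : _ - _ = (2 * (mu - mu')) *: nu); last by apply/rowP => i; rewrite !mxE; ring.
by rewrite normrZ normrM ger0_norm// ler_piMr ?mulr_ge0// norm_unit.
Qed.

(** Otherwise mirrors tending to mu from above have bad points. These keep away from the mirror and
    v is bounded below there, so tangential translates converge to a nonzero solution that is good
    at mu but has a nonpositive gap inside the strip, against the strong maximum principle. *)
Let good_step v mu z : half_solution v -> 0 < v z -> 0 < mu -> good v mu ->
  exists2 e : R, 0 < e & forall mu', mu <= mu' < mu + e -> good v mu'.
Proof.
move=> hv vz mu0 gmu; apply: contrapT => ne.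
have /choice[m Hm] k : exists m, [/\ mu <= m, m < mu + k.+1%:R^-1 & ~ good v m].
  apply: contrapT => nk; apply: ne; exists k.+1%:R^-1; first by rewrite invr_gt0.
  by move=> m /andP[m1 m2]; apply: contrapT => ng; apply: nk; exists m.
have m1 k : mu <= m k by case: (Hm k).
have m2 k : m k <= mu + 1.
  have [_ h _] := Hm k; apply: le_trans (ltW h) _; rewrite lerD2l invf_le1// ler1n//.
have m0 k : 0 < m k by exact: lt_le_trans (m1 k).
have /choice[y Hy] k : exists y, [/\ 0 < dot nu y, dot nu y <= m k - delta,
    gap v (m k) y < 0 & eta (m k) <= v y].
  by apply: not_good => //; case: (Hm k).
pose s k := dot nu (y k).
(* Tangential translation that brings the bad point onto the axis spanned by nu. *)
pose v' k x := v ((y k - s k *: nu) + x).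
have tz k : dot nu (y k - s k *: nu) = 0.
  by rewrite dotBr dotZr -/(nsq nu) nu1 mulr1 subrr.
have hv' k : half_solution (v' k) by exact: half_translate.
have [F [FU Foo]] := nat_ultrafilter.
have FP : ProperFilter F by exact: ultra_proper.
have [w [hw wc]] := half_ultra FU hv'.
have [|sb _ sc] := @ultra_real R F FU s (mu + 1).
  apply: filterE => k; have [a b _ _] := Hy k; have := m2 k; have := delta0.
  by rewrite ger0_norm ?(ltW a)// /s; move: a b; lra.
have mc e : 0 < e -> \forall k \near F, `|m k - mu| < e.
  move=> e0; apply: Foo; near=> k; have [a b _] := Hm k.
  rewrite ger0_norm ?subr_ge0// ltrBlDl; apply: lt_trans b _; rewrite ltrD2l.
  by near: k; exact: near_infty_natSinv_lt (PosNum e0).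
have [wL w01 wlow wE] := hw.
have LL0 : 0 < `|L| + 1 by rewrite ltr_wpDl.
have lipb (v1 : V -> R) (a b : V) (r : R) : lip L v1 -> `|a - b| <= r -> `|v1 a - v1 b| <= (`|L| + 1) * r.
  move=> l1 ab; apply: le_trans (l1 _ _) _.
  apply: le_trans (_ : `|L| * `|a - b| <= _); first by rewrite ler_wpM2r// ler_norm.
  by apply: ler_pM => //; rewrite lerDl.
have vyE k : v' k (s k *: nu) = v (y k) by rewrite /v' subrK.
have gE k t x : gap (v' k) t x = gap v t ((y k - s k *: nu) + x).
  rewrite /gap /v'; congr (v _ - _); rewrite /refl dotDr tz add0r.
  by rewrite addrA.
have vL k : lip L (v' k) by case: (hv' k).
have sbnu e : 0 < e -> \forall k \near F, `|s k *: nu - sb *: nu| < e.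
  move=> /sc; apply: filterS => k H; rewrite -scalerBl normrZ.
  by apply: le_lt_trans H; rewrite ler_piMr// norm_unit.
have p10 : 0 < p - 1 by rewrite subr_gt0.
have eta_ge k : eta (mu + 1) <= v (y k).
  have [_ _ _ h] := Hy k; apply: le_trans h; rewrite /eta.
  have q1 : 0 < m k + delta by rewrite addr_gt0.
  have q2 : 0 < mu + 1 + delta by rewrite !addr_gt0.
  apply: ge0_ler_powR; rewrite ?nnegrE ?invr_ge0 ?(ltW p10)//.
  - by rewrite !mulr_ge0 ?sqr_ge0// ltW.
  - by rewrite !mulr_ge0 ?sqr_ge0// ltW.
  - rewrite lef_pV2 ?posrE ?mulr_gt0 ?exprn_gt0//.
    rewrite ler_pM2r// ler_pM2l// lerXn2r ?nnegrE ?(ltW q1) ?(ltW q2)//.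
    by rewrite lerD2r.
have eta0 : 0 < eta (mu + 1).
  have q1 : 0 < mu + 1 + delta by rewrite !addr_gt0.
  by rewrite powR_gt0// invr_gt0 mulr_gt0// mulr_gt0// exprn_gt0.
have wsb : 0 < w (sb *: nu).
  apply: lt_le_trans eta0 _.
  rewrite -lerN2; apply: (@ultra_le R F FU (fun k => - v' k (sb *: nu) - (`|L| + 1) * `|s k *: nu - sb *: nu|) _ _).
    move=> e e0; have e2 : 0 < e / 2 by rewrite divr_gt0.
    have e3 : 0 < e / 2 / (`|L| + 1) by rewrite divr_gt0.
    apply: filterS2 (wc (sb *: nu) _ e2) (sbnu _ e3) => k.
    move=> h1; rewrite ltr_pdivlMr// => h2.
    rewrite (_ : _ - _ = - (v' k (sb *: nu) - w (sb *: nu)) - (`|L| + 1) * `|s k *: nu - sb *: nu|); last by ring.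
    apply: le_lt_trans (ler_normB _ _) _; rewrite normrN.
    rewrite (ger0_norm (mulr_ge0 (ltW LL0) (normr_ge0 _))); lra.
  apply: filterE => k; rewrite -(opprK (_ * _)) -opprD lerN2.
  apply: le_trans (eta_ge k) _; rewrite -vyE.
  have := lipb _ _ _ _ (vL k) (lexx `|s k *: nu - sb *: nu|).
  by rewrite ler_norml => /andP[_ ?]; lra.
have sb0 : 0 < sb.
  rewrite ltNge; apply/negP => sbn; move: wsb.
  by rewrite wlow ?ltxx// dotZr -/(nsq nu) nu1 mulr1.
have sbmu : sb <= mu - delta.
  rewrite -subr_le0; apply: (@ultra_le R F FU (fun k => s k - m k + delta)).
    move=> e e0; have e2 : 0 < e / 2 by rewrite divr_gt0.
    apply: filterS2 (sc _ e2) (mc _ e2) => k; rewrite !ltr_norml => /andP[? ?] /andP[? ?].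
    by apply/andP; split; lra.
  by apply: filterE => k; have [_ b _ _] := Hy k; rewrite /s; lra.
have sbmu' : sb < mu by have := delta0; lra.
have dsb t : dot nu (t *: nu) = t by rewrite dotZr -/(nsq nu) nu1 mulr1.
have gapc t x e : 0 < e -> \forall k \near F, `|gap (v' k) t x - gap w t x| < e.
  move=> e0; have e2 : 0 < e / 2 by rewrite divr_gt0.
  apply: filterS2 (wc (refl nu t x) _ e2) (wc x _ e2) => k h1 h2.
  rewrite /gap (_ : _ - _ = (v' k (refl nu t x) - w (refl nu t x)) - (v' k x - w x)); last by ring.
  by apply: le_lt_trans (ler_normB _ _) _; lra.
have gw : good w mu.
  move=> x x0 xmu; rewrite -oppr_le0; apply: (@ultra_le R F FU (fun k => - gap (v' k) mu x)).
    by move=> e /(gapc mu x); apply: filterS => k; rewrite -opprD normrN.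
  apply: filterE => k; rewrite oppr_le0 gE; apply: gmu; by rewrite dotDr tz add0r.
have gsb : gap w mu (sb *: nu) <= 0.
  pose C := (`|L| + 1) * (4 + 2 * n%:R).
  have C0 : 0 < C by rewrite mulr_gt0// ltr_pwDl// mulr_ge0.
  have gl (v1 : V -> R) t (a b : V) : half_solution v1 ->
     `|gap v1 t a - gap v1 mu b| <= C * (`|a - b| + `|t - mu|).
    move=> h1; have l1 : lip L v1 by case: h1.
    have -> : gap v1 t a - gap v1 mu b = (gap v1 t a - gap v1 mu a) + ((v1 (refl nu mu a) - v1 (refl nu mu b)) - (v1 a - v1 b)).
      by rewrite /gap; ring.
    apply: le_trans (ler_normD _ _) _.
    have k1 := @gap_lip v1 t mu a h1.
    have k2 := lipb _ _ _ _ l1 (lexx `|a - b|).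
    have k3 : `|refl nu mu a - refl nu mu b| <= (1 + 2 * n%:R) * `|a - b|.
      rewrite /refl (_ : _ - _ = (a - b) - (2 * dot nu (a - b)) *: nu); last first.
        by rewrite dotBr; apply/rowP => i; rewrite !mxE; ring.
      apply: le_trans (ler_normB _ _) _.
      have -> : (1 + 2 * n%:R) * `|a - b| = `|a - b| + 2 * (n%:R * `|a - b|) by ring.
      rewrite lerD2l normrZ.
      apply: le_trans (_ : `|2 * dot nu (a - b)| * 1 <= _); first by rewrite ler_wpM2l// norm_unit.
      rewrite mulr1 normrM ger0_norm// ler_wpM2l//.
      by apply: le_trans (dot_le _ _) _; rewrite -mulrA ler_wpM2l// ler_piMl// norm_unit.
    have k4 := lipb _ _ _ _ l1 k3.
    have k5 := ler_normB (v1 (refl nu mu a) - v1 (refl nu mu b)) (v1 a - v1 b).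
    have k6 : 0 <= (`|L| + 1) * `|t - mu| by rewrite mulr_ge0// ltW.
    have k7 : 0 <= (`|L| + 1) * `|a - b| by rewrite mulr_ge0// ltW.
    have k8 : 0 <= `|t - mu| by [].
    have k9 : 0 <= (`|L| + 1) * n%:R * `|t - mu| by rewrite !mulr_ge0// ltW.
    rewrite /C; lra.
  apply: (@ultra_le R F FU (fun k => gap (v' k) mu (sb *: nu) - C * (`|s k *: nu - sb *: nu| + `|m k - mu|))).
    move=> e e0; have e3 : 0 < e / 3 by rewrite divr_gt0.
    have e4 : 0 < e / 3 / C by rewrite divr_gt0.
    apply: filterS (filterI (gapc mu (sb *: nu) _ e3) (filterI (sbnu _ e4) (mc _ e4))) => k.
    move=> [h1 [h2 h3]]; move: h2 h3; rewrite !(ltr_pdivlMr _ _ C0) => h2 h3.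
    rewrite addrAC; apply: le_lt_trans (ler_normB _ _) _.
    rewrite [X in _ + X]ger0_norm; last by rewrite mulr_ge0 ?addr_ge0// ltW.
    lra.
  apply: filterE => k; have [_ _ gk _] := Hy k.
  have gk' : gap (v' k) (m k) (s k *: nu) < 0 by rewrite gE subrK.
  by have := gl _ (m k) (s k *: nu) (sb *: nu) (hv' k); rewrite ler_norml => /andP[? ?]; lra.
(* 2 mu nu is the mirror image of 0, and w 0 = 0: the gap is positive on the axis near the boundary,
   and positivity spreads along the axis to sb nu. *)
have bpos : 0 < w ((2 * mu) *: nu).
  by apply: (half_solution_pos nu1 hw wsb); rewrite dsb mulr_gt0.
set be := w _ in bpos.
pose s1 := Num.min (sb / 2) (be / (4 * (`|L| + 1))).
have s1a : s1 <= sb / 2 by rewrite ge_min lexx.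
have s1b : (`|L| + 1) * s1 <= be / 4.
  have : s1 <= be / (4 * (`|L| + 1)) by rewrite ge_min lexx orbT.
  by rewrite ler_pdivlMr ?mulr_gt0//; lra.
have s10 : 0 < s1 by rewrite lt_min !divr_gt0// mulr_gt0.
have reflE t : refl nu mu (t *: nu) = (2 * mu - t) *: nu.
  by rewrite /refl dsb; apply/rowP => i; rewrite !mxE; ring.
have nnu t : 0 <= t -> `|t *: nu| <= t.
  by move=> t0; rewrite normrZ ger0_norm// ler_piMr// norm_unit.
have g1 : 0 < gap w mu (s1 *: nu).
  rewrite /gap reflE.
  have h1 : `|w ((2 * mu - s1) *: nu) - be| <= (`|L| + 1) * s1.
    by apply: lipb => //; rewrite -scalerBl addrAC subrr add0r scaleNr normrN nnu// ltW.
  have h2 : `|w (s1 *: nu) - w 0| <= (`|L| + 1) * s1.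
    by apply: lipb => //; rewrite subr0 nnu// ltW.
  have h3 : w 0 = 0 by apply: wlow; rewrite dot0r.
  by move: h1 h2; rewrite h3 !ler_norml => /andP[? ?] /andP[? ?]; lra.
pose St : set V := [set y | 0 < dot nu y] `&` [set y | dot nu y < mu].
have oSt : open St by apply: openI; [exact: open_dot_gt|exact: open_dot_lt].
pose r := Num.min s1 (mu - sb).
have r0 : 0 < r by rewrite lt_min s10 subr_gt0.
have r1 : r <= s1 by rewrite /r ge_min lexx.
have r2 : r <= mu - sb by rewrite /r ge_min lexx orbT.
have wc' x : {for x, continuous w} by exact: lip_cont wL _.
have := @SMP_segment R n St (gap w mu) _ (s1 *: nu) (sb *: nu) (r ^+ 2) oSt (@Lap_gap _ _ _ _ _ nu1 _ hw mu).
have w0 x : 0 <= w x by have /andP[] := w01 x.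
move=> H; have : 0 < gap w mu (sb *: nu).
  apply: H => //.
  - by move=> x _; apply: contB; [exact: cont_comp_refl|].
  - move=> x [/= xa xb].
    have := gw x (ltW xa) (ltW xb); rewrite /gap subr_ge0 => wx.
    have : w x `^ p <= w (refl nu mu x) `^ p by rewrite ge0_ler_powR ?nnegrE ?(ltW p0).
    lra.
  - by move=> x [/= xa xb]; apply: gw; exact: ltW.
  - by rewrite exprn_gt0.
  move=> x t /andP[t0 t1] H1.
  have := le_lt_trans (dot_unit_le nu1 (x - (s1 *: nu + t *: (sb *: nu - s1 *: nu)))) H1.
  rewrite !(dotDr, dotNr, dotZr) (nu1 : dot nu nu = 1) !mulr1 => H2.
  have s1sb : 0 <= sb - s1 by rewrite subr_ge0; lra.
  have t2 : 0 <= t * (sb - s1) by exact: mulr_ge0.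
  have t3 : 0 <= (1 - t) * (sb - s1) by rewrite mulr_ge0// subr_ge0.
  have : `|dot nu x - (s1 + t * (sb - s1))| < r.
    by rewrite -(@ltr_pXn2r _ 2)// ?nnegrE ?(ltW r0)// real_normK ?num_real.
  by rewrite ltr_norml => /andP[? ?]; split => /=; lra.
by rewrite ltNge gsb.
Unshelve. all: by end_near. Qed.

(** The supremum of good positions is good and could be increased. Small mu are good because a bad
    point would satisfy 0 < nu.y <= mu - delta. *)
Lemma half_monotone v z : half_solution v -> 0 < v z ->
  forall mu, 0 < mu -> good v mu.
Proof.
move=> hv vz c c0; apply: contrapT => nc.
have p10 : 0 < p - 1 by rewrite subr_gt0.
have small mu : 0 < mu <= delta -> good v mu.
  move=> /andP[mu0 mud]; apply: contrapT => /(not_good hv mu0)[y [a b _ _]]; lra.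
pose S := [set t : R | 0 < t /\ forall t', 0 < t' <= t -> good v t'].
have Ss : S delta by split => //; exact: small.
have Sc t : S t -> t <= c.
  move=> [t0 Ht]; rewrite leNgt; apply/negP => ct; apply: nc; apply: Ht.
  by rewrite c0 ltW.
have hS : has_sup S by split; [exists delta|exists c => t /Sc].
pose t := sup S.
have st : delta <= t by apply: sup_upper_bound.
have t0 : 0 < t by exact: lt_le_trans st.
have below t' : 0 < t' < t -> good v t'.
  move=> /andP[t'0 t't].
  have tt : 0 < t - t' by rewrite subr_gt0.
  have [a [_ Ha] ta] := sup_adherent tt hS.
  by apply: Ha; rewrite t'0 ltW//; move: ta; rewrite -/t; lra.
have LL0 : 0 < `|L| + 1 by rewrite ltr_wpDl.
have gt : good v t.
  move=> y y0 yt; have [ye|ye] := eqVneq (dot nu y) t.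
    by apply: (gap_boundary hv); right.
  rewrite leNgt; apply/negP => gn.
  have e0 : 0 < - gap v t y / (4 * (`|L| + 1)) by rewrite divr_gt0 ?mulr_gt0// oppr_gt0.
  pose t' := t - Num.min (Num.min (t - dot nu y) (t / 2)) (- gap v t y / (4 * (`|L| + 1))).
  set mm := Num.min _ _ in t'.
  have yt' : dot nu y < t by rewrite lt_neqAle ye.
  have m0 : 0 < mm by rewrite !lt_min subr_gt0 yt' divr_gt0.
  have m1 : mm <= t - dot nu y by rewrite !ge_min lexx.
  have m2 : mm <= t / 2 by rewrite !ge_min lexx orbT.
  have m3 : (`|L| + 1) * mm <= - gap v t y / 4.
    have : mm <= - gap v t y / (4 * (`|L| + 1)) by rewrite !ge_min lexx !orbT.
    by rewrite ler_pdivlMr ?mulr_gt0//; lra.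
  have t'b : 0 < t' < t by apply/andP; rewrite /t'; lra.
  have yt'' : dot nu y <= t' by rewrite /t'; lra.
  have := below _ t'b y y0 yt''; have := @gap_lip v t' t y hv.
  rewrite (_ : `|t' - t| = mm); last by rewrite /t' addrAC subrr sub0r normrN gtr0_norm.
  by rewrite ler_norml => /andP[? ?]; lra.
have [e e0 He] := good_step hv vz t0 gt.
have St : S (t + e / 2).
  split; first by rewrite addr_gt0// divr_gt0.
  move=> t' /andP[t'0 t't]; have [tt|tt] := ltP t' t; first by apply: below; rewrite t'0.
  by apply: He; rewrite tt/=; lra.
have := sup_upper_bound hS St; rewrite -/t; lra.
Qed.

(** Monotonicity keeps v z as a lower bound at z for the translates of v by k nu. They solve the
    equation in half-spaces exhausting the space, so their limit contradicts [liouville_whole]. *)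
Lemma liouville_half v : (2 <= n)%N -> p * (n%:R - 2) < n%:R + 2 ->
  half_solution v -> forall y, v y = 0.
Proof.
move=> n2 pn hv z; apply/eqP; apply/negPn/negP => vz0.
have [vL v01 vlow vE] := hv.
have vz : 0 < v z by rewrite lt_neqAle eq_sym vz0; have /andP[] := v01 z.
have dz : 0 < dot nu z by rewrite ltNge; apply/negP => /vlow H; rewrite H ltxx in vz.
have mono t : 0 <= t -> v z <= v (z + t *: nu).
  rewrite le_eqVlt => /predU1P[<-|t0]; first by rewrite scale0r addr0.
  (* The mirror at height nu.z + t / 2 exchanges z and z + t nu. *)
  have := half_monotone hv vz (_ : 0 < dot nu z + t / 2) (ltW dz).
  rewrite addr_gt0 ?divr_gt0// => /(_ isT) H.
  have := H _; rewrite lerDl divr_ge0 ?(ltW t0)// => /(_ isT).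
  rewrite /gap subr_ge0 /refl (_ : z - _ = z + t *: nu)//.
  by apply/rowP => i; rewrite !mxE; field.
pose v' (k : nat) y := v (k%:R *: nu + y).
have v'L k : lip L (v' k).
  by move=> x y; apply: le_trans (vL _ _) _; rewrite opprD addrACA subrr add0r.
have v'01 k y : 0 <= v' k y <= 1 by exact: v01.
have v'B k y : `|v' k y| <= 1 by have /andP[a b] := v'01 k y; rewrite ger0_norm.
have [F [FU Foo]] := nat_ultrafilter.
have FP : ProperFilter F by exact: ultra_proper.
have [w [wc wL wB wK]] := @ultra_fun R n F FU v' 1 L v'B v'L.
have w01 y : 0 <= w y <= 1.
  by apply: (@ultra_unit R F FU (fun k => v' k y)) => // e; exact: wc.
have wE : Lap setT w (fun y => - w y `^ p).
  apply: (@Lap_powR_ultra R n F FU p _ v' w (ltW p1) v'01 w01 wK) => K cK _ e e0.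
  have [|B B0 HB] := compact_ubound (w := fun y => - dot nu y) cK.
    by move=> x _; apply: contN; exact: cont_dot.
  apply: Foo; near=> k.
  exists [set y | 0 < dot nu (k%:R *: nu + y)], (fun y => - v' k y `^ p); split.
  - exact: (@Lap_translate _ _ _ _ _ (k%:R *: nu) vE).
  - move=> y /HB yB; rewrite /= dotDr dotZr -/(nsq nu) nu1 mulr1.
    have : B < k%:R by near: k; exact: nbhs_infty_gtr.
    lra.
  - by move=> x _; rewrite subrr normr0 ltW.
have : 0 < w z.
  apply: lt_le_trans vz _; rewrite -lerN2.
  apply: (@ultra_le R F FU (fun k => - v' k z)).
    by move=> e /(wc z); apply: filterS => k; rewrite -opprD normrN.
  by apply: filterE => k; rewrite lerN2 /v' addrC; exact: mono.
by rewrite (liouville_whole n2 p1 pn wL w01 wE) ltxx.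
Unshelve. all: by end_near. Qed.
End half_space_liouville.

(** * Regularity of eigenfunctions *)

(** Telescoping over steps of length k shows that g h - g 0 differs from h (g k - g 0) / k by at
    most C h^2 + O(k). The slopes are bounded by L, and l is their limit along an ultrafilter as k
    tends to 0. *)
Lemma second_difference_derivative {R : realType} (g : R -> R) (r C L : R) :
  0 < r -> 0 <= C -> 0 <= L ->
  (forall a b h : R, `|a| <= r -> `|b| <= r -> `|h| <= r ->
     `|g (a + h) - g a - (g (b + h) - g b)| <= C * `|h| * `|a - b|) ->
  (forall a b : R, `|a| <= r -> `|b| <= r -> `|g a - g b| <= L * `|a - b|) ->
  exists l, forall h, `|h| <= r -> `|g h - g 0 - h * l| <= C * h ^+ 2.
Proof.
move=> r0 C0 L0 gC gL.
have fwd (f : R -> R) :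
   (forall a b h : R, `|a| <= r -> `|b| <= r -> `|h| <= r ->
     `|f (a + h) - f a - (f (b + h) - f b)| <= C * `|h| * `|a - b|) ->
   (forall a b : R, `|a| <= r -> `|b| <= r -> `|f a - f b| <= L * `|a - b|) ->
   forall h k, 0 < k -> k <= h -> h <= r ->
   `|f h - f 0 - h * ((f k - f 0) / k)| <= C * h ^+ 2 + 2 * L * k.
  move=> fC fL h k k0 kh hr.
  have h0 : 0 < h by exact: lt_le_trans kh.
  pose m := Num.truncn (h / k).
  have [m1 m2] : m%:R * k <= h /\ h < m.+1%:R * k.
    have hk : 0 <= h / k by rewrite divr_ge0// ltW.
    have /andP[a b] := truncn_itv hk.
    by rewrite -ler_pdivlMr// -ltr_pdivrMr.
  have tel j : j%:R * k <= r ->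
      `|f (j%:R * k) - f 0 - j%:R * (f k - f 0)| <= C * (j%:R * k) ^+ 2.
    elim: j => [_|j IH jr].
      by rewrite !mul0r !subrr normr0 expr0n/= mulr0.
    have jk0 : 0 <= j%:R * k by rewrite mulr_ge0// ltW.
    have jr' : j%:R * k <= r by move: jr; rewrite -natr1 mulrDl mul1r; lra.
    have := IH jr'; have := fC (j%:R * k) 0 k.
    rewrite normr0 subr0 add0r (ger0_norm jk0) (gtr0_norm k0).
    move=> /(_ jr' (ltW r0) (le_trans kh hr)).
    have -> : j%:R * k + k = j.+1%:R * k by rewrite -natr1 mulrDl mul1r.
    move=> H1 H2.
    have -> : f (j.+1%:R * k) - f 0 - j.+1%:R * (f k - f 0) =
       (f (j%:R * k) - f 0 - j%:R * (f k - f 0)) + (f (j.+1%:R * k) - f (j%:R * k) - (f k - f 0)).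
      by rewrite -natr1; ring.
    apply: le_trans (ler_normD _ _) _; apply: le_trans (lerD H2 H1) _.
    rewrite -natr1.
    have : 0 <= C * (k * (j%:R * k)) by rewrite !mulr_ge0// ltW.
    have : 0 <= C * k ^+ 2 by rewrite mulr_ge0// sqr_ge0.
    lra.
  have mk0 : 0 <= m%:R * k by rewrite mulr_ge0// ltW.
  have mkr : m%:R * k <= r by apply: le_trans m1 hr.
  have H1 := tel m mkr.
  have H2 : `|f h - f (m%:R * k)| <= L * k.
    apply: le_trans (fL _ _ _ _) _; rewrite ?ger0_norm ?(ltW h0) ?subr_ge0//.
    by rewrite ler_wpM2l//; move: m2; rewrite -natr1; lra.
  have H3 : `|(h - m%:R * k) * ((f k - f 0) / k)| <= L * k.
    rewrite normrM ger0_norm ?subr_ge0// mulrC ler_pM ?subr_ge0//; last first.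
      by move: m2; rewrite -natr1; lra.
    rewrite normrM (ger0_norm (_ : 0 <= k^-1)) ?invr_ge0 ?(ltW k0)// ler_pdivrMr//.
    have kr : k <= r by apply: le_trans hr.
    by apply: le_trans (fL _ _ _ _) _; rewrite ?subr0 ?normr0 ?(gtr0_norm k0) ?(ltW r0).
  have -> : f h - f 0 - h * ((f k - f 0) / k) =
    ((f (m%:R * k) - f 0 - m%:R * (f k - f 0)) + (f h - f (m%:R * k))) - (h - m%:R * k) * ((f k - f 0) / k).
    by field; rewrite gt_eqF.
  apply: le_trans (ler_normB _ _) _.
  have := ler_normD (f (m%:R * k) - f 0 - m%:R * (f k - f 0)) (f h - f (m%:R * k)).
  have : C * (m%:R * k) ^+ 2 <= C * h ^+ 2.
    by rewrite ler_wpM2l// lerXn2r// nnegrE// ltW.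
  lra.
have both h k : 0 < k -> k <= `|h| -> `|h| <= r ->
   `|g h - g 0 - h * ((g k - g 0) / k)| <= C * h ^+ 2 + (2 * L + C * r) * k.
  move=> k0 kh hr; have Crk : 0 <= C * r * k by rewrite !mulr_ge0// ltW.
  have [h0|h0] := leP 0 h.
    rewrite ger0_norm// in kh hr *.
    by apply: le_trans (fwd g gC gL h k k0 kh hr) _; lra.
  rewrite ltr0_norm// in kh hr.
  (* For negative h the reflected function yields the backward slope, which differs from the forward
     one by at most C k. *)
  have := fwd (fun t => g (- t)) _ _ (- h) k k0 kh hr; rewrite opprK oppr0 sqrrN => H.
  have {}H : `|g h - g 0 - - h * ((g (- k) - g 0) / k)| <= C * h ^+ 2 + 2 * L * k.
    apply: H.
      move=> a b t ar br tr; rewrite (opprD a) (opprD b).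
      by have := gC (- a) (- b) (- t); rewrite (_ : - a - - b = - (a - b)) ?normrN; [exact|ring].
    by move=> a b ar br; have := gL (- a) (- b); rewrite (_ : - a - - b = - (a - b)) ?normrN; [exact|ring].
  have H2 : `|g k - g 0 - (g 0 - g (- k))| <= C * k * k.
    have := gC 0 (- k) k; rewrite add0r (addrC (- k)) subrr sub0r opprK normr0 normrN.
    rewrite (gtr0_norm k0); apply; rewrite ?(ltW r0)//; exact: le_trans hr.
  have -> : g h - g 0 - h * ((g k - g 0) / k) =
     (g h - g 0 - - h * ((g (- k) - g 0) / k)) - (h / k) * (g k - g 0 - (g 0 - g (- k))).
    by field; rewrite gt_eqF.
  apply: le_trans (ler_normB _ _) _; rewrite normrM.
  have : `|h / k| * `|g k - g 0 - (g 0 - g (- k))| <= C * r * k.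
    apply: le_trans (ler_wpM2l (normr_ge0 _) H2) _.
    rewrite normrM ltr0_norm// (gtr0_norm (_ : 0 < k^-1)) ?invr_gt0//.
    have -> : - h / k * (C * k * k) = - h * (C * k) by field; rewrite gt_eqF.
    have -> : C * r * k = r * (C * k) by ring.
    by rewrite ler_wpM2r// mulr_ge0// ltW.
  lra.
have [F [FU Foo]] := nat_ultrafilter.
have FP : ProperFilter F by exact: ultra_proper.
pose kk (m : nat) : R := r / m.+1%:R.
have kk0 m : 0 < kk m by rewrite divr_gt0.
have kkr m : kk m <= r by rewrite ler_pdivrMr// ler_peMr ?(ltW r0)// ler1n.
pose a m := (g (kk m) - g 0) / kk m.
have [|l _ Hl] := @ultra_real R F FU a L.
  apply: filterE => m; rewrite /a normrM (gtr0_norm (_ : 0 < (kk m)^-1)) ?invr_gt0//.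
  rewrite ler_pdivrMr//; apply: le_trans (gL _ _ _ _) _; rewrite ?normr0 ?(ltW r0)//.
    by rewrite gtr0_norm.
  by rewrite subr0 gtr0_norm.
exists l => h hr; have [->|h0] := eqVneq h 0.
  by rewrite subrr mul0r subr0 normr0 mulr_ge0// sqr_ge0.
have hn : 0 < `|h| by rewrite normr_gt0.
apply/ler_addgt0Pr => e e0.
pose B := 2 * L + C * r + 1.
have B0 : 0 < B by rewrite ltr_wpDl// addr_ge0 ?mulr_ge0// ltW.
have e1 : 0 < e / (2 * r) by rewrite divr_gt0// mulr_gt0.
have e2 : 0 < Num.min `|h| (e / (2 * B)) / r.
  by rewrite divr_gt0// lt_min hn divr_gt0// mulr_gt0.
have [m [h1 h2]] : exists m, `|a m - l| < e / (2 * r) /\ m.+1%:R^-1 < Num.min `|h| (e / (2 * B)) / r.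
  apply: (@filter_ex _ F); apply: filterI; first exact: Hl.
  by apply: Foo; near=> m; near: m; exact: near_infty_natSinv_lt (PosNum e2).
have {}h2 : kk m < Num.min `|h| (e / (2 * B)).
  by move: h2; rewrite ltr_pdivlMr// mulrC.
move: h2; rewrite lt_min => /andP[h2 h3].
have := both h (kk m) (kk0 m) (ltW h2) hr; rewrite -/(a m) => H.
have -> : g h - g 0 - h * l = (g h - g 0 - h * a m) + h * (a m - l) by ring.
apply: le_trans (ler_normD _ _) _; rewrite normrM.
have : `|h| * `|a m - l| <= e / 2.
  apply: le_trans (_ : r * (e / (2 * r)) <= _); first by rewrite ler_pM// ltW.
  by apply: le_eq; field; rewrite gt_eqF.
have : (2 * L + C * r) * kk m <= e / 2.
  apply: le_trans (_ : B * (e / (2 * B)) <= _).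
    rewrite ler_pM ?(ltW (kk0 m)) ?(ltW h3) ?lerDl//.
    by rewrite addr_ge0 ?mulr_ge0// ltW.
  by apply: le_eq; field; rewrite gt_eqF.
lra.
Unshelve. all: by end_near. Qed.

Section regularity.
Context {R : realType} {n : nat}.
Local Notation V := 'rV[R]_n.
Implicit Types (x y z : V) (u v w f g : V -> R) (D K : set V).
Variable mu : R.

(** Locally the property holds for all large C, so a finite covering leaves finitely many
    thresholds; this is the covering form of compactness for the filter at infinity. *)
Lemma compact_uniform K (P : R -> V -> Prop) : compact K ->
  (forall x, K x -> exists C0 r : R, [/\ 0 < C0, 0 < r &
     forall C, C0 <= C -> forall y, cube x r y -> P C y]) ->
  exists C : R, 0 < C /\ forall x, K x -> P C x.
Proof.
move=> /compact_near_coveringP cov H.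
have F1 : pinfty_nbhs R (fun C : R => 0 < C) by exact: nbhs_pinfty_gt.
suff F2 : pinfty_nbhs R (fun C => K `<=` P C).
  by have [C [C0 HC]] := filter_ex (filterI F1 F2); exists C.
have PF : Filter (pinfty_nbhs R) by exact: filter_filter.
refine (cov R (pinfty_nbhs R) P PF _) => x /H[C0 [r [C00 r0 HC]]].
exists (cube x r, [set C | C0 <= C]) => /=.
  split; first by apply/nbhs_cube; exists r.
  by exists C0; split; [exact: num_real|move=> C /ltW].
by move=> [y C] /= [yr CC]; exact: HC.
Qed.

Lemma cube_sub x y (r s : R) : cube x r y -> cube y s `<=` cube x (r + s).
Proof.
move=> yr z zs; rewrite /cube /= (_ : z - x = (z - y) + (y - x)); last by rewrite addrA subrK.
by apply: le_trans (ler_normD _ _) _; rewrite addrC lerD.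
Qed.

Lemma cube_le x (r s : R) : r <= s -> cube x r `<=` cube x s.
Proof. by move=> rs y yr; exact: le_trans yr rs. Qed.

Lemma cube_delta x y (r s t : R) (i : 'I_n) : cube x r y -> `|t| <= s ->
  cube x (r + s) (y + t *: delta_mx ord0 i).
Proof.
move=> yr ts; apply: (cube_sub yr); rewrite /cube /= addrAC subrr add0r normrZ.
by apply: le_trans ts; rewrite ler_piMr// norm_delta.
Qed.

(* Applied twice, to v and to its difference quotients, the interior estimate
   bounds second differences, hence gives the partial derivatives. *)
Lemma eigen_partial_local D v z (i : 'I_n) : open D ->
  (forall x, D x -> {for x, continuous v}) ->
  Lap D v (fun y => - mu * v y) -> D z ->
  exists r C : R, [/\ 0 < r, 0 < C, cube z r `<=` D & forall x, cube z r x ->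
    is_derive x (delta_mx ord0 i) v (partial i v x) /\
    (forall h : R, `|h| <= r ->
       `|v (x + h *: delta_mx ord0 i) - v x - h * partial i v x| <= C * h ^+ 2)].
Proof.
move=> oD cv Lv Dz; set e := delta_mx ord0 i.
have [d d0 QD] := open_cube oD Dz.
have [M M0 vM] : exists2 M, 0 < M & forall x, cube z d x -> `|v x| <= M.
  have [|M1 M10 H1] := compact_ubound (w := v) (@cube_compact _ _ z d).
    by move=> x /QD; exact: cv.
  have [|M2 M20 H2] := compact_ubound (w := fun x => - v x) (@cube_compact _ _ z d).
    by move=> x /QD Dx; apply: contN; exact: cv.
  exists (M1 + M2); first by rewrite addr_gt0.
  by move=> x xQ; have := H1 x xQ; have := H2 x xQ; rewrite ler_norml; lra.
have G0 (B : R) : 0 <= B -> 0 < `|mu| * B + 1 by move=> ?; rewrite ltr_wpDl// mulr_ge0.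
have fB (B : R) (w : V -> R) x : `|w x| <= B -> `|- mu * w x| <= `|mu| * B + 1.
  by move=> wB; rewrite normrM normrN ler_wpDr// ler_wpM2l.
pose L1 := n%:R * (2 * n%:R * M / d + d * (`|mu| * M + 1)).
have vL1 x y : cube z (d / 2) x -> cube z (d / 2) y -> `|v x - v y| <= L1 * `|x - y|.
  apply: (interior_lipschitz oD QD d0 Lv) => //.
  - by move=> t /QD; exact: cv.
  - by move=> t /vM; exact: fB.
  - exact: G0 (ltW M0).
have L10 : 0 <= L1.
  by rewrite mulr_ge0// addr_ge0 ?mulr_ge0 ?invr_ge0 ?(ltW d0) ?(ltW M0) ?(ltW (G0 _ (ltW M0))).
pose r4 := d / 4.
have r40 : 0 < r4 by rewrite divr_gt0.
pose L2 := n%:R * (2 * n%:R * L1 / r4 + r4 * (`|mu| * L1 + 1)).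
have vL2 x y h : `|h| <= r4 -> cube z (r4 / 2) x -> cube z (r4 / 2) y ->
   `|v (x + h *: e) - v x - (v (y + h *: e) - v y)| <= L2 * `|h| * `|x - y|.
  move=> hr xQ yQ; have [->|h0] := eqVneq h 0.
    by rewrite !scale0r !addr0 !subrr normr0 mulr0 mul0r.
  have hn : 0 < `|h| by rewrite normr_gt0.
  pose D' := D `&` [set x | D (h *: e + x)].
  have oD' : open D'.
    apply: openI => //; apply: (@open_comp _ _ (fun x => h *: e + x) D) => // t _.
    have := @affine_continuous _ _ (h *: e) 1%:M t.
    by rewrite (_ : (fun y => _) = (fun x => h *: e + x))//; apply/funext => s; rewrite mulmx1.
  pose q x := h^-1 * (v (h *: e + x) - v x).
  have Lq : Lap D' q (fun y => - mu * q y).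
    have L0 := LapZ h^-1 (LapB (Lap_sub (Lap_translate (z := h *: e) Lv) (_ : D' `<=` _)) (Lap_sub Lv (_ : D' `<=` _))).
    apply: (Lap_eq (L0 _ _)) => [t []|t []|t|t _]//.
    by split => //; rewrite /q; ring.
  have qd t : cube z r4 t -> [/\ cube z (d / 2) t, cube z (d / 2) (h *: e + t), D t & D (h *: e + t)].
    move=> tQ; have t1 : cube z (d / 2) t by apply: cube_le tQ; rewrite /r4; lra.
    have t2 : cube z (d / 2) (h *: e + t).
      by rewrite addrC; apply: cube_le (cube_delta i tQ hr); rewrite /r4; lra.
    by split => //; apply: QD; apply: cube_le _ _ _; try eassumption; lra.
  have qL1 t : cube z r4 t -> `|q t| <= L1.
    move=> /qd[t1 t2 _ _]; rewrite /q normrM normfV ler_pdivrMl// mulrC.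
    apply: le_trans (vL1 _ _ t2 t1) _; rewrite addrK normrZ ler_wpM2l//.
    by rewrite ler_piMr// norm_delta.
  have := @interior_lipschitz _ _ D' q _ z r4 L1 (`|mu| * L1 + 1) oD' _ r40 Lq _ qL1 _ (G0 _ L10) x y _ _.
  move=> H.
  have {}H : `|q x - q y| <= L2 * `|x - y|.
    apply: H => //.
    - by move=> t /qd[].
    - move=> t /qd[_ _ t1 t2]; apply: contZ; apply: contB; last exact: cv.
      apply: (@continuous_comp _ _ _ (fun x => h *: e + x) v); last exact: cv.
      have := @affine_continuous _ _ (h *: e) 1%:M t.
      by rewrite (_ : (fun y => _) = (fun x => h *: e + x))//; apply/funext => s; rewrite mulmx1.
    - by move=> t /qL1; exact: fB.
  have -> : v (x + h *: e) - v x - (v (y + h *: e) - v y) = h * (q x - q y).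
    by rewrite /q !(addrC (h *: e)); field.
  by rewrite normrM mulrAC mulrC ler_wpM2r.
have L20 : 0 <= L2.
  apply: mulr_ge0 => //; apply: addr_ge0; apply: mulr_ge0.
  - by rewrite mulr_ge0// mulr_ge0.
  - by rewrite invr_ge0 ltW.
  - exact: ltW.
  - exact: ltW (G0 _ L10).
pose r := r4 / 4.
have r0 : 0 < r by rewrite divr_gt0.
have rQ x t : cube z r x -> `|t| <= r -> cube z (r4 / 2) (x + t *: e).
  by move=> xr tr; apply: cube_le (cube_delta i xr tr); rewrite /r; lra.
exists r, (L2 + 1); split => //; first by rewrite ltr_wpDl.
  by move=> x xr; apply: QD; apply: cube_le xr; rewrite /r /r4; lra.
move=> x xr.
have [||l Hl] := @second_difference_derivative R (fun t => v (x + t *: e)) r L2 L1 r0 L20 L10.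
- move=> a b h ar br hr; rewrite !scalerDl !addrA.
  apply: le_trans (vL2 _ _ h _ (rQ _ _ xr ar) (rQ _ _ xr br)) _.
    by apply: le_trans hr _; rewrite /r; lra.
  apply: ler_wpM2l; first by rewrite mulr_ge0.
  rewrite opprD addrACA subrr add0r -scalerBl normrZ.
  by rewrite ler_piMr// norm_delta.
- move=> a b ar br; apply: le_trans (vL1 _ _ _ _) _.
  + by apply: cube_le (rQ _ _ xr ar); rewrite /r4; lra.
  + by apply: cube_le (rQ _ _ xr br); rewrite /r4; lra.
  rewrite ler_wpM2l// opprD addrACA subrr add0r -scalerBl normrZ.
  by rewrite ler_piMr// norm_delta.
rewrite /= scale0r addr0 in Hl.
have isd : is_derive x e v l.
  have cvd : (fun k : R => k^-1 *: ((v \o shift x) (k *: e) - v x)) @ 0^' --> l.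
    apply/cvgrPdist_le => eps eps0; near=> k.
    have k0 : k != 0 by near: k; exact: nbhs_dnbhs_neq.
    have kr : `|k| < r by near: k; exact: dnbhs0_lt.
    have ke : `|k| < eps / (L2 + 1) by near: k; apply: dnbhs0_lt; rewrite divr_gt0// ltr_wpDl.
    have kn : 0 < `|k| by rewrite normr_gt0.
    rewrite -(ler_pM2l kn) -normrM.
    rewrite (_ : k * _ = - (v (x + k *: e) - v x - k * l)); last first.
      by rewrite /= [_ *: _]mulrC (addrC (k *: e)); field.
    rewrite normrN; apply: le_trans (Hl _ (ltW kr)) _.
    rewrite -real_normK ?num_real// expr2 mulrCA ler_wpM2l//.
    move: ke; rewrite ltr_pdivlMr ?ltr_wpDl//; lra.
  apply: DeriveDef; first by apply/cvg_ex; exists l.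
  exact: cvg_lim cvd.
have pl : partial i v x = l by rewrite /partial derive_val.
split; first by rewrite pl.
move=> h hr; rewrite pl; apply: le_trans (Hl h hr) _.
by rewrite ler_wpM2r ?sqr_ge0// lerDl.
Unshelve. all: by end_near. Qed.

(** The equation is linear and translation invariant, so difference quotients solve it. They
    converge locally uniformly to the partial derivative, which is therefore continuous and a
    solution too. *)
Lemma eigen_partial D v (i : 'I_n) : open D ->
  (forall x, D x -> {for x, continuous v}) ->
  Lap D v (fun y => - mu * v y) ->
  [/\ forall x, D x -> derivable v x (delta_mx ord0 i),
      forall x, D x -> {for x, continuous (partial i v)} &
      Lap D (partial i v) (fun y => - mu * partial i v y)].
Proof.
move=> oD cv Lv; set e := delta_mx ord0 i.
have loc := eigen_partial_local i oD cv Lv.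
have cshift (h : R) t : {for t, continuous (fun x : V => h *: e + x)}.
  have := @affine_continuous _ _ (h *: e) 1%:M t.
  by rewrite (_ : (fun y => _) = (fun x => h *: e + x))//; apply/funext => s; rewrite mulmx1.
have nz (h x : R) : 0 < h -> h^-1 * (h * x) = x by move=> h0; rewrite mulrA mulVf ?mul1r// gt_eqF.
split.
- move=> x Dx; have [r [C [r0 _ _ H]]] := loc x Dx.
  by have [[]] := H x (cube_center _ (ltW r0)).
- move=> z Dz; have [r [C [r0 C0 rD H]]] := loc z Dz.
  apply/cvg_near0P => eps eps0.
  pose h := Num.min r (eps / (4 * C)).
  have h0 : 0 < h by rewrite lt_min r0 divr_gt0// mulr_gt0.
  have hr : `|h| <= r by rewrite gtr0_norm// /h ge_min lexx.
  have hC : C * h <= eps / 4.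
    have : h <= eps / (4 * C) by rewrite /h ge_min lexx orbT.
    by rewrite ler_pdivlMr ?mulr_gt0//; lra.
  pose q x := h^-1 * (v (h *: e + x) - v x).
  have qp x : cube z r x -> `|q x - partial i v x| <= eps / 4.
    move=> /H[_ /(_ h hr)] Hh; apply: le_trans hC.
    rewrite /q (addrC (h *: e)) -(ler_pM2l h0) -[X in X * _ <= _](gtr0_norm h0) -normrM.
    rewrite mulrBr mulrA divff ?gt_eqF// mul1r; apply: le_trans Hh _.
    by apply: le_eq; ring.
  have Dhz : D (h *: e + z).
    apply: rD; rewrite /cube /= addrK normrZ; apply: le_trans hr.
    by rewrite ler_piMr// norm_delta.
  have cq : {for z, continuous q}.
    apply: contZ; apply: contB; last exact: cv.
    by apply: (@continuous_comp _ _ _ (fun x => h *: e + x) v); [exact: cshift|exact: cv].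
  have e4 : 0 < eps / 4 by rewrite divr_gt0.
  have /cvg_near0P/(_ _ e4) H2 := cq.
  apply: filterS2 H2 (@near0_norm R n r r0) => k k1 k2.
  have a1 : cube z r (z + k) by rewrite /cube /= addrAC subrr add0r ltW.
  have a2 := qp _ a1; have a3 := qp z (cube_center _ (ltW r0)).
  have -> : partial i v (z + k) - partial i v z =
    - (q (z + k) - partial i v (z + k)) + ((q (z + k) - q z) + (q z - partial i v z)) by ring.
  apply: le_lt_trans (ler_normD _ _) _; rewrite normrN.
  have := ler_normD (q (z + k) - q z) (q z - partial i v z); lra.
apply: Lap_stable => K cK KD eps eps0.
(* One constant serves both as a bound and as the reciprocal of the admissible step, so that the
   property persists when C grows, as [compact_uniform] requires. *)
have [C [C0 HC]] : exists C : R, 0 < C /\ forall x, K x -> [/\ D x, cube x C^-1 `<=` D &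
    forall h : R, `|h| <= C^-1 -> `|v (x + h *: e) - v x - h * partial i v x| <= C * h ^+ 2].
  apply: compact_uniform cK _ => x /KD /loc[r [C [r0 C0 rD H]]].
  exists (C + 2 / r), (r / 2); split; [by rewrite addr_gt0// divr_gt0|by rewrite divr_gt0|].
  move=> C' CC' y yr.
  have C'0 : 0 < C' by apply: lt_le_trans CC'; rewrite addr_gt0// divr_gt0.
  have Ci : C'^-1 <= r / 2.
    rewrite -(invrK (r / 2)) lef_pV2 ?posrE ?invr_gt0 ?divr_gt0//.
    apply: le_trans CC'; rewrite invfM invrK mulrC lerDr; exact: ltW.
  split.
  - by apply: rD; apply: cube_le yr; lra.
  - by move=> t yt; apply: rD; apply: cube_le (cube_sub yr yt); lra.
  - move=> h hC.
    have yr' : cube x r y by apply: cube_le yr; lra.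
    have [_ /(_ h _)] := H y yr'; move=> H'; apply: le_trans (H' _) _; first by apply: le_trans hC _; lra.
    rewrite ler_wpM2r ?sqr_ge0//; apply: le_trans CC'; rewrite lerDl; apply: ltW; exact: divr_gt0.
have mu1 : 0 < `|mu| + 1 by rewrite ltr_wpDl.
pose h := Num.min C^-1 (eps / (C * (`|mu| + 1))).
have h0 : 0 < h by rewrite lt_min invr_gt0 C0 divr_gt0// mulr_gt0.
have hC : `|h| <= C^-1 by rewrite gtr0_norm// /h ge_min lexx.
have hmu : (`|mu| + 1) * (C * h) <= eps.
  have : h <= eps / (C * (`|mu| + 1)) by rewrite /h ge_min lexx orbT.
  by rewrite ler_pdivlMr ?mulr_gt0//; lra.
have hC2 : C * h <= eps.
  apply: le_trans hmu; rewrite ler_peMl ?lerDr// mulr_ge0// ltW//.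
pose D' := D `&` [set x | D (h *: e + x)].
exists D', (fun x => h^-1 * (v (h *: e + x) - v x)), (fun x => - mu * (h^-1 * (v (h *: e + x) - v x))).
have qp x : K x -> `|h^-1 * (v (h *: e + x) - v x) - partial i v x| <= C * h.
  move=> /HC[_ _ /(_ h hC)] Hh.
  rewrite (addrC (h *: e)) -(ler_pM2l h0) -[X in X * _ <= _](gtr0_norm h0) -normrM.
  rewrite mulrBr mulrA divff ?gt_eqF// mul1r; apply: le_trans Hh _.
  by apply: le_eq; ring.
split.
- have L0 := LapZ h^-1 (LapB (Lap_sub (Lap_translate (z := h *: e) Lv) (_ : D' `<=` _)) (Lap_sub Lv (_ : D' `<=` _))).
  apply: (Lap_eq (L0 _ _)) => [t []|t []|t|t _]//.
  by split => //; ring.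
- move=> x Kx; have [Dx xD _] := HC x Kx; split => //; apply: xD.
  by rewrite /cube /= addrK normrZ; apply: le_trans hC; rewrite ler_piMr// norm_delta.
- move=> x Kx; split; first exact: le_trans (qp x Kx) hC2.
  rewrite -mulrBr normrM normrN; apply: le_trans hmu.
  by rewrite ler_pM ?qp// lerDl.
Qed.

Lemma eigen_smooth D v : open D -> (forall x, D x -> {for x, continuous v}) ->
  Lap D v (fun y => - mu * v y) ->
  Ck_on 2 D v /\ forall x, D x -> laplacian v x = - mu * v x.
Proof.
move=> oD cv Lv.
have it (s : seq 'I_n) : (forall x, D x -> {for x, continuous (iter_partial s v)}) /\
    Lap D (iter_partial s v) (fun y => - mu * iter_partial s v y).
  elim: s => [//|i s [c L]]; rewrite /iter_partial /= -/(iter_partial s v).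
  by have [_ ? ?] := eigen_partial i oD c L.
have CD : Ck_on 2 D v.
  move=> s _; have [c L] := it s; split.
    by apply: continuous_in_subspaceT => x /set_mem; exact: c.
  by move=> _ x Dx i; have [H _ _] := eigen_partial i oD c L; exact: H.
split => // x Dx.
have L1 : Lap D v (laplacian v) by apply: Lap_lap => y; exact: C2_lap.
have clap y : D y -> {for y, continuous (laplacian v)}.
  move=> Dy; have cs (r : seq 'I_n) : {for y, continuous (fun t => \sum_(i <- r) partial i (partial i v) t)}.
    elim: r => [|i r IH].
      rewrite (_ : (fun t => _) = cst 0); first exact: cst_continuous.
      by apply/funext => t; rewrite big_nil.
    rewrite (_ : (fun t => _) = (fun t => partial i (partial i v) t + \sum_(i <- r) partial i (partial i v) t)).
      by apply: contD => //; have [c _] := it [:: i; i]; exact: c.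
    by apply/funext => t; rewrite big_cons.
  exact: cs.
(* The function here is v - v = 0, with source Laplacian v + mu v. The maximum principle at each
   point, for both signs, makes this continuous source vanish. *)
have L2 := LapB L1 Lv.
have cd : {for x, continuous (fun y => laplacian v y - - mu * v y)}.
  by apply: contB; [exact: clap|apply: contZ; exact: cv].
have H1 : laplacian v x - - mu * v x <= 0.
  by apply: (Lap_max_cont oD L2 Dx _ cd); apply: filterE => y; rewrite !subrr.
have H2 : - (laplacian v x - - mu * v x) <= 0.
  apply: (Lap_max_cont oD (LapN L2) Dx); last exact: contN.
  by apply: filterE => y; rewrite !subrr.
by apply/eqP; rewrite -subr_eq0 eq_le H1 -oppr_le0.
Qed.
End regularity.

(** * Estimates up to the boundary *)

(** [triangular_bound] is used for g minus its linear part and, inside, for its first derivatives.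
    Second derivatives are bounded on a cube four times as large, which contains the intermediate
    points. *)
Lemma C2_taylor {R : realType} {m : nat} (g : 'rV[R]_m -> R) (z : 'rV[R]_m) (r : R) :
  Ck_on 2 setT g -> 0 < r ->
  exists2 C : R, 0 < C & forall y y1, cube z r y -> cube z r y1 ->
    `|g y - g y1 - \sum_k partial k g y1 * (y - y1) ord0 k| <= C * `|y - y1| ^+ 2.
Proof.
move=> Cg r0.
have d1 y k : is_derive y (delta_mx ord0 k) g (partial k g y).
  have [_ H] := Cg [::] isT.
  by apply/derivableP; have := H isT y I; exact.
have d2 y j k : is_derive y (delta_mx ord0 j) (partial k g) (partial j (partial k g) y).
  have [_ H] := Cg [:: k] isT.
  by apply/derivableP; have := H isT y I; exact.
have c2 j k y : {for y, continuous (partial j (partial k g))}.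
  have [H _] := Cg [:: j; k] isT; move: H; rewrite continuous_open_subspace//; last exact: openT.
  by apply; rewrite inE.
have /choice[B HB] (jk : 'I_m * 'I_m) : exists B : R, 0 < B /\
    forall y, cube z (4 * r) y -> `|partial jk.1 (partial jk.2 g) y| <= B.
  have [|B1 B10 H1] := compact_ubound (w := partial jk.1 (partial jk.2 g)) (@cube_compact _ _ z (4 * r)).
    by move=> y _; exact: c2.
  have [|B2 B20 H2] := compact_ubound (w := fun y => - partial jk.1 (partial jk.2 g) y) (@cube_compact _ _ z (4 * r)).
    by move=> y _; apply: contN; exact: c2.
  exists (B1 + B2); split; first by rewrite addr_gt0.
  by move=> y yQ; have := H1 y yQ; have := H2 y yQ; rewrite ler_norml; lra.
pose S := \sum_jk B jk.
have S0 : 0 <= S by rewrite sumr_ge0// => jk _; have [/ltW] := HB jk.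
have SB jk : B jk <= S.
  rewrite /S (bigD1 jk)//= lerDl sumr_ge0// => i _; by have [/ltW] := HB i.
exists (m%:R * (m%:R * S) + 1); first by rewrite ltr_wpDl// !mulr_ge0.
move=> y y1 yQ y1Q.
have yy : `|y - y1| < 3 * r.
  rewrite (_ : y - y1 = (y - z) - (y1 - z)); last by apply/rowP => i; rewrite !mxE; ring.
  by apply: le_lt_trans (ler_normB _ _) _; move: yQ y1Q; rewrite /cube /=; lra.
have inQ h : `|h| < 3 * r -> cube z (4 * r) (y1 + h).
  move=> hr; rewrite /cube /= addrAC; apply: le_trans (ler_normD _ _) _.
  by move: y1Q; rewrite /cube /=; lra.
pose p : 'rV[R]_m := \row_k partial k g y1.
have -> : \sum_k partial k g y1 * (y - y1) ord0 k = dot p (y - y1).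
  by apply: eq_bigr => k _; rewrite [p _ _]mxE.
pose G t := g t - dot p t.
apply: le_trans (_ : m%:R * ((m%:R * S) * `|y - y1| ^+ 2) <= _); last first.
  by rewrite mulrA ler_wpM2r ?sqr_ge0// lerDl.
have -> : g y - g y1 - dot p (y - y1) = G (y1 + (y - y1)) - G y1.
  by rewrite (addrC y1) subrK /G dotBr; ring.
apply: (@triangular_bound R m G y1 (3 * r) (m%:R * S) 1) => //; first by rewrite mulr_ge0.
move=> h k hr _.
have Db := jet_is_derive (delta_mx ord0 k) (jet_dot p (y1 + h)).
have DG : is_derive (y1 + h) (delta_mx ord0 k) G (partial k g (y1 + h) - partial k g y1).
  by have := is_deriveB (d1 (y1 + h) k) Db; rewrite dot_delta mxE; exact.
split => //; rewrite derive_val expr1 -mulrA -[`|h|]expr1.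
apply: (@triangular_bound R m (partial k g) y1 (3 * r) S 0) => //.
move=> h' j h'r _; have D2 := d2 (y1 + h') j k; split => //.
rewrite derive_val expr0 mulr1; apply: le_trans (SB (j, k)).
by have [_ /(_ _ (inQ _ h'r))] := HB (j, k).
Qed.

Section boundary_geometry.
Context {R : realType} {n : nat}.
Local Notation V := 'rV[R]_n.
Implicit Types (x y z : V) (D : set V).

Lemma boundary_compact D : bounded_set D -> compact (boundary D).
Proof.
move=> bD; have [M [_ HM]] := bD.
apply: bounded_closed_compact.
  exists (M + 1); split; first exact: num_real.
  move=> M' MM' x [cx _].
  have cl : closure D `<=` [set y | `|y| <= M + 1].
    have -> : [set y : V | `|y| <= M + 1] = cube 0 (M + 1).
      by apply/funext => y; rewrite /cube /= subr0.
    rewrite (_ : cube 0 (M + 1) = closure (cube 0 (M + 1))).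
      apply: closureS => y Dy; rewrite /cube /= subr0; apply: HM => //; lra.
    apply/closure_id; apply: compact_closed; [exact: norm_hausdorff|exact: cube_compact].
  by apply: le_trans (cl _ cx) (ltW MM').
apply: closedI; first exact: closed_closure.
by apply: open_closedC; exact: open_interior.
Qed.

(** nu is the inner unit normal, and the boundary lies between two opposite paraboloids. A single C
    bounds the curvature and, through its inverse, the neighbourhood, in the format of
    [compact_uniform]. *)
Definition touching_paraboloids D (C : R) x0 nu := nsq nu = 1 /\
  forall x, `|x - x0| < C^-1 ->
    (D x -> - C * nsq (x - x0) <= dot nu (x - x0)) /\
    (~ D x -> dot nu (x - x0) <= C * nsq (x - x0)).

Lemma boundary_touching D : bounded_smooth_domain D ->
  exists C : R, 0 < C /\ forall x0, boundary D x0 -> exists nu, touching_paraboloids D C x0 nu.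
Proof.
move=> [oD _ _ bD sD].
pose P C x0 := boundary D x0 -> exists nu, touching_paraboloids D C x0 nu.
suff H : forall x, boundary D x -> exists C0 r : R, [/\ 0 < C0, 0 < r &
     forall C, C0 <= C -> forall y, cube x r y -> P C y].
  have [C [C0 HC]] := compact_uniform (boundary_compact bD) H.
  by exists C; split => // x Bx; exact: HC.
move=> y0 /sD[i [b [g [r [r0 sg Hg]]]]].
have r2 : 0 < r / 2 by rewrite divr_gt0.
have [C C0 HC] := @C2_taylor R n.-1 g (col' i y0) (r / 2) (sg 2) r2.
have C1 : 0 < C + 4 / r by rewrite addr_gt0// divr_gt0.
exists (C + 4 / r), (r / 4); split; [exact: C1|by rewrite divr_gt0|].
move=> C' CC' x1 x1Q [clx1 nx1].
have C'0 : 0 < C' by exact: lt_le_trans CC'.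
have C'C : C <= C' by apply: le_trans CC'; rewrite lerDl divr_ge0// ltW.
have C'r : C'^-1 <= r / 4.
  rewrite -(invrK (r / 4)) lef_pV2 ?posrE ?invr_gt0 ?divr_gt0//.
  by apply: le_trans CC'; rewrite invfM invrK mulrC lerDr ltW.
have col_le x y : `|col' i x - col' i y| <= `|x - y|.
  apply: norm_le => // k; rewrite !mxE.
  by have := coord_le (x - y) (lift i k); rewrite !mxE.
have colQ x : cube y0 (r / 2) x -> cube (col' i y0) (r / 2) (col' i x).
  by move=> xQ; apply: le_trans xQ; exact: col_le.
have Dg x : cube y0 (r / 2) x -> (D x <-> g (col' i x) < (-1) ^+ b * x ord0 i).
  move=> xQ; apply: Hg; rewrite -ball_normE /= distrC; apply: le_lt_trans xQ _; lra.
set s : R := (-1) ^+ b in Dg.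
have x1Q2 : cube y0 (r / 2) x1 by apply: cube_le x1Q; lra.
have nD : ~ D x1 by move=> Dx1; apply: nx1; rewrite /interior; exact: open_nbhs_nbhs.
(* Near [y0] the domain is the set F > 0, and F vanishes at [x1]. Below, [a] is the gradient of F at
   [x1], of length at least 1 because of its i-th entry. *)
pose F x := s * x ord0 i - g (col' i x).
have cF x : {for x, continuous F}.
  apply: contB.
    rewrite (_ : (fun y : V => s * y ord0 i) = dot (s *: delta_mx ord0 i)).
      exact: cont_dot.
    by apply/funext => y; rewrite dotZl dotC dot_delta.
  apply: (@continuous_comp _ _ _ (fun x : V => col' i x) g).
    apply: cont_normP => e e0; exists e => // y ye; exact: le_lt_trans (col_le _ _) ye.
  have [+ _] := sg 0%N [::] isT; rewrite continuous_open_subspace; last exact: openT.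
  by apply; rewrite inE.
have F1 : F x1 = 0.
  apply/eqP; rewrite eq_le; apply/andP; split.
    rewrite subr_le0 leNgt; apply/negP => H; apply: nD; exact/(Dg _ x1Q2).
  rewrite leNgt; apply/negP => F1n.
  have cn : {for x1, continuous (fun x => - F x)} by exact: contN.
  have Fp : 0 < - F x1 by rewrite oppr_gt0.
  have nF : \forall x \near x1, 0 < - F x.
    have Fp2 : - F x1 / 2 < - F x1 by lra.
    apply: filterS (cont_near_gt cn Fp2) => x; lra.
  have nQ : \forall x \near x1, cube y0 (r / 2) x.
    apply/nbhs_cube; exists (r / 4); first by rewrite divr_gt0.
    by move=> x xQ; apply: cube_le (cube_sub x1Q xQ); lra.
  have [x [Dx [Fx xQ]]] := clx1 _ (filterI nF nQ).
  by have /(Dg _ xQ) := Dx; move: Fx; rewrite /F; lra.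
pose a : V := \row_j (if unlift i j is Some k then - partial k g (col' i x1) else s).
have dota h : dot a h = s * h ord0 i - \sum_k partial k g (col' i x1) * h ord0 (lift i k).
  rewrite /dot (bigD1_ord i)//= mxE unlift_none; congr (_ + _).
  rewrite -sumrN; apply: eq_bigr => k _.
  by rewrite mxE liftK mulNr.
have ss : s ^+ 2 = 1 by rewrite /s sqrr_sign.
have a1 : 1 <= nsq a.
  rewrite nsqE (bigD1 i)//= mxE unlift_none ss lerDl sumr_ge0// => j _; exact: sqr_ge0.
have FT x : cube y0 (r / 2) x -> `|F x - dot a (x - x1)| <= C' * nsq (x - x1).
  move=> xQ; have := HC _ _ (colQ _ xQ) (colQ _ x1Q2).
  have -> : F x - dot a (x - x1) =
     - (g (col' i x) - g (col' i x1) - \sum_k partial k g (col' i x1) * (col' i x - col' i x1) ord0 k).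
    rewrite dota (_ : F x = F x - F x1); last by rewrite F1 subr0.
    rewrite /F.
    rewrite (_ : \sum_k partial k g (col' i x1) * (x - x1) ord0 (lift i k) =
       \sum_k partial k g (col' i x1) * (col' i x - col' i x1) ord0 k); last first.
      by apply: eq_bigr => k _; rewrite !mxE.
    by rewrite !mxE; ring.
  rewrite normrN => /le_trans; apply.
  apply: ler_pM => //; [exact: ltW|].
  apply: le_trans (norm_sqr_le _).
  by rewrite lerXn2r// nnegrE.
pose q := Num.sqrt (nsq a).
have q1 : 1 <= q by rewrite -sqrtr1 ler_wsqrtr.
have q0 : 0 < q by exact: lt_le_trans q1.
exists (q^-1 *: a); split.
  by rewrite nsqZ exprVn sqr_sqrtr ?nsq_ge0// mulVf// gt_eqF// (lt_le_trans _ a1).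
move=> x xC; have xQ : cube y0 (r / 2) x.
  apply: cube_le (cube_sub x1Q (_ : cube x1 (r / 4) x)); first lra.
  by apply: ltW; exact: lt_le_trans C'r.
have := FT _ xQ; rewrite ler_norml => /andP[f1 f2].
have N0 : 0 <= C' * nsq (x - x1) by rewrite mulr_ge0 ?nsq_ge0// ltW.
have qN : q * (C' * nsq (x - x1)) >= C' * nsq (x - x1) by rewrite ler_peMl.
split=> [/(Dg _ xQ)|nDx]; rewrite dotZl.
  by rewrite ler_pdivlMl//; move: f2; rewrite /F; lra.
have Fx : F x <= 0.
  by rewrite subr_le0 leNgt; apply/negP => H; apply: nDx; exact/(Dg _ xQ).
by rewrite ler_pdivrMl//; lra.
Qed.
End boundary_geometry.

Section global_estimate.
Context {R : realType} {n : nat}.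
Local Notation V := 'rV[R]_n.
Implicit Types (x y z nu : V) (u v w f : V -> R) (D K : set V).
Hypothesis n0 : (0 < n)%N.

Let n1 : 1 <= n%:R :> R. Proof. by rewrite ler1n. Qed.
Let np : 0 < n%:R :> R. Proof. exact: lt_le_trans n1. Qed.

(** The boundary point is the first exit from D on the segment from x to y. *)
Lemma segment_boundary D x y : open D -> D x -> ~ D y ->
  exists2 x0, boundary D x0 & `|x - x0| <= `|x - y| /\ `|y - x0| <= `|x - y|.
Proof.
move=> oD Dx nDy.
pose S := [set s : R | 0 <= s <= 1 /\ forall t, 0 <= t <= s -> D (x + t *: (y - x))].
have S0 : S 0.
  split; first by rewrite lexx ler01.
  move=> t /andP[t0 t0']; have -> : t = 0 by apply/eqP; rewrite eq_le t0 t0'.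
  by rewrite scale0r addr0.
have hS : has_sup S by split; [exists 0|exists 1 => s [/andP[]]].
pose t := sup S.
have t0 : 0 <= t by exact: sup_upper_bound.
have t1 : t <= 1 by apply: ge_sup; [exists 0|move=> s [/andP[]]].
pose p s := x + s *: (y - x).
have below s : 0 <= s -> s < t -> D (p s).
  move=> s0 st; have ts : 0 < t - s by rewrite subr_gt0.
  have [a [_ Ha] ta] := sup_adherent ts hS.
  by apply: Ha; rewrite s0/=; move: ta; rewrite -/t; lra.
have pn s s' : `|p s - p s'| = `|s - s'| * `|y - x|.
  by rewrite /p opprD addrACA subrr add0r -scalerBl normrZ.
have nDt : ~ D (p t).
  move=> Dt; have [r r0 rD] := open_cube oD Dt.
  have t1' : t < 1.
    rewrite lt_neqAle t1 andbT; apply/eqP => te; apply: nDy.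
    by move: Dt; rewrite /p te scale1r addrC subrK.
  have yx1 : 0 < `|y - x| + 1 by rewrite ltr_wpDl.
  pose e := Num.min (1 - t) (r / (`|y - x| + 1)).
  have e0 : 0 < e by rewrite lt_min subr_gt0 t1' divr_gt0.
  have e1 : e <= 1 - t by rewrite /e ge_min lexx.
  have er : e * (`|y - x| + 1) <= r by rewrite -ler_pdivlMr// /e ge_min lexx orbT.
  have St : S (t + e).
    split; first by apply/andP; split; lra.
    move=> s /andP[s0 ste]; have [st|st] := ltP s t; first exact: below.
    apply: rD; rewrite /cube /= -/(p s) pn ger0_norm ?subr_ge0//.
    apply: le_trans er; apply: ler_pM; rewrite ?subr_ge0//; lra.
  have := sup_upper_bound hS St; rewrite -/t; lra.
exists (p t).
  split; last by move=> /interior_subset.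
  have [te|te] := eqVneq t 0.
    by apply: subset_closure; rewrite te /p scale0r addr0.
  have tp : 0 < t by rewrite lt_neqAle eq_sym te.
  move=> B /nbhs_cube[r r0 rB].
  have yx1 : 0 < `|y - x| + 1 by rewrite ltr_wpDl.
  pose e := Num.min t (r / (`|y - x| + 1)).
  have e0 : 0 < e by rewrite lt_min tp divr_gt0.
  have e1 : e <= t by rewrite /e ge_min lexx.
  have er : e * (`|y - x| + 1) <= r by rewrite -ler_pdivlMr// /e ge_min lexx orbT.
  exists (p (t - e)); split; first by apply: below; lra.
  apply: rB; rewrite /cube /= pn (_ : t - e - t = - e); last by ring.
  rewrite normrN gtr0_norm//; apply: le_trans er; rewrite ler_wpM2l ?(ltW e0)// lerDl//.
have x0 : x = p 0 by rewrite /p scale0r addr0.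
have y1 : y = p 1 by rewrite /p scale1r addrC subrK.
rewrite [in `|x - p t|]x0 [in `|y - p t|]y1 !pn (distrC x) sub0r normrN ger0_norm//.
by rewrite ger0_norm ?subr_ge0// !ler_piMl//; lra.
Qed.

(* Quadratic barrier at a boundary point x0: with l = nu.(x - x0),
   psi = A l + B |x - x0|^2 - E l^2 is positive in D near x0 because there
   l >= - C |x - x0|^2. *)
Lemma boundary_barrier D u f x0 nu (C M G d : R) : open D -> ~ D x0 ->
  0 < C -> touching_paraboloids D C x0 nu ->
  continuous u -> (forall x, ~ D x -> u x = 0) -> Lap D u f ->
  (forall x, u x <= M) -> (forall x, D x -> - G <= f x) -> 0 < G -> 0 < M ->
  0 < d -> 8 * n%:R ^+ 2 * (C * d) <= 1 -> d < C^-1 ->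
  forall x, cube x0 d x -> u x <= 4 * n%:R ^+ 2 * (G * d + 2 * n%:R * M / d) * `|x - x0|.
Proof.
move=> oD nD C0 [nu1 Hnu] cu u0 L uM fG G0 M0 d0 dC dC1 x xQ.
(* The term 2 G beats f >= - G; the other one makes psi at least M where |y - x0| = d. A gives A l -
   E l^2 >= 0 for 0 <= l <= n d, and 2 n B = E gives psi the Laplacian - E. *)
pose E := 2 * G + 4 * n%:R * M / d ^+ 2.
have dd : 0 < d ^+ 2 by rewrite exprn_gt0.
have Ep : 0 < 4 * n%:R * M / d ^+ 2 by rewrite divr_gt0// !mulr_gt0.
have E0 : 0 < E by rewrite addr_gt0// mulr_gt0.
pose l y := dot nu (y - x0).
pose P y := nsq (y - x0).
pose A := E * n%:R * d.
pose B := E / (2 * n%:R).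
pose psi y := A * l y + B * P y - E * l y ^+ 2.
have jl y : jet l y nu 0.
  have := @jet_affine _ _ (dot nu) (- x0) 1%:M y nu 0.
  rewrite mulmx0 mul0mx trmx1 !mulmx1 (addrC (- x0)) => /(_ (jet_dot _ _)).
  by under eq_fun do rewrite mulmx1 addrC.
have ll y : lap l y 0 by exists nu, 0; split => //; rewrite mxtrace0 mulr0.
have ll2 y : lap (fun x => l x ^+ 2) y 2.
  have := lapM (jl y) (jl y); rewrite mxtrace0 !mulr0 !add0r -/(nsq nu) nu1 mulr1.
  by under eq_fun do rewrite -expr2.
have lpsi y : lap psi y (- E).
  have := lapB (lapD (lapZ A (ll y)) (lapZ B (lap_shift (lap_nsq (y - x0))))) (lapZ E (ll2 y)).
  by congr (lap _ _ _); rewrite /B; field; rewrite gt_eqF.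
have lP y : l y ^+ 2 <= P y by have := CauchySchwarz nu (y - x0); rewrite nu1 mul1r.
have P0 y : 0 <= P y by exact: nsq_ge0.
have lQ y : cube x0 d y -> `|l y| <= n%:R * d.
  move=> yQ; have := dot_le nu (y - x0); have nn : `|nu| <= 1.
    by have := norm_sqr_le nu; rewrite nu1 expr_le1.
  move=> /le_trans; apply; rewrite -mulrA ler_wpM2l//.
  by rewrite -[leRHS]mul1r ler_pM.
have psi_ge y : cube x0 d y -> D y -> E / (4 * n%:R) * P y <= psi y.
  move=> yQ Dy; have ly := lQ _ yQ.
  have lC : - C * P y <= l y by have [] := Hnu y (le_lt_trans yQ dC1) => /(_ Dy).
  have Pp := P0 y.
  have EP : 0 <= E * P y by rewrite mulr_ge0// ltW.
  have e1 : B * P y = 2 * (E / (4 * n%:R) * P y) by rewrite /B; field; rewrite gt_eqF.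
  have e2 : 0 <= E / (4 * n%:R) * P y by rewrite mulr_ge0// divr_ge0 ?mulr_ge0 ?(ltW E0).
  move: ly; rewrite ler_norml => /andP[ly1 ly2].
  rewrite /psi e1; have [l0|l0] := leP 0 (l y).
    have : 0 <= E * (l y * (n%:R * d - l y)) by rewrite !mulr_ge0 ?(ltW E0)// subr_ge0.
    by rewrite /A; lra.
  (* For l < 0 the paraboloid gives |l| <= C |y - x0|^2, and the smallness of C d lets half of B |y
     - x0|^2 absorb A l - E l^2. *)
  have k1 : E * (n%:R * d) * (- l y) <= E * (n%:R * d) * (C * P y).
    by rewrite ler_wpM2l ?mulr_ge0 ?(ltW E0) ?(ltW d0)//; lra.
  have k2 : E * (- l y * - l y) <= E * (n%:R * d * (C * P y)).
    rewrite ler_wpM2l ?(ltW E0)// ler_pM ?oppr_ge0 ?(ltW l0)//; lra.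
  have k3 : 2 * (E * (n%:R * d) * (C * P y)) <= E / (4 * n%:R) * P y.
    have -> : 2 * (E * (n%:R * d) * (C * P y)) = (E / (4 * n%:R) * P y) * (8 * n%:R ^+ 2 * (C * d)).
      by field; rewrite gt_eqF.
    by rewrite ler_piMr.
  by rewrite /A; lra.
have cpsi y : {for y, continuous psi} by exact: lap_cont (lpsi y).
(* Cutting by psi >= 0 instead of D keeps the set closed and makes the comparison immediate outside
   D, where u = 0. *)
pose K := cube x0 d `&` [set y | 0 <= psi y].
have cK : compact K.
  apply: compact_closedI; first exact: cube_compact.
  apply: (@preimage_closed _ _ psi [set t | 0 <= t]); last exact: closed_ge.
  by move=> y _; exact: cpsi.
have main : forall y, K y -> u y - psi y <= 0.
  have L2 : Lap D (fun y => u y - psi y) (fun y => f y - - E).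
    by apply: LapB => //; exact: Lap_lap.
  apply: (Lap_le0 oD L2 cK) => [y _|y [yQ yp]].
    by apply: contB; [exact: cu|exact: cpsi].
  have [Dy|nDy] := pselect (D y); last by left; rewrite u0// sub0r oppr_le0.
  have yx0 : y != x0 by apply/eqP => H; apply: nD; rewrite -H.
  have Py : 0 < P y by rewrite nsq_gt0 subr_eq0.
  have [yd|yd] := leP d `|y - x0|.
    left; rewrite subr_le0; apply: le_trans (uM y) _; apply: le_trans (psi_ge _ yQ Dy).
    have dP : d ^+ 2 <= P y.
      apply: le_trans (norm_sqr_le _).
      by rewrite ler_sqr ?nnegrE ?normr_ge0 ?(ltW d0).
    apply: le_trans (_ : 4 * n%:R * M / d ^+ 2 / (4 * n%:R) * d ^+ 2 <= _).
      by apply: le_eq; field; rewrite !gt_eqF.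
    have n4 : 0 < (4 * n%:R)^-1 :> R by rewrite invr_gt0 mulr_gt0.
    have e3 : 0 <= 4 * n%:R * M / d ^+ 2 / (4 * n%:R) by exact: (mulr_ge0 (ltW Ep) (ltW n4)).
    apply: (ler_pM e3 (ltW dd) _ dP); rewrite (ler_pM2r n4) lerDr.
    by rewrite mulr_ge0// ltW.
  right; split => //.
    have psi0 : 0 < psi y.
      apply: lt_le_trans (psi_ge _ yQ Dy); apply: mulr_gt0 => //.
      by apply: divr_gt0 => //; exact: mulr_gt0.
    have p2 : psi y / 2 < psi y by lra.
    have H1 := cont_near_gt (@cpsi y) p2.
    have H2 : nbhs y (cube x0 d).
      apply/nbhs_cube; exists (d - `|y - x0|); first by rewrite subr_gt0.
      by move=> t ty; have := cube_sub (lexx `|y - x0|) ty; rewrite addrC subrK; exact.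
    by apply: filterS2 H1 H2 => t t1 t2; split => //=; lra.
  exists G => //.
  have : \forall t \near y, D t by exact: open_nbhs_nbhs.
  apply: filterS => t Dt; have := fG _ Dt; rewrite /E; lra.
have xn : 0 <= `|x - x0| by [].
have Gd : 0 <= G * d + 2 * n%:R * M / d.
  by apply: addr_ge0; apply: mulr_ge0; rewrite ?mulr_ge0 ?invr_ge0 ?(ltW G0) ?(ltW M0) ?(ltW d0).
have [Dx|nDx] := pselect (D x); last first.
  by rewrite u0// mulr_ge0// mulr_ge0// mulr_ge0// sqr_ge0.
have Kx : K x.
  split => //; apply: le_trans (psi_ge _ xQ Dx); rewrite mulr_ge0//.
  by rewrite divr_ge0 ?mulr_ge0 ?(ltW E0).
have := main _ Kx; rewrite subr_le0 => /le_trans; apply.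
have l1 : l x <= n%:R * `|x - x0|.
  apply: le_trans (ler_norm _) (le_trans (dot_le _ _) _).
  have nn : `|nu| <= 1 by have := norm_sqr_le nu; rewrite nu1 expr_le1.
  by rewrite -mulrA ler_wpM2l// ler_piMl.
have P1 : P x <= n%:R * (d * `|x - x0|).
  by apply: le_trans (nsq_le _) _; rewrite ler_wpM2l// expr2 ler_wpM2r.
have A0 : 0 <= A by rewrite !mulr_ge0// ltW.
have B0 : 0 <= B by rewrite divr_ge0 ?mulr_ge0// ltW.
have h1 := ler_wpM2l A0 l1; have h2 := ler_wpM2l B0 P1.
have h3 : 0 <= E * l x ^+ 2 by rewrite mulr_ge0 ?sqr_ge0// ltW.
apply: le_trans (_ : A * (n%:R * `|x - x0|) + B * (n%:R * (d * `|x - x0|)) <= _).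
  by rewrite /psi; lra.
have -> : 4 * n%:R ^+ 2 * (G * d + 2 * n%:R * M / d) * `|x - x0| =
   2 * n%:R ^+ 2 * (E * d * `|x - x0|) by rewrite /E; field; rewrite gt_eqF.
have -> : A * (n%:R * `|x - x0|) + B * (n%:R * (d * `|x - x0|)) =
   (n%:R ^+ 2 + 2^-1) * (E * d * `|x - x0|) by rewrite /A /B; field; rewrite gt_eqF.
rewrite ler_wpM2r ?mulr_ge0 ?(ltW E0) ?(ltW d0)//.
by have : 1 <= n%:R ^+ 2 :> R; [rewrite exprn_ege1|lra].
Qed.

(** Within 4 |x - y| of the complement of D, the barrier bounds both values. Further inside, the
    interior estimate is applied on a cube around x of size d or comparable to the distance to the
    complement; in the latter case the barrier bounds u there by that distance, so the quotient M' /
    s stays bounded. *)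
Lemma global_lipschitz D : bounded_smooth_domain D ->
  exists C d1 : R, [/\ 0 < C, 0 < d1 & forall u f (M G d : R),
   continuous u -> (forall x, ~ D x -> u x = 0) -> Lap D u f ->
   (forall x, `|u x| <= M) -> (forall x, D x -> `|f x| <= G) -> 0 < G -> 0 < M ->
   0 < d <= d1 -> lip (C * (M / d + d * G)) u].
Proof.
move=> hD; have [oD _ _ _ _] := hD.
have [C [C0 HC]] := boundary_touching hD.
pose N : R := n%:R; have N1 : 1 <= N by [].
have N0 : 0 < N by [].
have NN : 0 < 8 * N ^+ 2 by rewrite mulr_gt0// exprn_gt0.
pose c1 : R := 8 * N ^+ 2 * (1 + N).
have c10 : 0 < c1 by rewrite mulr_gt0// addr_gt0.
exists (9 * c1 + 4 + N * (6 * N * c1 + 2 * N + 1)), ((8 * N ^+ 2 * C)^-1 / 2); split.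
- have Nc : 0 < 6 * N * c1 by do 2 apply: mulr_gt0 => //.
  have : 0 < N * (6 * N * c1 + 2 * N + 1) by apply: mulr_gt0 => //; lra.
  by lra.
- by apply: divr_gt0 => //; rewrite invr_gt0; exact: mulr_gt0.
move=> u f M G d cu u0 L uM fG G0 M0 /andP[d0 dd].
have dC : 8 * N ^+ 2 * (C * d) <= 1.
  have H : d <= (8 * N ^+ 2 * C)^-1.
    by apply: le_trans dd _; rewrite ler_pdivrMr// ler_peMr ?invr_ge0 ?mulr_ge0 ?(ltW NN) ?(ltW C0)// ler1n.
  rewrite mulrA; apply: le_trans (_ : 8 * N ^+ 2 * C * (8 * N ^+ 2 * C)^-1 <= _).
    by rewrite ler_wpM2l// mulr_ge0 ?(ltW NN) ?(ltW C0).
  by rewrite divff// gt_eqF// mulr_gt0.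
have dC1 : d < C^-1.
  rewrite -[C^-1]mul1r ltr_pdivlMr//.
  have Cd : 0 < C * d by rewrite mulr_gt0.
  have : 1 <= N ^+ 2 by rewrite exprn_ege1.
  nra.
pose T := M / d + d * G.
have Md : 0 < M / d by rewrite divr_gt0.
have dG : 0 < d * G by rewrite mulr_gt0.
have T0 : 0 < T by rewrite addr_gt0.
have c1T : 0 < c1 * T by rewrite mulr_gt0.
have bd x x0 : boundary D x0 -> `|u x| <= c1 * T * `|x - x0|.
  move=> Bx0; have [nu Hnu] := HC _ Bx0.
  have nDx0 : ~ D x0.
    by move=> Dx0; case: Bx0 => _; apply; rewrite /interior; exact: open_nbhs_nbhs.
  have xn : 0 <= `|x - x0| by [].
  have [xQ|xQ] := leP `|x - x0| d; last first.
    apply: le_trans (uM x) _.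
    apply: le_trans (_ : M / d * `|x - x0| <= _).
      by rewrite mulrAC ler_pdivlMr// ler_pM2l// ltW.
    rewrite ler_wpM2r//; apply: le_trans (_ : T <= _); first by rewrite lerDl ltW.
    rewrite ler_peMl ?(ltW T0)// /c1.
    have : 1 <= N ^+ 2 by rewrite exprn_ege1.
    nra.
  have key (w g : V -> R) : continuous w -> (forall x, ~ D x -> w x = 0) -> Lap D w g ->
      (forall x, w x <= M) -> (forall x, D x -> - G <= g x) -> w x <= c1 * T * `|x - x0|.
    move=> cw w0 Lw wM gG.
    have := boundary_barrier oD nDx0 C0 Hnu cw w0 Lw wM gG G0 M0 d0 dC dC1 xQ.
    move=> /le_trans; apply; rewrite ler_wpM2r// -/N /c1 /T.
    have p1 : 0 <= N ^+ 2 * (M / d) by rewrite mulr_ge0 ?sqr_ge0// ltW.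
    have p2 : 0 <= N ^+ 2 * (d * G) by rewrite mulr_ge0 ?sqr_ge0// ltW.
    have p3 : 0 <= N * (N ^+ 2 * (d * G)) by rewrite mulr_ge0// ltW.
    have -> : 2 * N * M / d = 2 * N * (M / d) by rewrite mulrA.
    lra.
  rewrite ler_norml lerNl; apply/andP; split.
    apply: (key (fun x => - u x) (fun x => - f x)).
    - by move=> y; apply: contN; exact: cu.
    - by move=> y /u0 ->; rewrite oppr0.
    - exact: LapN.
    - by move=> y; have := uM y; rewrite ler_norml => /andP[? ?]; lra.
    - by move=> y /fG; rewrite ler_norml => /andP[? ?]; lra.
  apply: (key u f) => //.
  - by move=> y; have := uM y; rewrite ler_norml => /andP[].
  - by move=> y /fG; rewrite ler_norml => /andP[].
have out x z : ~ D z -> `|u x| <= c1 * T * `|x - z|.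
  move=> nDz; have [Dx|nDx] := pselect (D x); last first.
    by rewrite u0// normr0 mulr_ge0// ltW.
  have [x0 Bx0 [h1 _]] := segment_boundary oD Dx nDz.
  by apply: le_trans (bd _ _ Bx0) _; rewrite ler_wpM2l// ltW.
have CT0 : 0 <= 9 * c1 * T by rewrite -mulrA; apply: mulr_ge0 => //; exact: ltW.
have Nc : 0 < N * (6 * N * c1) by do 3 apply: mulr_gt0 => //.
have NcT : 0 < N * (6 * N * c1) * T by exact: mulr_gt0.
have NT : 0 < N * T by exact: mulr_gt0.
have NNT : 0 < N * (N * T) by exact: mulr_gt0.
have I0 : 0 <= N * (6 * N * c1 + 2 * N + 1) * T by lra.
move=> x y; set rho := `|x - y|.
have rho0 : 0 <= rho by exact: normr_ge0.
have [Dx|nDx] := pselect (D x); last first.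
  rewrite (u0 _ nDx) sub0r normrN; apply: le_trans (out y x nDx) _.
  rewrite distrC -/rho ler_wpM2r// -/T; lra.
have [/eqP|rhop] := eqVneq rho 0.
  by rewrite normr_eq0 subr_eq0 => /eqP xy; rewrite xy subrr normr0 -/T; apply: mulr_ge0 => //; lra.
have {}rhop : 0 < rho by rewrite lt_neqAle eq_sym rhop.
have [near_bd|far] := pselect (exists2 z, ~ D z & `|x - z| <= 4 * rho).
  have [z nDz xz] := near_bd.
  have h1 := out x z nDz; have h2 := out y z nDz.
  have yz : `|y - z| <= 5 * rho.
    rewrite (_ : y - z = (x - z) - (x - y)); last by apply/rowP => i; rewrite !mxE; ring.
    by apply: le_trans (ler_normB _ _) _; rewrite -/rho; lra.
  have h3 := ler_wpM2l (ltW c1T) xz; have h4 := ler_wpM2l (ltW c1T) yz.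
  apply: le_trans (ler_normB _ _) _.
  apply: le_trans (_ : 9 * c1 * T * rho <= _); first lra.
  rewrite ler_wpM2r// -/T; lra.
have far4 : cube x (4 * rho) `<=` D.
  by move=> z xz; apply: contrapT => nDz; apply: far; exists z => //; rewrite distrC.
have interior s M' : 0 < s -> s <= d -> cube x s `<=` D -> 2 * rho <= s ->
   (forall z, cube x s z -> `|u z| <= M') -> `|u x - u y| <= N * (2 * N * M' / s + d * G) * rho.
  move=> s0 sd sD rs uM'.
  have := @interior_lipschitz R n D u f x s M' G oD sD s0 L (fun z _ => @cu z) uM' (fun z zs => fG _ (sD _ zs)) G0 x y.
  move=> H; apply: le_trans (H _ _) _.
  - by apply: cube_center; rewrite divr_ge0// ltW.
  - by rewrite /cube /= distrC -/rho; lra.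
  - rewrite -/rho ler_wpM2r// ler_wpM2l ?(ltW N0)// lerD2l ler_wpM2r// ltW//.
have [dD|ndD] := pselect (cube x d `<=` D).
  have [rd|rd] := leP (2 * rho) d.
    apply: le_trans (interior d M d0 (lexx _) dD rd (fun z _ => uM z)) _.
    rewrite ler_wpM2r// -/T.
    have q1 : N * (2 * N * M / d + d * G) <= N * (2 * N + 1) * T.
      have -> : 2 * N * M / d = 2 * N * (M / d) by rewrite mulrA.
      have w1 : 0 < N * (N * (d * G)) by do 2 apply: mulr_gt0 => //.
      have w2 : 0 < N * (M / d) by exact: mulr_gt0.
      by rewrite /T; lra.
    have q2 := ltW NcT.
    lra.
  apply: le_trans (ler_normB _ _) _; apply: le_trans (lerD (uM x) (uM y)) _.
  apply: le_trans (_ : 4 * (M / d) * rho <= _).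
    rewrite -mulrA mulrAC mulrA ler_pdivlMr//.
    have := ler_wpM2l (ltW M0) (ltW rd); lra.
  rewrite ler_wpM2r// -/T; have : M / d <= T by rewrite lerDl ltW.
  lra.
have [z1 z1d nDz1] : exists2 z, cube x d z & ~ D z.
  by apply: contrapT => H; apply: ndD => z zd; apply: contrapT => nDz; apply: H; exists z.
pose S := [set s : R | 0 <= s /\ cube x s `<=` D].
have S4 : S (4 * rho) by split => //; rewrite mulr_ge0.
have Sd s : S s -> s <= d.
  move=> [s0 sD]; rewrite leNgt; apply/negP => ds; apply: nDz1; apply: sD.
  by apply: cube_le z1d; exact: ltW.
have hS : has_sup S by split; [exists (4 * rho)|exists d => s /Sd].
pose t := sup S.
have t4 : 4 * rho <= t by exact: sup_upper_bound.
have td : t <= d by apply: ge_sup; [exists (4 * rho)|move=> s /Sd].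
have t0 : 0 < t by apply: lt_le_trans t4; rewrite mulr_gt0.
(* t is the sup-norm distance from x to the complement: the cube of size s lies in D and that of
   size 2 s does not, so all points of the former are within 3 s of the complement. *)
pose s := 3 / 4 * t.
have s0 : 0 < s by rewrite mulr_gt0// divr_gt0.
have sD : cube x s `<=` D.
  have ts : 0 < t - s by rewrite /s; lra.
  have [a [_ Ha] ta] := sup_adherent ts hS.
  by move=> z zs; apply: Ha; apply: cube_le zs; move: ta; rewrite -/t; lra.
have [z2 z2s nDz2] : exists2 z, cube x (2 * s) z & ~ D z.
  apply: contrapT => H.
  have : S (2 * s).
    split; first by rewrite mulr_ge0// ltW.
    by move=> z zs; apply: contrapT => nDz; apply: H; exists z.
  by move=> /(sup_upper_bound hS); rewrite -/t /s; lra.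
have M's z : cube x s z -> `|u z| <= c1 * T * (3 * s).
  move=> zs; apply: le_trans (out z z2 nDz2) _; rewrite ler_wpM2l ?(ltW c1T)//.
  rewrite (_ : z - z2 = (z - x) - (z2 - x)); last by apply/rowP => i; rewrite !mxE; ring.
  by apply: le_trans (ler_normB _ _) _; move: zs z2s; rewrite /cube /=; lra.
have sd : s <= d by rewrite /s; lra.
have rs : 2 * rho <= s by rewrite /s; lra.
apply: le_trans (interior s _ s0 sd sD rs M's) _.
rewrite ler_wpM2r// -/T.
have -> : 2 * N * (c1 * T * (3 * s)) / s = 6 * N * c1 * T by field; rewrite gt_eqF.
have q1 : N * (6 * N * c1 * T + d * G) <= N * (6 * N * c1 + 1) * T.
  have w : 0 < N * (M / d) by exact: mulr_gt0.
  have -> : N * (6 * N * c1 + 1) * T = N * (6 * N * c1) * T + N * T by ring.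
  by rewrite /T; lra.
lra.
Qed.
End global_estimate.

(** * The norm of the gradient *)

Section gradient_norm.
Context {R : realType}.
Local Notation T := (measurableTypeR R).

Let box n (r : R) : set (n.-tuple T) := [set t | forall i, `|tnth t i| <= r].

Lemma measurable_box n (r : R) : measurable (@box n r).
Proof.
have -> : @box n r = \bigcap_(i in [set: 'I_n]) ((fun t : n.-tuple T => tnth t i) @^-1` `[- r, r]%classic).
  apply/seteqP; split => [t tr i _|t tr i]; first by rewrite /= in_itv /= -ler_norml.
  by have := tr i Logic.I; rewrite /= in_itv /= -ler_norml.
apply: fin_bigcap_measurable => // i _.
by rewrite -[X in measurable X]setTI; apply: (measurable_tnth i).
Qed.

Lemma leb_box_lty n (r : R) : (leb R n (@box n r) < +oo)%E.
Proof.
elim: n => [|n IH] /=; first by rewrite diracE ltry.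
rewrite /leb_step /pushforward /=.
have -> : @cons_pair R n @^-1` (@box n.+1 r) = `[- r, r]%classic `*` @box n r.
  apply/seteqP; split => [[x t] /= xt|[x t] [/= xr tr] i].
    split => /=; first by rewrite in_itv /= -ler_norml; exact: (xt ord0).
    by move=> i; have := xt (lift ord0 i); rewrite /cons_pair /= tnthS.
  rewrite /cons_pair; have [->|[j ->]] : i = ord0 \/ exists j, i = lift ord0 j.
  - by have [j ->|->] := unliftP ord0 i; [right; exists j|left].
  - by move: xr; rewrite in_itv /= -ler_norml.
  - by rewrite tnthS; exact: tr.
rewrite product_measure1E//=; last exact: measurable_box.
have mu_itv : (lebesgue_measure (`[(- r)%R, r%R]%classic : set T) < +oo)%E.
  by rewrite lebesgue_measure_itv /=; case: ifP => // _; rewrite -EFinB ltry.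
by rewrite lte_mul_pinfty// ge0_fin_numE.
Qed.

Lemma partial_le n (D : set 'rV[R]_n) (u : 'rV[R]_n -> R) (L : R) x i : open D -> D x ->
  derivable u x (delta_mx ord0 i) -> 0 <= L ->
  (forall y, D y -> `|u y - u x| <= L * `|y - x|) -> `|partial i u x| <= L.
Proof.
move=> oD Dx du L0 uL; rewrite leNgt; apply/negP => Ll.
have [r r0 rD] := open_cube oD Dx.
have H1 : \forall h \near (0 : R)^', L < `|h^-1 *: (u (h *: delta_mx ord0 i + x) - u x)|.
  exact: (cvgr_norm_gt ('D_(delta_mx ord0 i) u x) du L Ll).
have H2 : \forall h \near (0 : R)^', h != 0 by exact: nbhs_dnbhs_neq.
have H3 : \forall h \near (0 : R)^', `|h| < r.
  by apply: dnbhs0_lt.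
have [h [/= h1 [h2 h3]]] := filter_ex (filterI H1 (filterI H2 H3)).
have dn : `|delta_mx (ord0 : 'I_1) i : 'rV[R]_n| <= 1 by exact: norm_delta.
have hd : `|h *: delta_mx (ord0 : 'I_1) i + x - x| <= `|h|.
  by rewrite addrK normrZ ler_piMr.
have Dh : D (h *: delta_mx ord0 i + x) by apply: rD; rewrite /cube /= (le_trans hd)// ltW.
move: h1; apply/negP; rewrite -leNgt [leLHS]normrM normfV mulrC.
rewrite ler_pdivrMr ?normr_gt0//; apply: le_trans (uL _ Dh) _.
by rewrite ler_wpM2l.
Qed.

Lemma grad_L2norm_le n (D : set 'rV[R]_n) : bounded_set D -> exists2 c : R, 0 < c &
  forall (u : 'rV[R]_n -> R) (L : R), 0 <= L ->
    (forall x i, D x -> `|partial i u x| <= L) ->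
    (grad_L2norm D u <= (c * L)%:E)%E.
Proof.
move=> bD.
have [r Dr] : exists r : R, forall x, D x -> `|x| <= r.
  have [r [_ Hr]] := bD; exists (r + 1) => x Dx; apply: (Hr (r + 1)) => //.
  by rewrite ltrDl.
pose m := fine (leb R n (@box n r)).
have mE : leb R n (@box n r) = m%:E by rewrite fineK// ge0_fin_numE// leb_box_lty.
have m0 : 0 <= m by rewrite /m fine_ge0.
(* The square root of n times the measure of a box containing D, plus 1 for positivity. *)
exists (Num.sqrt (n%:R * m) + 1); first by rewrite ltr_wpDl.
move=> u L L0 uL.
have cL : Num.sqrt (n%:R * m) * L <= (Num.sqrt (n%:R * m) + 1) * L by rewrite ler_wpM2r// lerDl.
apply: (@le_trans _ _ (Num.sqrt (n%:R * m) * L)%:E); last by rewrite lee_fin.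
rewrite /grad_L2norm unlock.
have -> : Num.sqrt (n%:R * m) * L = ((n%:R * L ^+ 2) * m) `^ 2^-1.
  rewrite powR12_sqrt; last by rewrite mulr_ge0// mulr_ge0// sqr_ge0.
  by rewrite mulrAC [RHS]sqrtrM ?mulr_ge0// sqrtr_sqr ger0_norm.
rewrite -poweR_EFin; apply: gt0_ler_poweR => //.
- by rewrite in_itv /= leey andbT integral_ge0// => t _; exact: poweR_ge0.
- by rewrite in_itv /= leey andbT lee_fin mulr_ge0// mulr_ge0// sqr_ge0.
rewrite EFinM -mE -(integral_cst _ (@measurable_box n r)) [X in (_ <= X)%E]integral_mkcond.
(* Both integrals are suprema over simple functions below the integrand. Comparing these suprema
   asks nothing about measurability of the gradient. *)
rewrite ge0_integralTE; last by move=> t; exact: poweR_ge0.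
rewrite [X in (_ <= X)%E]ge0_integralTE; last first.
  move=> t; rewrite patchE; case: ifP => // _.
  by rewrite lee_fin mulr_ge0// sqr_ge0.
apply: ereal_sup_le => _ [g /= gf <-]; exists g => //= t; apply: le_trans (gf t) _.
rewrite !patchE; case: ifPn => [|_]; last first.
  rewrite abse0 poweR0r ?pnatr_eq0//; case: ifP => // _.
  by rewrite lee_fin mulr_ge0// sqr_ge0.
rewrite inE /= => Dt.
have -> : t \in @box n r.
  rewrite inE => i; have := Dr _ Dt; apply: le_trans.
  by have := coord_le (rv_of_tuple t) i; rewrite mxE.
rewrite lee_fin powR_mulrn// ger0_norm ?sqrtr_ge0//.
rewrite sqr_sqrtr ?sumr_ge0//; last by move=> i _; rewrite sqr_ge0.
apply: le_trans (ler_sum _ (_ : forall i, true -> _ <= L ^+ 2)) _.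
  move=> i _; rewrite mxE -real_normK ?num_real// ler_sqr ?nnegrE//.
  exact: uL.
by rewrite sumr_const card_ord mulr_natl.
Qed.
End gradient_norm.

(** * A priori bounds *)

Section blow_up.
Context {R : realType} {n : nat}.
Local Notation V := 'rV[R]_n.
Implicit Types (x y z nu : V) (u w f : V -> R) (D K : set V).

Lemma compact_sub_cube K : compact K -> exists2 A : R, 0 < A & K `<=` cube 0 A.
Proof.
move=> cK; have [|A A0 KA] := @compact_ubound R n K (fun x => `|x|) cK.
  by move=> x _; exact: norm_continuous.
by exists A => // x Kx; rewrite /cube /= subr0; exact: KA.
Qed.

(** In coordinates zoomed by s the constant C becomes C s: the paraboloids flatten to a hyperplane
    as s tends to 0. *)
Lemma touching_scaled D C nu x c y (s : R) : 0 < s ->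
  touching_paraboloids D C (x + s *: c) nu -> s * `|y - c| < C^-1 ->
  (C * s * nsq (y - c) < dot nu (y - c) -> D (x + s *: y)) /\
  (dot nu (y - c) < - (C * s * nsq (y - c)) -> ~ D (x + s *: y)).
Proof.
move=> s0 [_ H] sy.
have E : x + s *: y - (x + s *: c) = s *: (y - c).
  by apply/rowP => i; rewrite !mxE; ring.
have [] := H (x + s *: y); first by rewrite E normrZ gtr0_norm.
rewrite E nsqZ dotZr => H1 H2; split => Hy.
  apply: contrapT => /H2.
  rewrite (_ : C * _ = s * (C * s * nsq (y - c))); last by ring.
  by rewrite ler_pM2l// leNgt Hy.
move=> /H1.
rewrite (_ : - C * _ = s * - (C * s * nsq (y - c))); last by ring.
by rewrite ler_pM2l// leNgt Hy.
Qed.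

Variables (p B : R) (D : set V).
Hypotheses (n2 : (2 <= n)%N) (p1 : 1 < p) (pn : p * (n%:R - 2) < n%:R + 2).
Hypothesis hD : bounded_smooth_domain D.
Variables (x : nat -> V) (s : nat -> R) (v g : nat -> V -> R).
Hypothesis Dx : forall k, D (x k).
Hypothesis s0 : forall k, 0 < s k <= k.+1%:R^-1.
Hypothesis vL : forall k, lip B (v k).
Hypothesis v01 : forall k y, 0 <= v k y <= 1.
Hypothesis v1 : forall k, v k 0 = 1.
Hypothesis vD : forall k y, ~ D (x k + s k *: y) -> v k y = 0.
Hypothesis Lv : forall k, Lap [set y | D (x k + s k *: y)] (v k) (g k).
Hypothesis gv : forall k y, D (x k + s k *: y) -> `|g k y - - v k y `^ p| <= k.+1%:R^-1.

Let oD : open D. Proof. by case: hD. Qed.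
Let np : 0 < n%:R :> R. Proof. by rewrite ltr0n; exact: leq_trans n2. Qed.
Let Dk k : set V := [set y | D (x k + s k *: y)].

(** Either the rescaled domains eventually contain every cube and the limit solves the equation in
    the space, or boundary points stay within distance A of 0, the domains converge to a half-space
    and the limit is a translated [half_solution]. The value 1 at 0 contradicts the Liouville
    theorem in both cases. *)
Lemma no_blow_up : False.
Proof.
have [C [C0 HC]] := boundary_touching hD.
have [F [FU FN]] := nat_ultrafilter.
have FP : ProperFilter F by exact: ultra_proper.
have inv (e : R) : 0 < e -> \forall k \near F, k.+1%:R^-1 < e.
  by move=> e0; apply: FN; exact: (near_infty_natSinv_lt (PosNum e0)).
have [||w [wl wL _ wu]] := @ultra_fun R n F FU v 1 B => //.
  by move=> k y; have /andP[? ?] := v01 k y; rewrite ger0_norm.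
have w01 y : 0 <= w y <= 1 by exact: (ultra_unit (wl y) (fun k => v01 k y)).
have w1 : w 0 = 1.
  apply/eqP/negPn/negP => w1; have e0 : 0 < `|1 - w 0|.
    by rewrite normr_gt0 subr_eq0 eq_sym.
  by have [k] := filter_ex (wl 0 _ e0); rewrite v1 ltxx.
have LD D' : (forall K, compact K -> K `<=` D' -> \forall k \near F, K `<=` Dk k) ->
    Lap D' w (fun y => - w y `^ p).
  move=> H; apply: (@Lap_powR_ultra _ _ F _ p D' v w) => //; first exact: ltW.
  move=> K cK KD' e e0; apply: filterS2 (H K cK KD') (inv e e0) => k KDk ke.
  exists (Dk k), (g k); split => [||y Ky]; [exact: Lv|exact: KDk|].
  by apply: le_trans (ltW ke); apply: gv; exact: KDk.
have [full|] := pselect (forall A, \forall k \near F, cube 0 A `<=` Dk k).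
  have LT : Lap setT w (fun y => - w y `^ p).
    apply: LD => K /compact_sub_cube[A _ KA] _.
    by apply: filterS (full A) => k; exact: subset_trans.
  have := liouville_whole n2 p1 pn wL w01 LT 0; rewrite w1 => /eqP.
  by rewrite oner_eq0.
move=> /existsNP[A nA].
have ev : \forall k \near F, ~ (cube 0 A `<=` Dk k).
  by have [//|] := in_ultra_setVsetC (fun k => cube 0 A `<=` Dk k) FU.
have [A0|A0] := ltP A 0.
  have [k] := filter_ex ev; apply; move=> y; rewrite /cube /= subr0 => yA.
  by have := le_lt_trans yA A0; rewrite ltNge normr_ge0.
have sk k : 0 < s k by have /andP[] := s0 k.
(* Boundary points in rescaled coordinates with their inner normals; the default 0 concerns the
   indices whose domain contains the cube. *)
have bp k : exists c nu, ~ (cube 0 A `<=` Dk k) ->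
    cube 0 A c /\ touching_paraboloids D C (x k + s k *: c) nu.
  have [sub|nsub] := pselect (cube 0 A `<=` Dk k); first by exists 0, 0.
  have [z zA nDz] : exists2 z, cube 0 A z & ~ Dk k z.
    by apply: contrapT => H; apply: nsub => z zA; apply: contrapT => nDz; apply: H; exists z.
  have [b Bb [xb _]] := segment_boundary oD (Dx k) nDz.
  have [nu Hnu] := HC _ Bb.
  exists ((s k)^-1 *: (b - x k)), nu => _; split; last first.
    by rewrite scalerA divff ?gt_eqF// scale1r addrC subrK.
  rewrite /cube /= subr0 normrZ normfV (gtr0_norm (sk k)) mulrC ler_pdivrMr// distrC.
  apply: le_trans xb _; rewrite opprD addrA subrr sub0r normrN normrZ (gtr0_norm (sk k)).
  by rewrite mulrC ler_pM2r//; move: zA; rewrite /cube /= subr0.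
have [c /choice[nu Hc]] := choice bp.
have evc : \forall k \near F, cube 0 A (c k).
  by apply: filterS ev => k /Hc[].
have [c' c'A cl] := ultra_rV (@cube_compact _ _ 0 A) evc.
have evnu : \forall k \near F, cube 0 1 (nu k).
  apply: filterS ev => k /Hc[_ [nu1 _]]; rewrite /cube /= subr0; exact: norm_unit.
have [nu' nu'1 nul] := ultra_rV (@cube_compact _ _ 0 1) evnu.
have n'1 : `|nu'| <= 1 by move: nu'1; rewrite /cube /= subr0.
have nsq1 : nsq nu' = 1.
  apply/eqP/negPn/negP => nu1; have e0 : 0 < `|1 - nsq nu'| / (2 * n%:R).
    by rewrite divr_gt0 ?mulr_gt0// normr_gt0 subr_eq0 eq_sym.
  have [k [/= h1 [/= h2 /Hc[_ [h3 _]]]]] := filter_ex (filterI (nul _ e0) (filterI evnu ev)).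
  move: h1; rewrite ltr_pdivlMr ?mulr_gt0//; apply/negP; rewrite -leNgt -[X in `|X - _|]h3.
  have -> : nsq (nu k) - nsq nu' = dot (nu k - nu') (nu k + nu').
    by rewrite dotBl !dotDr /nsq (dotC nu'); ring.
  apply: le_trans (dot_le _ _) _.
  have nn : `|nu k + nu'| <= 2.
    by apply: le_trans (ler_normD _ _) _; move: h2; rewrite /cube /= subr0; lra.
  have nn0 : 0 <= n%:R * `|nu k - nu'| by rewrite mulr_ge0// ltW.
  have := ler_wpM2l nn0 nn; lra.
(* On a bounded cube the rescaled domain agrees with the half-space nu'.(y - c') > 0 up to a layer
   of width e on each side of its boundary. *)
have side (A' e : R) : 0 < e -> 0 <= A' -> \forall k \near F, forall y, cube 0 A' y ->
    (e < dot nu' (y - c') -> Dk k y) /\ (dot nu' (y - c') < - e -> ~ Dk k y).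
  move=> e0 A'0; pose q := A' + A + 1.
  have q0 : 0 < q by rewrite /q; lra.
  pose d := e / (4 * n%:R * q).
  have d0 : 0 < d by rewrite divr_gt0// !mulr_gt0.
  have nd1 : n%:R * d * q = e / 4 by rewrite /d; field; rewrite !gt_eqF.
  clearbody d.
  have d1 : 0 < e / (2 * (C * n%:R * q ^+ 2)).
    by rewrite divr_gt0// !mulr_gt0// exprn_gt0.
  have d2 : 0 < C^-1 / q by rewrite divr_gt0// invr_gt0.
  apply: filterS2 (filterI (filterI evc evnu) (filterI (cl _ d0) (nul _ d0)))
    (filterI ev (filterI (inv _ d1) (inv _ d2))).
  move=> k [[ca na] [cd nd]] [/Hc[_ T] [s1 s2]] y yA.
  have /andP[sp sk1] := s0 k.
  move: (yA) (ca) (na); rewrite /cube /= !subr0 => yA1 ca1 na1.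
  have yc : `|y - c k| <= q by apply: le_trans (ler_normB _ _) _; rewrite /q; lra.
  have dd : `|dot (nu k) (y - c k) - dot nu' (y - c')| <= e / 2.
    have -> : dot (nu k) (y - c k) - dot nu' (y - c') =
        dot (nu k - nu') (y - c k) - dot nu' (c k - c').
      by rewrite !dotBl !dotBr; ring.
    apply: le_trans (ler_normB _ _) _.
    have h1 : `|dot (nu k - nu') (y - c k)| <= n%:R * d * q.
      apply: le_trans (dot_le _ _) _; rewrite -!mulrA ler_wpM2l ?(ltW np)//.
      exact: (ler_pM (normr_ge0 _) (normr_ge0 _) (ltW nd) yc).
    have h2 : `|dot nu' (c k - c')| <= n%:R * d * q.
      apply: le_trans (dot_le _ _) _; rewrite -!mulrA ler_wpM2l ?(ltW np)// (mulrC `|nu'|).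
      have n'q : `|nu'| <= q by apply: le_trans n'1 _; rewrite /q; lra.
      exact: (ler_pM (normr_ge0 _) (normr_ge0 _) (ltW cd) n'q).
    lra.
  have sy : s k * `|y - c k| < C^-1.
    apply: le_lt_trans (_ : s k * q < _); first by rewrite ler_pM2l.
    by rewrite -ltr_pdivlMr//; exact: le_lt_trans s2.
  have Cs : C * s k * nsq (y - c k) <= e / 2.
    have := nsq_le (y - c k) => h1.
    have h2 : n%:R * `|y - c k| ^+ 2 <= n%:R * q ^+ 2.
      by rewrite ler_wpM2l ?(ltW np)// ler_sqr ?nnegrE ?(ltW q0).
    have h3 : C * s k * nsq (y - c k) <= C * s k * (n%:R * q ^+ 2).
      by rewrite ler_pM2l ?mulr_gt0//; exact: le_trans h1 h2.
    apply: le_trans h3 _.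
    have : s k <= e / (2 * (C * n%:R * q ^+ 2)) by apply: le_trans sk1 (ltW s1).
    rewrite ler_pdivlMr ?mulr_gt0 ?exprn_gt0//; lra.
  have [S1 S2] := touching_scaled sp T sy.
  move: dd; rewrite ler_norml => /andP[dd1 dd2].
  by split => H; [apply: S1|apply: S2]; lra.
have neg y : dot nu' y < 0 -> w (c' + y) = 0.
  move=> y0; apply/eqP/negPn/negP => wy; have e0 : 0 < `|w (c' + y)| by rewrite normr_gt0.
  have e1 : 0 < - dot nu' y / 2 by lra.
  have [k [/= h1 h2]] := filter_ex (filterI (wl (c' + y) _ e0) (side `|c' + y| _ e1 (normr_ge0 _))).
  have [|_ H] := h2 (c' + y); first by rewrite /cube /= subr0.
  move: h1; rewrite vD ?sub0r ?normrN ?ltxx//.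
  by apply: H; rewrite addrC addKr; lra.
have Lw : Lap [set y | 0 < dot nu' y] (fun y => w (c' + y)) (fun y => - w (c' + y) `^ p).
  suff L : Lap [set z | 0 < dot nu' (z - c')] w (fun y => - w y `^ p).
    by apply: (Lap_sub (@Lap_translate _ _ _ _ _ c' L)) => y; rewrite /= addrC addKr.
  apply: LD => K cK Kp; have [K0|K0] := pselect (K !=set0); last first.
    by apply: filterE => k y Ky; exfalso; apply: K0; exists y.
  have [z Kz zmin] := @compact_min _ _ K (dot nu') cK K0 (fun y _ => @cont_dot _ _ nu' y).
  have [A' A'0 KA] := compact_sub_cube cK.
  have m0 : 0 < dot nu' (z - c') / 2 by rewrite divr_gt0//; exact: Kp.
  apply: filterS (side A' _ m0 (ltW A'0)) => k H y Ky.
  have [h1 _] := H _ (KA _ Ky); apply: h1.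
  by have := Kp _ Kz; have := zmin _ Ky; rewrite /= !dotBr; lra.
have HS : half_solution nu' p B (fun y => w (c' + y)).
  split => //.
  - by move=> y z; apply: le_trans (wL _ _) _; rewrite opprD addrACA subrr add0r.
  (* [neg] concerns the open half-space; moving y by - t nu' enters it, and the Lipschitz bound
     carries the value 0 to the hyperplane. *)
  - move=> y y0; apply/eqP/negPn/negP => wy; have e0 : 0 < `|w (c' + y)| by rewrite normr_gt0.
    have B1 : 0 < `|B| + 1 by rewrite ltr_wpDl.
    pose t := `|w (c' + y)| / (2 * (`|B| + 1)).
    have t0 : 0 < t by rewrite divr_gt0// mulr_gt0.
    have := wL (c' + y) (c' + (y - t *: nu')).
    rewrite (neg (y - t *: nu')); last by rewrite dotBr dotZr -/(nsq nu') nsq1; lra.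
    rewrite subr0 opprD addrACA subrr add0r opprB addrCA subrr addr0 normrZ gtr0_norm//.
    apply/negP; rewrite -ltNge.
    have h1 : t * `|nu'| <= t by rewrite ler_piMr// ltW.
    have h2 : B * (t * `|nu'|) <= `|B| * t.
      apply: le_trans (ler_wpM2r _ (ler_norm B)) _; first by rewrite mulr_ge0// ltW.
      by rewrite ler_wpM2l.
    have h3 : t * (2 * (`|B| + 1)) = `|w (c' + y)| by rewrite /t divfK// gt_eqF// mulr_gt0.
    lra.
have := liouville_half nsq1 p1 n2 pn HS (- c'); rewrite subrr w1 => /eqP.
by rewrite oner_eq0.
Qed.
End blow_up.

Section states.
Context {R : realType} {n : nat}.
Local Notation V := 'rV[R]_n.
Implicit Types (x y z : V) (u w f : V -> R).

Variables (D : set V) (a b alpha p : R) (h : V -> R -> V -> R).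

(* K stands for the Kirchhoff coefficient a + t b |grad u|_2^(2 alpha), X for
   the gradient of the solution, w for its extension by 0 and xs for a point
   where it is maximal. *)
Record state (c t : R) w (M K : R) (X : V -> V) (xs : V) : Prop := State {
  state_t : 0 <= t <= 1;
  state_cont : continuous w;
  state_out : forall x, ~ D x -> w x = 0;
  state_pos : forall x, D x -> 0 < w x;
  state_in : D xs;
  state_max : w xs = M;
  state_le : forall x, w x <= M;
  state_K : a <= K;
  state_eq : Lap D w (fun x => - ((w x `^ p + t * h x (w x) (X x)) / K));
  state_grad : forall L, 0 <= L -> lip L w -> K <= a + b * (c * L) `^ (2 * alpha) }.

Lemma extension_continuous u : open D -> {within closure D, continuous u} ->
  (forall x, boundary D x -> u x = 0) ->
  continuous (fun x => if x \in D then u x else 0).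
Proof.
move=> oD /subspace_continuousP cu u0 x.
have [cx|ncx] := pselect (closure D x); last first.
  have H : \forall y \near x, ~ closure D y.
    by apply: open_nbhs_nbhs; split => //; apply: closed_openC; exact: closed_closure.
  have xD : x \in D = false by apply/negP; rewrite inE => /subset_closure.
  apply/(cvgrPdist_lt (FF := nbhs_filter x)) => e e0; apply: filterS H => y cy.
  rewrite xD ifF ?subrr ?normr0//.
  by apply/negP; rewrite inE => /subset_closure.
have ux : (if x \in D then u x else 0) = u x.
  have [//|nDx] := boolP (x \in D); rewrite u0//; split => // Dx.
  by move/negP: nDx; apply; rewrite inE; exact: (interior_subset Dx).
have := cu x cx => /cvgrPdist_lt H.
apply/(cvgrPdist_lt (FF := nbhs_filter x)) => e e0; rewrite ux.
have [Dx|nDx] := boolP (x \in D).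
  have Dn : \forall y \near x, D y by apply: open_nbhs_nbhs; split => //; rewrite inE in Dx.
  have := H e e0; rewrite near_withinE => H1; apply: filterS2 H1 Dn => y + Dy.
  by rewrite (mem_set Dy); apply; exact: subset_closure.
have := H e e0; rewrite near_withinE; apply: filterS => y.
have [Dy|_ _] := boolP (y \in D); first by apply; apply: subset_closure; rewrite inE in Dy.
by rewrite -ux (negbTE nDx) subrr normr0.
Qed.

(** From here on |grad u|_2 enters only through [state_grad]: a Lipschitz constant L of w bounds the
    partial derivatives, hence the norm by c L, hence K, uniformly in t <= 1. *)
Lemma solution_state : bounded_smooth_domain D -> 0 <= b -> 0 < alpha ->
  exists2 c : R, 0 < c & forall t u, 0 <= t <= 1 -> solution D a b alpha p h t u ->
    0 < a -> exists w M K X xs, state c t w M K X xs /\ supnorm D u = M%:E.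
Proof.
move=> [oD _ [x0 Dx0] bD _] b0 alpha0; have [c c0 Hc] := grad_L2norm_le bD.
exists c => // t u t01 [[C2 cu u0] up gfin eq] a0.
pose w x := if x \in D then u x else 0.
have wE x : D x -> w x = u x by move=> Dx; rewrite /w mem_set.
have cw : continuous w by exact: extension_continuous.
have wout x : ~ D x -> w x = 0 by move=> nDx; rewrite /w memNset.
have [r Dr] : exists r : R, D `<=` cube 0 r.
  have [r [_ Hr]] := bD; exists (r + 1) => x Dx; rewrite /cube /= subr0.
  by apply: (Hr (r + 1)) => //; rewrite ltrDl.
have [xs _ wmax] := @compact_max _ _ (cube 0 r) w (@cube_compact _ _ 0 r)
   (ex_intro _ x0 (Dr _ Dx0)) (fun x _ => cw x).
have wxs : 0 < w xs by apply: lt_le_trans (wmax _ (Dr _ Dx0)); rewrite wE// up.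
have Dxs : D xs by apply: contrapT => /wout wx; move: wxs; rewrite wx ltxx.
have wle x : w x <= w xs.
  by have [Dx|/wout ->] := pselect (D x); [apply: wmax; exact: Dr|exact: ltW].
pose K := a + t * b * fine (grad_L2norm D u) `^ (2 * alpha).
have aK : a <= K by rewrite lerDl mulr_ge0 ?powR_ge0// mulr_ge0//; have /andP[] := t01.
have K0 : 0 < K by exact: lt_le_trans aK.
exists w, (w xs), K, (grad u), xs; split; first split => //.
- by move=> x Dx; rewrite wE// up.
- have L : Lap D u (laplacian u) by apply: Lap_lap => x Dx; exact: C2_lap oD C2 Dx.
  apply: (Lap_eq L) => // x Dx; rewrite wE//; split => //.
  by rewrite -eq// -/K; field; rewrite gt_eqF.
- move=> L L0 wL.
  have gL : fine (grad_L2norm D u) <= c * L.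
    have := Hc u L L0.
    have H x i : D x -> `|partial i u x| <= L.
      move=> Dx; apply: (@partial_le _ _ D) => //.
        by have [_ H] := C2 [::] isT; exact: H.
      by move=> y Dy; have := wL y x; rewrite !wE.
    move=> /(_ H) gL; have g0 : (0 <= grad_L2norm D u)%E by exact: Lnorm_ge0.
    by rewrite -lee_fin fineK// ge0_fin_numE.
  have g0 : 0 <= fine (grad_L2norm D u) by rewrite fine_ge0//; exact: Lnorm_ge0.
  rewrite /K lerD2l -mulrA.
  apply: le_trans (_ : b * fine (grad_L2norm D u) `^ (2 * alpha) <= _).
    by rewrite ler_piMl ?mulr_ge0 ?powR_ge0//; have /andP[] := t01.
  rewrite ler_wpM2l// ge0_ler_powR ?nnegrE ?mulr_ge0 ?(ltW alpha0) ?(ltW c0)//.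
- apply/eqP; rewrite eq_le; apply/andP; split.
    apply: ge_ereal_sup => _ [x Dx <-]; rewrite lee_fin -wE// ger0_norm; first exact: wle.
    by rewrite wE// ltW// up.
  apply: ereal_sup_ubound; exists xs => //; rewrite -wE// ger0_norm//; exact: ltW.
Qed.
End states.

Section powers.
Context {R : realType}.

Lemma powR_large (r A : R) : 0 < r -> exists2 S : R, 1 <= S &
  forall M, S < M -> A < M `^ r.
Proof.
move=> r0; exists (Num.max 1 (`|A| `^ r^-1)); first by rewrite le_max lexx.
move=> M; rewrite gt_max => /andP[M1 AM]; apply: le_lt_trans (ler_norm A) _.
rewrite -[ltLHS]powRr1// -(mulVf (lt0r_neq0 r0)) powRrM.
by rewrite gt0_ltr_powR ?nnegrE ?powR_ge0// ltW// (lt_trans _ M1).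
Qed.

Lemma powR_small (r e : R) : 0 < r -> 0 < e -> exists2 s : R, 0 < s &
  forall M, 0 <= M < s -> M `^ r < e.
Proof.
move=> r0 e0; exists (e `^ r^-1); first exact: powR_gt0.
move=> M /andP[M0 Ms]; rewrite -[ltRHS](powRr1 (ltW e0)) -(mulVf (lt0r_neq0 r0)) powRrM.
by rewrite gt0_ltr_powR ?nnegrE ?powR_ge0.
Qed.
End powers.

(** * Upper bound by blow-up *)

Section upper_bound.
Context {R : realType} {n : nat}.
Local Notation V := 'rV[R]_n.
Implicit Types (x y z : V) (u w f : V -> R).
Variables (D : set V) (a b alpha p : R) (h : V -> R -> V -> R) (C q c : R).
Hypotheses (n2 : (2 <= n)%N) (hD : bounded_smooth_domain D).
Hypotheses (a0 : 0 < a) (b0 : 0 < b) (alpha0 : 0 < alpha) (alphap : 2 * alpha + 1 < p).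
Hypothesis pn : p * (n%:R - 2) < n%:R + 2.
Hypotheses (C0 : 0 < C) (q1 : 1 < q) (qp : q < p) (c0 : 0 < c).
Hypothesis h_growth : forall x s xi, D x -> 0 < s -> `|h x s xi| <= C * (s + s `^ q).

Let p1 : 1 < p. Proof. by move: alpha0 alphap; lra. Qed.
Let p0 : 0 < p. Proof. exact: lt_trans p1. Qed.
Let n0 : (0 < n)%N. Proof. exact: leq_trans n2. Qed.
Let st := @state R n D a b alpha p h c.

Lemma state_perturbation t w M K X xs x : st t w M K X xs -> 1 <= M -> D x ->
  `|t * h x (w x) (X x)| <= 2 * C * M `^ q.
Proof.
move=> S M1 Dx; have wx := state_pos S Dx; have wM := state_le S x.
have /andP[t0 t1] := state_t S.
rewrite normrM (ger0_norm t0); apply: le_trans (ler_piMl (normr_ge0 _) t1) _.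
apply: le_trans (h_growth _ Dx wx) _.
rewrite (mulrC 2) -mulrA ler_wpM2l ?(ltW C0)//.
have h1 : w x `^ q <= M `^ q.
  by rewrite ge0_ler_powR ?nnegrE ?(ltW wx)//; move: q1 M1; lra.
have h2 : M <= M `^ q by apply: le1r_powR => //; exact: ltW.
lra.
Qed.

Lemma state_source t w M K X xs x : st t w M K X xs -> 1 <= M -> D x ->
  `|w x `^ p + t * h x (w x) (X x)| <= (1 + 2 * C) * M `^ p.
Proof.
move=> S M1 Dx; have wx := state_pos S Dx; have wM := state_le S x.
apply: le_trans (ler_normD _ _) _.
have h1 : `|w x `^ p| <= M `^ p.
  rewrite ger0_norm ?powR_ge0// ge0_ler_powR ?nnegrE ?(ltW wx) ?(ltW p0)//.
  by move: M1; lra.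
have h2 := state_perturbation S M1 Dx.
have h3 : 2 * C * M `^ q <= 2 * C * M `^ p.
  by rewrite ler_wpM2l ?mulr_ge0 ?(ltW C0)// ler_powR// ltW.
lra.
Qed.

(** The Laplacian of w is at most of order M^p / K, so the restriction on d makes the second term of
    [global_lipschitz], d sup |Laplacian w|, at most of the order of the first, M / d. *)
Lemma state_lipschitz : exists B d1 : R, [/\ 0 < B, 0 < d1 &
  forall t w M K X xs d, st t w M K X xs -> 1 <= M -> 0 < d <= d1 ->
    d ^+ 2 <= K / M `^ (p - 1) -> lip (B * (M / d)) w].
Proof.
have [B [d1 [B0 d10 H]]] := global_lipschitz n0 hD.
exists (B * (2 + 2 * C)), d1; split => //.
  by rewrite mulr_gt0// addr_gt0// mulr_gt0.
move=> t w M K X xs d S M1 /andP[d0 dd1] dK.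
have M0 : 0 < M by exact: lt_le_trans M1.
have K0 : 0 < K by exact: lt_le_trans (state_K S).
have Mp : 0 < M `^ (p - 1) by exact: powR_gt0.
have Md : 0 < M / d by rewrite divr_gt0.
pose G := (1 + 2 * C) * M `^ p / K.
have cc : 0 < 1 + 2 * C by rewrite addr_gt0// mulr_gt0.
have G0 : 0 < G by rewrite divr_gt0// mulr_gt0// powR_gt0.
have dG : d * G <= (1 + 2 * C) * (M / d).
  rewrite ler_pdivlMr// in dK.
  rewrite /G -(mulr_powRB1 (ltW M0) p0).
  have -> : d * ((1 + 2 * C) * (M * M `^ (p - 1)) / K) =
    (1 + 2 * C) * (M / d) * (d ^+ 2 * M `^ (p - 1) / K) by field; rewrite !gt_eqF.
  apply: ler_piMr; first by rewrite mulr_ge0 ?(ltW cc) ?(ltW Md).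
  by rewrite ler_pdivrMr// mul1r.
have := H w _ M G d (state_cont S) (state_out S) (state_eq S) _ _ G0 M0 _.
have wM x : `|w x| <= M.
  have [Dx|nDx] := pselect (D x); last by rewrite (state_out S nDx) normr0 ltW.
  by rewrite ger0_norm ?(state_le S)//; exact: ltW (state_pos S Dx).
move=> /(_ wM) L x y; apply: le_trans (L _ _ x y) _.
- move=> z Dz; rewrite normrN normrM normfV (gtr0_norm K0) ler_pM2r ?invr_gt0//.
  exact: state_source S M1 Dz.
- by rewrite d0.
rewrite ler_wpM2r// -mulrA ler_pM2l//; lra.
Qed.

Lemma kappa_small (e : R) : 0 < e -> exists2 S : R, 1 <= S &
  forall t w M K X xs, st t w M K X xs -> S < M -> K / M `^ (p - 1) < e.
Proof.
move=> e0; have [B [d1 [B0 d10 H]]] := state_lipschitz.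
pose e' := Num.min e (d1 ^+ 2).
have e'0 : 0 < e' by rewrite lt_min e0 exprn_gt0.
pose d := Num.sqrt e'.
have d0 : 0 < d by rewrite sqrtr_gt0.
have dd : d <= d1.
  rewrite -(ler_pXn2r (n:=2)) ?nnegrE ?(ltW d0) ?(ltW d10)//.
  by rewrite sqr_sqrtr ?(ltW e'0)// ge_min lexx orbT.
have d2 : d ^+ 2 = e' by rewrite sqr_sqrtr// ltW.
pose A := a + b * (c * (B / d)) `^ (2 * alpha).
(* The assumption 2 alpha + 1 < p acts here: A M^(2 alpha) < e' M^(p - 1) for M large. *)
have delta0 : 0 < p - 1 - 2 * alpha by move: alphap; lra.
have [S S1 HS] := powR_large (A / e') delta0.
exists S => // t w M K X xs hs SM.
have M1 : 1 <= M by exact: le_trans (ltW SM).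
have M0 : 0 < M by exact: lt_le_trans M1.
have Mp : 0 < M `^ (p - 1) by exact: powR_gt0.
have M2a : 1 <= M `^ (2 * alpha).
  have := @ler_powR _ M M1 0 (2 * alpha); rewrite powRr0; apply.
  by rewrite mulr_ge0// ltW.
rewrite ltNge; apply/negP => eK.
have eK' : d ^+ 2 <= K / M `^ (p - 1) by rewrite d2; apply: le_trans eK; rewrite ge_min lexx.
have Md : 0 < M / d by rewrite divr_gt0.
have L := H _ _ _ _ _ _ d hs M1 _ eK'; rewrite d0 dd in L.
have BM : 0 <= B * (M / d) by rewrite mulr_ge0// ltW.
have KA := state_grad hs BM (L isT).
have KA' : K <= A * M `^ (2 * alpha).
  apply: le_trans KA _.
  have -> : c * (B * (M / d)) = c * (B / d) * M by ring.
  have cBd : 0 <= c * (B / d) by apply: mulr_ge0; [exact: ltW|apply: divr_ge0; exact: ltW].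
  rewrite (powRM _ cBd (ltW M0)).
  have := ler_wpM2l (ltW a0) M2a; rewrite /A; lra.
have := HS _ SM; rewrite powRB; last by rewrite (gt_eqF M0) implybT.
rewrite ltr_pdivlMr ?powR_gt0// mulrAC ltr_pdivrMr// => /(le_lt_trans KA').
by apply/negP; rewrite -leNgt mulrC -ler_pdivlMr// -d2.
Qed.

(** With s^2 = K / M^(p - 1), the function w (xs + s y) / M solves the normalized equation up to t h
    / M^p, which is at most 2 C M^(q - p). The bound of [state_lipschitz] for d = s becomes the
    constant B. *)
Lemma rescale : exists B : R, forall e : R, 0 < e -> exists2 S : R, 0 < S &
  forall t w M K X xs, st t w M K X xs -> S < M -> exists s v g,
   [/\ 0 < s <= e, lip B v, forall y, 0 <= v y <= 1, v 0 = 1 &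
     forall y, ~ D (xs + s *: y) -> v y = 0] /\
   (Lap [set y | D (xs + s *: y)] v g /\
     forall y, D (xs + s *: y) -> `|g y - - v y `^ p| <= e).
Proof.
have [B [d1 [B0 d10 H]]] := state_lipschitz.
exists B => e e0; pose m := Num.min e d1.
have m0 : 0 < m by rewrite lt_min e0.
have [S1 S11 HS1] := kappa_small (exprn_gt0 2 m0).
have pq : 0 < p - q by rewrite subr_gt0.
have [S2 S21 HS2] := powR_large (2 * C / e) pq.
exists (Num.max S1 S2); first by rewrite lt_max (lt_le_trans _ S11).
move=> t w M K X xs hs; rewrite gt_max => /andP[/(HS1 _ _ _ _ _ _ hs) kM S2M].
have M1 : 1 <= M by exact: le_trans (ltW S2M).
have M0 : 0 < M by exact: lt_le_trans M1.
have K0 : 0 < K by exact: lt_le_trans (state_K hs).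
have Mp : 0 < M `^ (p - 1) by exact: powR_gt0.
pose k := K / M `^ (p - 1); have k0 : 0 < k by rewrite divr_gt0.
pose s := Num.sqrt k; have s0 : 0 < s by rewrite sqrtr_gt0.
have s2 : s ^+ 2 = k by rewrite sqr_sqrtr// ltW.
have sm : s <= m.
  by rewrite -(ler_pXn2r (n:=2)) ?nnegrE ?(ltW s0) ?(ltW m0)// s2 ltW.
have se : s <= e by apply: le_trans sm _; rewrite ge_min lexx.
have sd : s <= d1 by apply: le_trans sm _; rewrite ge_min lexx orbT.
have wL : lip (B * (M / s)) w.
  by apply: (H _ _ _ _ _ _ s hs M1); rewrite ?s0// s2.
have w0 x : 0 <= w x.
  by have [/(state_pos hs)/ltW//|/(state_out hs) ->] := pselect (D x).
exists s, (fun y => M^-1 * w (xs + s *: y)), (fun y => M^-1 * (s ^+ 2 *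
  - ((w (xs + s *: y) `^ p + t * h (xs + s *: y) (w (xs + s *: y)) (X (xs + s *: y))) / K))).
split; [split|split].
- by rewrite s0.
- move=> y z; rewrite -mulrBr normrM gtr0_norm ?invr_gt0// mulrC ler_pdivrMr//.
  apply: le_trans (wL _ _) _; rewrite opprD addrACA subrr add0r -scalerBr normrZ gtr0_norm//.
  by apply: le_eq; field; rewrite gt_eqF.
- move=> y; rewrite mulr_ge0 ?invr_ge0 ?(ltW M0)//= mulrC ler_pdivrMr// mul1r.
  exact: state_le hs _.
- by rewrite scaler0 addr0 (state_max hs) mulVf// gt_eqF.
- by move=> y /(state_out hs) ->; rewrite mulr0.
- exact: (LapZ M^-1 (@Lap_scale _ _ _ _ _ xs s (state_eq hs))).
move=> y Dy; set x := xs + s *: y in Dy *.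
have -> : M^-1 * (s ^+ 2 * - ((w x `^ p + t * h x (w x) (X x)) / K)) - - (M^-1 * w x) `^ p
   = - (t * h x (w x) (X x) / M `^ p).
  rewrite s2 /k powRM ?invr_ge0 ?(ltW M0)// -powR_inv1 ?(ltW M0)// -powRrM mulN1r.
  rewrite powR_inv1 ?(ltW M0)// powRN -(mulr_powRB1 (ltW M0) p0).
  by field; rewrite !gt_eqF.
rewrite normrN normrM normfV (ger0_norm (powR_ge0 _ _)) ler_pdivrMr ?powR_gt0//.
apply: le_trans (state_perturbation hs M1 Dy) _.
have := HS2 _ S2M; rewrite powRB; last by rewrite (gt_eqF M0) implybT.
by rewrite ltr_pdivlMr ?powR_gt0// mulrAC ltr_pdivrMr// (mulrC _ e) => /ltW.
Qed.

Lemma upper_bound : exists2 S : R, 0 < S &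
  forall t w M K X xs, st t w M K X xs -> M <= S.
Proof.
apply: contrapT => nS.
have big (S : R) : 0 < S -> exists t w M K X xs, st t w M K X xs /\ S < M.
  move=> S0; apply: contrapT => H; apply: nS; exists S => // t w M K X xs hs.
  by rewrite leNgt; apply/negP => SM; apply: H; exists t, w, M, K, X, xs.
have [B HB] := rescale.
(* Centre, scale, rescaled solution and its Laplacian, packed so that one choice yields the whole
   sequence. *)
have seq k : exists z : V * R * (V -> R) * (V -> R), D z.1.1.1 /\
   [/\ 0 < z.1.1.2 <= k.+1%:R^-1, lip B z.1.2, forall y, 0 <= z.1.2 y <= 1, z.1.2 0 = 1 &
     forall y, ~ D (z.1.1.1 + z.1.1.2 *: y) -> z.1.2 y = 0] /\
   (Lap [set y | D (z.1.1.1 + z.1.1.2 *: y)] z.1.2 z.2 /\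
     forall y, D (z.1.1.1 + z.1.1.2 *: y) -> `|z.2 y - - z.1.2 y `^ p| <= k.+1%:R^-1).
  have [|S S0 HS] := HB k.+1%:R^-1; first by rewrite invr_gt0.
  have [t [w [M [K [X [xs [hs SM]]]]]]] := big S S0.
  have [s [v [g Hg]]] := HS _ _ _ _ _ _ hs SM.
  by exists (xs, s, v, g); split => //; exact: state_in hs.
have [z Hz] := choice seq.
apply: (@no_blow_up R n p B D n2 p1 pn hD (fun k => (z k).1.1.1) (fun k => (z k).1.1.2)
  (fun k => (z k).1.2) (fun k => (z k).2)) => k; have [? [[? ? ? ? ?] [? ?]]] := Hz k => //.
Qed.
End upper_bound.

(** * Lower bound by comparison with the first eigenvalue *)

Section lower_bound.
Context {R : realType} {n : nat}.
Local Notation V := 'rV[R]_n.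
Implicit Types (x y z : V) (u w f : V -> R).
Variables (D : set V) (a b alpha p : R) (h : V -> R -> V -> R) (lambda c : R).
Hypotheses (n0 : (0 < n)%N) (hD : bounded_smooth_domain D).
Hypotheses (a0 : 0 < a) (p1 : 1 < p) (lambda0 : 0 < lambda).
Hypothesis h_lim : forall e : R, 0 < e -> exists2 d : R, 0 < d &
  forall x s xi, D x -> 0 < s < d -> `|h x s xi / s - lambda| < e.
Hypothesis hlambda : lambda < a * lambda1 D.

Let p0 : 0 < p. Proof. exact: lt_trans p1. Qed.
Let oD : open D. Proof. by case: hD. Qed.
Let st := @state R n D a b alpha p h c.

(** Here v = w / M and mu = t lambda / K. For M small, w^p / M <= M^(p - 1) is small and h / w is
    close to lambda, so v solves the eigenvalue equation up to e. *)
Lemma normalize : exists B : R, forall e : R, 0 < e -> exists2 r : R, 0 < r &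
  forall t w M K X xs, st t w M K X xs -> M < r -> exists mu v g,
   [/\ 0 <= mu <= lambda / a, lip B v, forall y, 0 <= v y <= 1, v xs = 1 &
     forall y, ~ D y -> v y = 0] /\
   (Lap D v g /\ forall y, D y -> `|g y - - mu * v y| <= e).
Proof.
have [B [d1 [B0 d10 H]]] := global_lipschitz n0 hD.
(* Bound for the Laplacian of v: lambda / a for mu v and 2 / a for the error, since e1 <= 1. *)
pose G := (lambda + 2) / a; have G0 : 0 < G by rewrite divr_gt0// addr_gt0.
exists (B * (1 / d1 + d1 * G)) => e e0.
pose e1 := Num.min 1 (e * a / 2).
have e10 : 0 < e1 by rewrite lt_min ltr01 divr_gt0// mulr_gt0.
have e11 : e1 <= 1 by rewrite ge_min lexx.
have e1e : 2 * e1 / a <= e.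
  rewrite ler_pdivrMr//; have : e1 <= e * a / 2 by rewrite ge_min lexx orbT.
  lra.
have p10 : 0 < p - 1 by rewrite subr_gt0.
have [r1 r10 Hr1] := powR_small p10 e10.
have [r2 r20 Hr2] := h_lim e10.
exists (Num.min r1 r2); first by rewrite lt_min r10.
move=> t w M K X xs hs; rewrite lt_min => /andP[M1 M2].
have w0 x : 0 <= w x.
  by have [/(state_pos hs)/ltW//|/(state_out hs) ->] := pselect (D x).
have M0 : 0 < M by have := state_pos hs (state_in hs); rewrite (state_max hs).
have aK := state_K hs; have K0 : 0 < K by exact: lt_le_trans aK.
have /andP[t0 t1] := state_t hs.
pose mu := t * lambda / K.
have mu0 : 0 <= mu by rewrite divr_ge0 ?mulr_ge0 ?(ltW lambda0) ?(ltW K0).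
have mu1 : mu <= lambda / a.
  apply: ler_pM; rewrite ?mulr_ge0 ?invr_ge0 ?(ltW lambda0) ?(ltW K0)//.
    by rewrite ler_piMl// ltW.
  by rewrite lef_pV2 ?posrE.
pose v x := M^-1 * w x.
have v0 x : 0 <= v x by rewrite mulr_ge0 ?invr_ge0 ?(ltW M0).
have v1 x : v x <= 1.
  by rewrite /v mulrC ler_pdivrMr// mul1r; exact: state_le hs _.
pose g x := M^-1 * - ((w x `^ p + t * h x (w x) (X x)) / K).
have Lv : Lap D v g by exact: (LapZ M^-1 (state_eq hs)).
have gmu x : D x -> `|g x - - mu * v x| <= 2 * e1 / a.
  move=> Dx; have wx := state_pos hs Dx; have wM := state_le hs x.
  have hw : `|h x (w x) (X x) / w x - lambda| < e1.
    by apply: Hr2 => //; rewrite wx; exact: le_lt_trans M2.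
  have wp : w x `^ p / M <= e1.
    rewrite ler_pdivrMr//; apply: le_trans (_ : M `^ p <= _).
      by rewrite ge0_ler_powR ?nnegrE ?(ltW wx) ?(ltW M0) ?(ltW p0).
    rewrite -(mulr_powRB1 (ltW M0) p0) mulrC ler_pM2r//; apply: ltW; apply: Hr1.
    by rewrite ltW.
  have -> : g x - - mu * v x = - ((w x `^ p / M + t * v x *
      (h x (w x) (X x) / w x - lambda)) / K).
    by rewrite /g /mu /v; field; rewrite !gt_eqF.
  rewrite normrN normrM normfV (gtr0_norm K0).
  apply: ler_pM => //; first by rewrite invr_ge0 ltW.
    apply: le_trans (ler_normD _ _) _.
    rewrite ger0_norm; last by rewrite divr_ge0 ?powR_ge0// ltW.
    suff : `|t * v x * (h x (w x) (X x) / w x - lambda)| <= e1 by lra.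
    rewrite normrM (ger0_norm (mulr_ge0 t0 (v0 x))); apply: le_trans (ltW hw).
    apply: ler_piMl => //; apply: le_trans (_ : 1 * 1 <= _); last by rewrite mulr1.
    exact: ler_pM.
  by rewrite lef_pV2 ?posrE.
have vD y : ~ D y -> v y = 0 by rewrite /v => /(state_out hs) ->; rewrite mulr0.
have cv : continuous v.
  by move=> x; apply: contZ; exact: (state_cont hs).
exists mu, v, g; split; [split|split] => //.
- by rewrite mu0.
- apply: (H v g 1 G d1) => //; last by rewrite d10 lexx.
  + by move=> x; rewrite ger0_norm.
  + move=> x Dx; rewrite (_ : g x = (g x - - mu * v x) + - mu * v x); last by ring.
    apply: le_trans (ler_normD _ _) _.
    have h1 := gmu x Dx.
    have h2 : `|- mu * v x| <= lambda / a.
      rewrite mulNr normrN (ger0_norm (mulr_ge0 mu0 (v0 x))); apply: le_trans mu1.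
      by rewrite ler_piMr.
    have h3 : 2 * e1 / a <= 2 / a by rewrite ler_pM2r ?invr_gt0// ler_piMr.
    by rewrite /G mulrDl; lra.
- by move=> y; rewrite v0 v1.
- by rewrite /v (state_max hs) mulVf// gt_eqF.
by move=> y Dy; exact: le_trans (gmu y Dy) e1e.
Qed.

Lemma lower_bound : exists2 r : R, 0 < r & forall t w M K X xs, st t w M K X xs -> r <= M.
Proof.
apply: contrapT => nr.
have small (r : R) : 0 < r -> exists t w M K X xs, st t w M K X xs /\ M < r.
  move=> r0; apply: contrapT => H; apply: nr; exists r => // t w M K X xs hs.
  by rewrite leNgt; apply/negP => rM; apply: H; exists t, w, M, K, X, xs.
have [B HB] := normalize.
have seq k : exists z : V * R * (V -> R) * (V -> R), D z.1.1.1 /\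
   [/\ 0 <= z.1.1.2 <= lambda / a, lip B z.1.2, forall y, 0 <= z.1.2 y <= 1,
     z.1.2 z.1.1.1 = 1 & forall y, ~ D y -> z.1.2 y = 0] /\
   (Lap D z.1.2 z.2 /\ forall y, D y -> `|z.2 y - - z.1.1.2 * z.1.2 y| <= k.+1%:R^-1).
  have [|r r0 Hr] := HB k.+1%:R^-1; first by rewrite invr_gt0.
  have [t [w [M [K [X [xs [hs rM]]]]]]] := small r r0.
  have [mu [v [g Hg]]] := Hr _ _ _ _ _ _ hs rM.
  by exists (xs, mu, v, g); split => //; exact: state_in hs.
have [z Hz] := choice seq.
pose xs k := (z k).1.1.1; pose mu k := (z k).1.1.2; pose v k := (z k).1.2; pose g k := (z k).2.
have Dxs k : D (xs k) by have [] := Hz k.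
have mua k : 0 <= mu k <= lambda / a by have [_ [[] ]] := Hz k.
have vL k : lip B (v k) by have [_ [[] ]] := Hz k.
have v01 k y : 0 <= v k y <= 1 by have [_ [[_ _ + _ _] _]] := Hz k; exact.
have v1 k : v k (xs k) = 1 by have [_ [[] ]] := Hz k.
have vD k y : ~ D y -> v k y = 0 by have [_ [[_ _ _ _ +] _]] := Hz k; exact.
have Lv k : Lap D (v k) (g k) by have [_ [_ []]] := Hz k.
have gv k y : D y -> `|g k y - - mu k * v k y| <= k.+1%:R^-1.
  by have [_ [_ [_ +]]] := Hz k; exact.
have [F [FU FN]] := nat_ultrafilter.
have FP : ProperFilter F by exact: ultra_proper.
have inv (e : R) : 0 < e -> \forall k \near F, k.+1%:R^-1 < e.
  by move=> e0; apply: FN; exact: (near_infty_natSinv_lt (PosNum e0)).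
have [||w [wl wL _ wu]] := @ultra_fun R n F FU v 1 B => //.
  by move=> k y; have /andP[? ?] := v01 k y; rewrite ger0_norm.
have w01 y : 0 <= w y <= 1 by exact: (ultra_unit (wl y) (fun k => v01 k y)).
have wD y : ~ D y -> w y = 0.
  move=> nDy; apply/eqP/negPn/negP => wy; have e0 : 0 < `|w y| by rewrite normr_gt0.
  by have [k] := filter_ex (wl y _ e0); rewrite vD// sub0r normrN ltxx.
have muB k : `|mu k| <= lambda / a by have /andP[m0 ?] := mua k; rewrite ger0_norm.
have [m _ ml] := @ultra_real R F FU mu (lambda / a) (filterE _ muB).
have ma : m <= lambda / a.
  by apply: (ultra_le ml); apply: filterE => k; have /andP[] := mua k.
have Lw : Lap D w (fun y => - m * w y).
  apply: (@Lap_ultra _ _ F _ _ _ _ v) => K cK KD e e0.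
  have m1 : 0 < `|m| + 1 by rewrite ltr_wpDl.
  have e3 : 0 < e / 3 by rewrite divr_gt0.
  have e4 : 0 < e / 3 / (`|m| + 1) by rewrite divr_gt0.
  apply: filterS2 (filterI (wu K cK _ e4) (wu K cK e e0)) (filterI (inv _ e3) (ml _ e3)).
  move=> k [h1 h2] [h3 h4]; exists D, (g k); split => // x Kx.
  have Dx := KD _ Kx.
  have -> : g k x - - m * w x = (g k x - - mu k * v k x) +
     (m * (w x - v k x) - (mu k - m) * v k x) by ring.
  have H1 := le_trans (gv k x Dx) (ltW h3).
  have H2 : `|m * (w x - v k x)| <= e / 3.
    rewrite normrM distrC; apply: le_trans (_ : (`|m| + 1) * `|v k x - w x| <= _).
      by rewrite ler_wpM2r// lerDl.
    by rewrite mulrC -ler_pdivlMr//; exact: h1.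
  have H3 : `|(mu k - m) * v k x| <= e / 3.
    have /andP[v0 v1'] := v01 k x.
    rewrite normrM (ger0_norm v0); apply: le_trans (ltW h4).
    by rewrite ler_piMr.
  have H4 := ler_normD (g k x - - mu k * v k x) (m * (w x - v k x) - (mu k - m) * v k x).
  have H5 := ler_normB (m * (w x - v k x)) ((mu k - m) * v k x).
  lra.
have cw : continuous w by move=> x; exact: lip_cont wL x.
have [C2 eqw] := @eigen_smooth R n m D w oD (fun x _ => cw x) Lw.
have [r Dr] : exists r : R, D `<=` cube 0 r.
  have [_ _ _ [r [_ Hr]] _] := hD; exists (r + 1) => x Dx; rewrite /cube /= subr0.
  by apply: (Hr (r + 1)) => //; rewrite ltrDl.
have [x _ xl] := ultra_rV (@cube_compact _ _ 0 r) (filterE _ (fun k => Dr _ (Dxs k))).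
(* The maximum survives in the limit, because the maximum points converge and the functions are
   uniformly Lipschitz; hence w is not zero. *)
have wx : w x = 1.
  apply/eqP/negPn/negP => wx; have e0 : 0 < `|1 - w x| / 2.
    by rewrite divr_gt0// normr_gt0 subr_eq0 eq_sym.
  have B1 : 0 < `|B| + 1 by rewrite ltr_wpDl.
  have e1 : 0 < `|1 - w x| / 2 / (`|B| + 1) by rewrite divr_gt0.
  have [k [/= h1 h2]] := filter_ex (filterI (wl x _ e0) (xl _ e1)).
  have H1 : `|v k (xs k) - v k x| < `|1 - w x| / 2.
    apply: le_lt_trans (vL k _ _) _.
    apply: le_lt_trans (_ : (`|B| + 1) * `|xs k - x| < _).
      by rewrite ler_wpM2r// (le_trans (ler_norm B))// lerDl.
    by rewrite mulrC -ltr_pdivlMr.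
  have := ler_normD (v k (xs k) - v k x) (v k x - w x).
  rewrite addrA subrK v1; apply/negP; rewrite -ltNge.
  by rewrite v1 in H1; lra.
have eig : dirichlet_eigenvalue D m.
  exists w; split.
  - split => //; first exact: continuous_subspaceT.
    by move=> y [_ nDy]; apply: wD => Dy; apply: nDy; exact: open_nbhs_nbhs.
  - exists x; last by rewrite wx oner_neq0.
    by apply: contrapT => /wD; rewrite wx => /eqP; rewrite oner_eq0.
  - by move=> y Dy; rewrite eqw// mulNr opprK.
(* [lambda1] is an infimum with default value 0: if the eigenvalues had no lower bound, [hlambda]
   would read lambda < 0. *)
have [lb|nlb] := pselect (has_lbound [set mu | dirichlet_eigenvalue D mu]).
  have : lambda1 D <= m by apply: ge_inf.
  have : lambda / a < lambda1 D by rewrite ltr_pdivrMr// mulrC.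
  lra.
move: hlambda; rewrite /lambda1 inf_out ?mulr0; first by move: lambda0; lra.
by move=> [_ ?].
Qed.
End lower_bound.

Theorem theorem3p8 (R : realType) (N : nat) (hN : (2 <= N)%N)
  (Omega : set 'rV[R]_N) (hOmega : bounded_smooth_domain Omega)
  (a b alpha p : R) (ha : 0 < a) (hb : 0 < b)
  (halpha0 : 0 < alpha)
  (halpha : (alpha%:E < (two_star R N - 1) * (2^-1)%:E)%E)
  (hp1 : 2 * alpha + 1 < p) (hp2 : (p%:E < two_star R N)%E)
  (h : 'rV[R]_N -> R -> 'rV[R]_N -> R)
  (h_holder : holder_pos Omega h)
  (h_ge0 : forall x s xi, closure Omega x -> 0 < s -> 0 <= h x s xi)
  (lambda : R) (hlambda0 : 0 < lambda)
  (h_lim : forall e : R, 0 < e -> exists2 d : R, 0 < d &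
     forall x s xi, closure Omega x -> 0 < s < d ->
       `|h x s xi / s - lambda| < e)
  (C q : R) (hC : 0 < C) (hq : 1 < q < p)
  (h_growth : forall x s xi, closure Omega x -> 0 < s ->
     `|h x s xi| <= C * (s + s `^ q))
  (hlambda : lambda < a * lambda1 Omega) :
  exists r S : R, [/\ 0 < r, 0 < S &
    forall (t : R) (u : 'rV[R]_N -> R),
      0 <= t <= 1 -> solution Omega a b alpha p h t u ->
      (r%:E <= supnorm Omega u <= S%:E)%E].
Proof.
have /andP[q1 qp] := hq.
have p1 : 1 < p by move: halpha0 hp1; lra.
(* One form of the subcriticality assumption for all N; for N = 2 it reads 0 < 4. *)
have pN : p * (N%:R - 2) < N%:R + 2.
  move: hp2; rewrite /two_star; case: eqP => [->|N2] => [_|].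
    by rewrite subrr mulr0 addr_gt0.
  rewrite lte_fin ltr_pdivlMr// subr_gt0 (ltr_nat R 2).
  by rewrite ltn_neqAle hN andbT eq_sym; exact/eqP.
have DC x : Omega x -> closure Omega x by exact: subset_closure.
have [c c0 Hc] := @solution_state R N Omega a b alpha p h hOmega (ltW hb) halpha0.
have [S S0 HS] := @upper_bound R N Omega a b alpha p h C q c hN hOmega ha
  halpha0 hp1 pN hC q1 qp c0 (fun x s xi Dx => h_growth x s xi (DC x Dx)).
have h_lim' (e : R) : 0 < e -> exists2 d : R, 0 < d &
    forall x s xi, Omega x -> 0 < s < d -> `|h x s xi / s - lambda| < e.
  by move=> /h_lim[d d0 Hd]; exists d => // x s xi /DC; exact: Hd.
have [r r0 Hr] := @lower_bound R N Omega a b alpha p h lambda c (ltnW hN) hOmega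
  ha p1 hlambda0 h_lim' hlambda.
exists r, S; split => // t u t01 sol.
have [w [M [K [X [xs [st ->]]]]]] := Hc t u t01 sol ha.
by rewrite !lee_fin (Hr _ _ _ _ _ _ st) (HS _ _ _ _ _ _ st).
Qed.
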